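(* For each $a>0$, let $$\alpha_a(x)=a^{-1}e^x,\qquad w_a(x)=\pi^{-1/2}a^{-1/2}\bigl(1-2e^{x/2}F(e^{x/2})\bigr)e^{x/2}.$$ For an arbitrary but fixed $\delta\in(0,1)$, let $h_a$ be chosen such that $$0<h_a\le\frac{2\pi^2}{3\ln\bigl(1+10\frac{1+a}{\delta}\bigr)}$$ and set $$n_a^+=n_a^+(\delta)=\Bigl\lceil2h_a^{-1}\ln\bigl(\sqrt a\,\operatorname{erfc}^{-1}(\delta/2)\bigr)\Bigr\rceil.$$ Then, defining $$\Phi_{a,n}(s)=\sum_{k=-n}^{n_a^+}h_aw_a(kh_a)e^{-\alpha_a(kh_a)s},\qquad\Phi_{a,\infty}(s)=\lim_{n\to\infty}\Phi_{a,n}(s),$$ one has $$\Bigl|\frac{\sqrt s}{s+a}-\Phi_{a,\infty}(s)\Bigr|\le\delta\frac{\sqrt s}{s+a}\quad\text{for all }s\in[1,\infty).$$ For any $\eta>0$ and $K>1$, provided that $$n\ge\min\Bigl\{n\in\mathbb N_0:\max\bigl\{f_a(1,h_an),f_a(K,h_an)\bigr\}\le\min\{\delta/2,\eta\}\Bigr\},$$ where $$f_a(s,y)=2\sqrt{\frac{a}{s\pi}}\,e^{-\frac sae^{-y}}F\bigl(e^{-y/2}\bigr)+\operatorname{erf}\Bigl(\sqrt{\frac sa}\,e^{-y/2}\Bigr),$$ one has in addition $$\Bigl|\frac{\sqrt s}{s+a}-\Phi_{a,n}(s)\Bigr|\le\delta\frac{\sqrt s}{s+a}\quad\text{for all }s\in[1,K],$$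 $$\bigl|\Phi_{a,\infty}(s)-\Phi_{a,n}(s)\bigr|\le\eta\frac{\sqrt s}{s+a}\quad\text{for all }s\in[1,K].$$
   Context: $F$ denotes the Dawson function $F(x)=e^{-x^2}\int_0^xe^{s^2}\,ds$. $\operatorname{erf}$ is the error function, $\operatorname{erfc}=1-\operatorname{erf}$, and $\operatorname{erfc}^{-1}$ its inverse function. $n\in\mathbb N_0$. *)

(* Defs.v *)
From Stdlib Require Export Reals ZArith Zfloor.
From Coquelicot Require Export Coquelicot.
From Stdlib Require Import Lra.
Open Scope R_scope.

Definition dawson (x : R) : R :=
  exp (- x ^ 2) * RInt (fun s => exp (s ^ 2)) 0 x.

Definition erf (x : R) : R :=
  2 / sqrt PI * RInt (fun t => exp (- t ^ 2)) 0 x.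

Definition erfc (x : R) : R := 1 - erf x.

(* [iota] is definite description; [erfc_inv] is meaningful on the range
   (0, 2) of the injective function [erfc], cf. [erfc_invE]. *)
Definition erfc_inv (y : R) : R := iota (fun x : R => erfc x = y).

Lemma erf_lt (x y : R) : x < y -> erf x < erf y.
Proof.
  intros Hxy.
  assert (C : forall u : R, continuous (fun t => exp (- t ^ 2)) u).
  { intros u. apply (ex_derive_continuous (fun t => exp (- t ^ 2))).
    now auto_derive. }
  assert (E : forall u v : R, ex_RInt (fun t => exp (- t ^ 2)) u v).
  { intros u v. apply (ex_RInt_continuous (V := R_CompleteNormedModule)).
    intros t _. apply C. }
  unfold erf. apply Rmult_lt_compat_l.
  - apply Rdiv_lt_0_compat; [lra | apply sqrt_lt_R0, PI_RGT_0].
  - rewrite <- (RInt_Chasles (fun t => exp (- t ^ 2)) 0 x y) by apply E.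
    assert (H : 0 < RInt (fun t => exp (- t ^ 2)) x y).
    { apply RInt_gt_0; [exact Hxy | intros; apply exp_pos | intros; apply C]. }
    unfold plus; simpl. simpl in H. lra.
Qed.

Lemma erfc_invE (x : R) : erfc_inv (erfc x) = x.
Proof.
  apply (iota_unique (fun z : R => erfc z = erfc x)); [ | reflexivity].
  intros y Hy. unfold erfc in Hy.
  destruct (Rtotal_order y x) as [H | [H | H]]; [ | exact H | ];
    apply erf_lt in H; lra.
Qed.

(* Sum of [f k] over the integers [lo <= k <= hi]; it is 0 when [hi < lo]. *)
Definition sum_Z (f : Z -> R) (lo hi : Z) : R :=
  sum_n_m (fun i : nat => f (lo - 1 + Z.of_nat i)%Z) 1 (Z.to_nat (hi - lo + 1)).

Definition is_min_nat (P : nat -> Prop) (m : nat) : Prop :=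
  P m /\ forall k : nat, P k -> (m <= k)%nat.

Definition alpha (a x : R) : R := / a * exp x.

Definition w (a x : R) : R :=
  / sqrt PI * / sqrt a * (1 - 2 * exp (x / 2) * dawson (exp (x / 2)))
  * exp (x / 2).

Definition n_plus (a delta h : R) : Z :=
  Zceil (2 * / h * ln (sqrt a * erfc_inv (delta / 2))).

Definition Phi (a delta h : R) (n : nat) (s : R) : R :=
  sum_Z (fun k => h * w a (IZR k * h) * exp (- alpha a (IZR k * h) * s))
    (- Z.of_nat n) (n_plus a delta h).

(* [Lim_seq] is total; convergence is [ex_finite_lim_seq]. *)
Definition Phi_inf (a delta h s : R) : R :=
  real (Lim_seq (fun n => Phi a delta h n s)).

Definition f_trunc (a s y : R) : R :=
  2 * sqrt (a / (s * PI)) * exp (- (s / a) * exp (- y)) * dawson (exp (- y / 2))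
  + erf (sqrt (s / a) * exp (- y / 2)).

(* Main.v *)
Require Import Defs.
From Stdlib Require Import Reals Lra Lia Psatz Wf_nat.
From Coquelicot Require Import Coquelicot.
Open Scope R_scope.

(** Put p = s / a. Divided by sqrt s / (s + a), the summands are h times the samples of
    a function dens p of total integral 1. It is a combination of functions
    e^{b x - q e^x}, which are positive and extend analytically to |Im x| <= pi / 3.
    Moving the line of integration bounds their Fourier coefficients, and by positivity
    Fejer means turn this into a bound, at most 0.32 delta, for the error of the
    bilateral trapezoidal sum.

    The cutoff on the right can raise the sum by the negative part of dens that is lost; an
    explicit decreasing majorant of - dens shows that this loss and the trapezoidal error
    together are at most delta. From below the bound must be 1 - delta / 2, since the
    truncation on the left takes the other delta / 2. If dens still increases at the
    cutoff, the sum dominates the integral up to the cutoff, which is at least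
    erf E = 1 - delta / 2 with E = erfc_inv (delta / 2). Otherwise dens decays
    log-concavely beyond the cutoff as long as it is positive; the lost integral is at most
    erfc E = delta / 2, and the lost Riemann sum is smaller than it by enough to absorb the
    trapezoidal error.

    To the left of the truncation index dens is positive and increasing, so the left tail
    of the sum is at most its integral f_trunc. As a function of s, f_trunc first
    decreases and then increases, so its values at 1 and K suffice. *)

(** * The Gaussian integral *)

(** The lower bound shapes the proof. The cutoff is such that the lost integral may use all of
    $\operatorname{erfc} E = \delta/2$, and the left truncation uses the other half, so nothing is
    reserved for the trapezoidal error. It has to be paid from the gap between the lost integral and
    the lost sum, whose nodes are the right ends of their cells. As $h \to 0$ this gap closes only
    polynomially while the error falls like $e^{-2\pi^2/(3h)}$; but for $h$ near its upper limit
    both have the same size, and only explicit constants on a division into boxes can decide.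

    On the strip of height $\pi/3$ one has $\cos y \ge 1/2$, so moving the line merely replaces $q$
    by $q/2$: a factor $\sqrt 2$ for $b = 1/2$ and $2\sqrt 2$ for $b = 3/2$. Frequency $2\pi n/h$ is
    damped by $X^{-n}$ with $X = e^{2\pi^2/(3h)}$, and the assumption on $h$ says $X - 1 \ge
    10(1+a)/\delta$. Since $s \ge 1$, the right side is at least $10(1 + 1/p)/\delta$, which matches
    the growth in $1/p$ of the error bound. *)

Ltac eqR := match goal with |- @eq _ ?a ?b => change (@eq R a b) end.

Ltac pos :=
  first
    [ assumption | lra
    | match goal with
      | |- ?x > 0 => change (0 < x); pos
      | |- 0 < ?x => is_var x; unfold x; pos
      | |- 0 <= ?x => is_var x; unfold x; pos
      | |- 0 < exp _ => apply exp_pos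
      | |- 0 < PI => apply PI_RGT_0
      | |- 0 < sqrt _ => apply sqrt_lt_R0; pos
      | |- 0 < _ * _ => apply Rmult_lt_0_compat; pos
      | |- 0 < _ / _ => apply Rdiv_lt_0_compat; pos
      | |- 0 < / _ => apply Rinv_0_lt_compat; pos
      | |- 0 < _ ^ _ => apply pow_lt; pos
      | |- 0 <= _ * _ => apply Rmult_le_pos; pos
      | |- 0 <= _ / _ => apply Rdiv_le_0_compat; pos
      | |- 0 <= _ ^ _ => apply pow_le; pos
      | |- 0 <= _ => apply Rlt_le; pos
      end ].

Ltac smooth :=
  match goal with |- continuous ?f _ => apply (ex_derive_continuous f); now auto_derive end.

Lemma derive_nonneg_le (f f' : R -> R) (a b : R) :
  a <= b ->
  (forall x, a <= x <= b -> is_derive f x (f' x)) ->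
  (forall x, a <= x <= b -> 0 <= f' x) ->
  f a <= f b.
Proof.
  intros Hab Hd Hp.
  destruct (MVT_gen f a b f') as [c [Hc He]].
  - intros x Hx. rewrite Rmin_left, Rmax_right in Hx by lra. apply Hd; lra.
  - intros x Hx. rewrite Rmin_left, Rmax_right in Hx by lra.
    apply continuity_pt_filterlim, (ex_derive_continuous f).
    exists (f' x). apply Hd; lra.
  - rewrite Rmin_left, Rmax_right in Hc by lra.
    assert (0 <= f' c * (b - a)) by (apply Rmult_le_pos; [apply Hp | ]; lra).
    lra.
Qed.

Lemma derive_nonpos_le (f f' : R -> R) (a b : R) :
  a <= b ->
  (forall x, a <= x <= b -> is_derive f x (f' x)) ->
  (forall x, a <= x <= b -> f' x <= 0) ->
  f b <= f a.
Proof.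
  intros Hab Hd Hp.
  enough (- f a <= - f b) by lra.
  apply (derive_nonneg_le (fun x => - f x) (fun x => - f' x)); [exact Hab | | ].
  - intros x Hx. apply (is_derive_opp f), Hd, Hx.
  - intros x Hx. specialize (Hp x Hx). lra.
Qed.

Lemma derive_nonpos_lim0_ge0 (f f' : R -> R) (a : R) :
  (forall x, a <= x -> is_derive f x (f' x)) ->
  (forall x, a <= x -> f' x <= 0) ->
  is_lim f p_infty 0 ->
  0 <= f a.
Proof.
  intros Hd Hp Hl.
  apply (is_lim_le_loc f (fun _ => f a) p_infty 0 (f a)); [ | exact Hl | apply is_lim_const].
  exists a. intros y Hy.
  apply (derive_nonpos_le f f'); [lra | | ]; intros x Hx; [apply Hd | apply Hp]; lra.
Qed.

Lemma div_le_of_le_mul (a b c : R) : 0 < c -> a <= b * c -> a / c <= b.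
Proof.
  intros Hc H. apply Rmult_le_reg_r with c; [exact Hc | ].
  unfold Rdiv. rewrite Rmult_assoc, Rinv_l, Rmult_1_r; lra.
Qed.

Lemma le_div_of_mul_le (a b c : R) : 0 < c -> a * c <= b -> a <= b / c.
Proof.
  intros Hc H. apply Rmult_le_reg_r with c; [exact Hc | ].
  unfold Rdiv. rewrite Rmult_assoc, Rinv_l, Rmult_1_r; lra.
Qed.

Lemma exp_le_mono (x y : R) : x <= y -> exp x <= exp y.
Proof. intros [H | ->]; [left; now apply exp_increasing | lra]. Qed.

Lemma exp_neg_le_inv (y : R) : 0 <= y -> exp (- y) <= / (1 + y).
Proof.
  intros Hy. rewrite exp_Ropp. apply Rinv_le_contravar; [lra | apply exp_ineq1_le].
Qed.

Lemma exp_quad_le (y : R) : 0 <= y -> 1 + y + y ^ 2 / 2 <= exp y.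
Proof.
  intros Hy.
  enough (0 <= exp y - 1 - y - y ^ 2 / 2) by lra.
  replace 0 with (exp 0 - 1 - 0 - 0 ^ 2 / 2) by (rewrite exp_0; field).
  apply (derive_nonneg_le (fun y => exp y - 1 - y - y ^ 2 / 2) (fun y => exp y - 1 - y)).
  - exact Hy.
  - intros x _. auto_derive; [exact I | field].
  - intros x _. generalize (exp_ineq1_le x). lra.
Qed.

Lemma Rbar_mult_pos_p_infty (c : R) : 0 < c -> Rbar_mult c p_infty = p_infty.
Proof. intros Hc. apply is_Rbar_mult_unique, is_Rbar_mult_sym, is_Rbar_mult_p_infty_pos. exact Hc. Qed.

Lemma is_lim_exp_neg_sqr : is_lim (fun x => exp (- x ^ 2)) p_infty 0.
Proof.
  apply (is_lim_le_le_loc (fun _ => 0) (fun x => / x)).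
  - exists 1. intros x Hx. split; [pos | ].
    eapply Rle_trans; [apply exp_neg_le_inv; nra | ].
    apply Rinv_le_contravar; nra.
  - apply is_lim_const.
  - apply (is_lim_inv (fun x => x) p_infty p_infty); [apply is_lim_id | discriminate].
Qed.

Lemma continuous_exp_neg_sqr (x : R) : continuous (fun t => exp (- t ^ 2)) x.
Proof. smooth. Qed.

Lemma ex_RInt_everywhere (f : R -> R) (a b : R) :
  (forall x, continuous f x) -> ex_RInt f a b.
Proof. intros H. apply (ex_RInt_continuous (V := R_CompleteNormedModule)). auto. Qed.

Lemma is_derive_mult_R (f g : R -> R) (x df dg : R) :
  is_derive f x df -> is_derive g x dg ->
  is_derive (fun x => f x * g x) x (df * g x + f x * dg).
Proof. intros Hf Hg. apply (is_derive_mult f g); [exact Hf | exact Hg | intros; apply Rmult_comm]. Qed.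

Lemma RInt_ext_R (f g : R -> R) (a b : R) :
  (forall x, f x = g x) -> RInt f a b = RInt g a b.
Proof. intros H. apply RInt_ext. intros; apply H. Qed.

Lemma RInt_scal_R (f : R -> R) (c a b : R) :
  ex_RInt f a b -> RInt (fun t => c * f t) a b = c * RInt f a b.
Proof. intros H. exact (RInt_scal f a b c H). Qed.

Lemma RInt_plus_R (f g : R -> R) (a b : R) :
  ex_RInt f a b -> ex_RInt g a b -> RInt (fun t => f t + g t) a b = RInt f a b + RInt g a b.
Proof. intros Hf Hg. exact (RInt_plus f g a b Hf Hg). Qed.

Lemma RInt_minus_R (f g : R -> R) (a b : R) :
  ex_RInt f a b -> ex_RInt g a b -> RInt (fun t => f t - g t) a b = RInt f a b - RInt g a b.
Proof. intros Hf Hg. exact (RInt_minus f g a b Hf Hg). Qed.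

Lemma RInt_Chasles_R (f : R -> R) (a b c : R) :
  ex_RInt f a b -> ex_RInt f b c -> RInt f a b + RInt f b c = RInt f a c.
Proof. intros H1 H2. exact (RInt_Chasles f a b c H1 H2). Qed.

Lemma RInt_comp_lin_R (f : R -> R) (u v a b : R) :
  ex_RInt f (u * a + v) (u * b + v) ->
  RInt (fun y => u * f (u * y + v)) a b = RInt f (u * a + v) (u * b + v).
Proof. intros H. exact (RInt_comp_lin f u v a b H). Qed.

Lemma is_derive_RInt_upper (f : R -> R) (a x : R) :
  (forall y, continuous f y) -> is_derive (fun y => RInt f a y) x (f x).
Proof.
  intros H. apply (is_derive_RInt f (fun y => RInt f a y) a x); [ | apply H].
  apply filter_forall. intros y. apply (RInt_correct (V := R_CompleteNormedModule)).
  now apply ex_RInt_everywhere.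
Qed.

Definition gauss (x : R) : R := RInt (fun t => exp (- t ^ 2)) 0 x.

Lemma is_derive_gauss (x : R) : is_derive gauss x (exp (- x ^ 2)).
Proof. apply (is_derive_RInt_upper (fun t => exp (- t ^ 2))), continuous_exp_neg_sqr. Qed.

Lemma gauss_0 : gauss 0 = 0.
Proof. exact (RInt_point 0 (fun t => exp (- t ^ 2))). Qed.

Lemma gauss_ge0 (x : R) : 0 <= x -> 0 <= gauss x.
Proof.
  intros Hx. rewrite <- gauss_0.
  apply (derive_nonneg_le gauss (fun x => exp (- x ^ 2))); [exact Hx | | ].
  - intros; apply is_derive_gauss.
  - intros; pos.
Qed.

(* The sum of [gauss x ^ 2] and [gauss_aux x] is constant. *)
Definition gauss_aux (x : R) : R :=
  RInt (fun t => exp (- (x ^ 2 * (1 + t ^ 2))) / (1 + t ^ 2)) 0 1.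

Lemma one_plus_sqr_neq_0 (t : R) : 1 + t ^ 2 <> 0.
Proof. nra. Qed.

Lemma continuous_gauss_aux (x t : R) :
  continuous (fun t => exp (- (x ^ 2 * (1 + t ^ 2))) / (1 + t ^ 2)) t.
Proof.
  apply (ex_derive_continuous (fun t => exp (- (x ^ 2 * (1 + t ^ 2))) / (1 + t ^ 2))).
  auto_derive. apply one_plus_sqr_neq_0.
Qed.

(** Differentiation under the integral cancels the denominator $1 + t^2$, and the substitution $s =
    x t$ turns the rest into [gauss x], so the result is minus the derivative of [gauss x ^ 2]. *)
Lemma is_derive_gauss_aux (x : R) :
  is_derive gauss_aux x (- 2 * exp (- x ^ 2) * gauss x).
Proof.
  assert (HD : forall t y, is_derive (fun u => exp (- (u ^ 2 * (1 + t ^ 2))) / (1 + t ^ 2)) y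
                 (- 2 * y * exp (- (y ^ 2 * (1 + t ^ 2))))).
  { intros t y. pose proof (one_plus_sqr_neq_0 t).
    auto_derive; [repeat split; simpl in *; nra | simpl; field; simpl in *; nra]. }
  assert (HI : RInt (fun t => Derive (fun u => exp (- (u ^ 2 * (1 + t ^ 2))) / (1 + t ^ 2)) x) 0 1
               = - 2 * exp (- x ^ 2) * gauss x).
  { transitivity (RInt (fun t => - 2 * exp (- x ^ 2) * (x * exp (- (x * t + 0) ^ 2))) 0 1).
    { apply RInt_ext_R. intros t. etransitivity; [apply is_derive_unique, HD | ].
      replace (- (x ^ 2 * (1 + t ^ 2))) with (- x ^ 2 + - (x * t + 0) ^ 2) by ring.
      rewrite exp_plus. ring. }
    rewrite RInt_scal_R.
    + rewrite (RInt_comp_lin_R (fun t => exp (- t ^ 2)) x 0 0 1).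
      * unfold gauss. replace (x * 0 + 0) with 0 by ring. replace (x * 1 + 0) with x by ring. eqR. ring.
      * apply ex_RInt_everywhere, continuous_exp_neg_sqr.
    + apply ex_RInt_everywhere. intros t.
      smooth. }
  rewrite <- HI.
  apply (is_derive_RInt_param (fun u t => exp (- (u ^ 2 * (1 + t ^ 2))) / (1 + t ^ 2)) 0 1 x).
  - apply filter_forall. intros y t _. eexists. apply HD.
  - intros t _.
      apply (continuity_2d_pt_ext (fun u v => - 2 * u * exp (- (u ^ 2 * (1 + v ^ 2))))).
      { intros u v. symmetry. apply is_derive_unique, HD. }
      apply continuity_2d_pt_mult.
      { apply continuity_2d_pt_mult; [apply continuity_2d_pt_const | apply continuity_2d_pt_id1]. }
      apply (continuity_1d_2d_pt_comp exp (fun u v => - (u ^ 2 * (1 + v ^ 2)))).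
      { apply derivable_continuous_pt, derivable_pt_exp. }
      apply continuity_2d_pt_opp, continuity_2d_pt_mult.
      { apply (continuity_1d_2d_pt_comp (fun u => u ^ 2) (fun u v => u)); [ | apply continuity_2d_pt_id1].
        apply derivable_continuous_pt, derivable_pt_pow. }
      apply continuity_2d_pt_plus; [apply continuity_2d_pt_const | ].
      apply (continuity_1d_2d_pt_comp (fun u => u ^ 2) (fun u v => v)); [ | apply continuity_2d_pt_id2].
      apply derivable_continuous_pt, derivable_pt_pow.
  - apply filter_forall. intros y.
      apply ex_RInt_everywhere. intros t. apply continuous_gauss_aux.
Qed.

Lemma gauss_sqr (x : R) : gauss x ^ 2 + gauss_aux x = PI / 4.
Proof.
  assert (H0 : gauss 0 ^ 2 + gauss_aux 0 = PI / 4).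
  { rewrite gauss_0. unfold gauss_aux.
    transitivity (RInt (fun t => / (1 + t ^ 2)) 0 1).
    - rewrite pow_ne_zero, Rplus_0_l by lia. apply RInt_ext_R. intros t.
      replace (- (0 * (1 + t ^ 2))) with 0 by ring. rewrite exp_0.
      field. apply one_plus_sqr_neq_0.
    - rewrite <- atan_1. apply is_RInt_unique.
      replace (atan 1) with (atan 1 - atan 0) by (rewrite atan_0; apply Rminus_0_r).
      apply (is_RInt_derive atan (fun t => / (1 + t ^ 2))).
      + intros t _. apply is_derive_Reals.
        pose proof (derivable_pt_lim_atan t) as Ht. unfold Rsqr in Ht.
        replace (t * t) with (t ^ 2) in Ht by ring. exact Ht.
      + intros t _. apply (ex_derive_continuous (fun t => / (1 + t ^ 2))).
        auto_derive. apply one_plus_sqr_neq_0. }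
  rewrite <- H0.
  set (f := fun x => gauss x ^ 2 + gauss_aux x). change (f x = f 0).
  assert (Hd : forall y, is_derive f y 0).
  { intros y. unfold f.
    replace 0 with (INR 2 * exp (- y ^ 2) * gauss y ^ (pred 2) + (- 2 * exp (- y ^ 2) * gauss y)) by (simpl; ring).
    apply (is_derive_plus (fun x => gauss x ^ 2) gauss_aux); [ | apply is_derive_gauss_aux].
    apply (is_derive_pow gauss 2), is_derive_gauss. }
  destruct (Rtotal_order 0 x) as [H | [<- | H]]; [symmetry | reflexivity | ];
    apply (eq_is_derive f); auto.
Qed.

Lemma gauss_aux_bounds (x : R) : 0 <= gauss_aux x <= exp (- x ^ 2).
Proof.
  unfold gauss_aux. split.
  - apply RInt_ge_0; [lra | apply ex_RInt_everywhere, continuous_gauss_aux | ].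
    intros t _. apply Rdiv_le_0_compat; [pos | nra].
  - apply Rle_trans with (RInt (fun _ => exp (- x ^ 2)) 0 1).
    + apply RInt_le; [lra | apply ex_RInt_everywhere, continuous_gauss_aux | apply ex_RInt_const | ].
      intros t _. rewrite <- (Rmult_1_r (exp (- x ^ 2))). unfold Rdiv.
      apply Rmult_le_compat; [pos | left; apply Rinv_0_lt_compat; nra | | ].
      * apply exp_le_mono. nra.
      * rewrite <- Rinv_1. apply Rinv_le_contravar; nra.
    + rewrite RInt_const. unfold scal; simpl; unfold mult; simpl. lra.
Qed.

Lemma sqrt_PI_pos : 0 < sqrt PI.
Proof. apply sqrt_lt_R0, PI_RGT_0. Qed.

Lemma is_lim_gauss : is_lim gauss p_infty (sqrt PI / 2).
Proof.
  assert (Hs : sqrt (PI / 4) = sqrt PI / 2).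
  { rewrite sqrt_div_alt by lra. f_equal. replace 4 with (2 ^ 2) by ring. apply sqrt_pow2. lra. }
  rewrite <- Hs.
  apply (is_lim_ext_loc (fun x => sqrt (PI / 4 - gauss_aux x))).
  - exists 0. intros x Hx. rewrite <- (gauss_sqr x).
    replace (gauss x ^ 2 + gauss_aux x - gauss_aux x) with (gauss x ^ 2) by ring.
    apply sqrt_pow2, gauss_ge0. lra.
  - apply is_lim_comp_continuous.
    + replace (Finite (PI / 4)) with (Finite (PI / 4 - 0)) by (f_equal; ring).
      apply (is_lim_minus' (fun _ => PI / 4) gauss_aux p_infty (PI / 4) 0); [apply is_lim_const | ].
      apply (is_lim_le_le_loc (fun _ => 0) (fun x => exp (- x ^ 2))).
      * exists 0. intros x _. apply gauss_aux_bounds.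
      * apply is_lim_const.
      * apply is_lim_exp_neg_sqr.
    + apply continuous_sqrt.
Qed.

Lemma erf_gauss (x : R) : erf x = 2 / sqrt PI * gauss x.
Proof. reflexivity. Qed.

Lemma is_derive_erf (x : R) : is_derive erf x (2 / sqrt PI * exp (- x ^ 2)).
Proof. apply (is_derive_scal gauss), is_derive_gauss. Qed.

Lemma erf_0 : erf 0 = 0.
Proof. rewrite erf_gauss, gauss_0. ring. Qed.

Lemma is_lim_erf : is_lim erf p_infty 1.
Proof.
  pose proof sqrt_PI_pos.
  replace (Finite 1) with (Rbar_mult (2 / sqrt PI) (sqrt PI / 2)).
  - apply is_lim_scal_l, is_lim_gauss.
  - simpl. f_equal. field. lra.
Qed.

Lemma is_lim_erfc : is_lim erfc p_infty 0.
Proof.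
  replace 0 with (1 - 1) by ring.
  apply (is_lim_minus' (fun _ => 1) erf); [apply is_lim_const | apply is_lim_erf].
Qed.

Lemma is_derive_erfc (x : R) : is_derive erfc x (- (2 / sqrt PI * exp (- x ^ 2))).
Proof.
  unfold erfc. replace (- (2 / sqrt PI * exp (- x ^ 2))) with (0 - 2 / sqrt PI * exp (- x ^ 2)) by ring.
  apply (is_derive_minus (fun _ => 1) erf); [apply (is_derive_const 1) | apply is_derive_erf].
Qed.

Lemma erf_le (x y : R) : x <= y -> erf x <= erf y.
Proof. intros [H | ->]; [left; now apply erf_lt | lra]. Qed.

Lemma erf_le_1 (x : R) : erf x <= 1.
Proof.
  apply (is_lim_le_loc (fun _ => erf x) erf p_infty (erf x) 1); [ | apply is_lim_const | apply is_lim_erf].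
  exists x. intros y Hy. apply erf_le. lra.
Qed.

(** Both sides vanish at infinity, so it is enough that their difference decreases; with this
    rational factor the derivative collapses to $-4 e^{-x^2}/(1+2x^2)^2$. The same scheme proves
    [erfc_upper]. *)
Lemma erfc_lower (x : R) : 0 <= x -> 2 * x * exp (- x ^ 2) / (1 + 2 * x ^ 2) <= sqrt PI * erfc x.
Proof.
  intros Hx. pose proof sqrt_PI_pos as Hpi.
  enough (0 <= sqrt PI * erfc x - 2 * x * exp (- x ^ 2) / (1 + 2 * x ^ 2)) by lra.
  apply (derive_nonpos_lim0_ge0
    (fun x => sqrt PI * erfc x - 2 * x * exp (- x ^ 2) / (1 + 2 * x ^ 2))
    (fun x => - 4 * exp (- x ^ 2) / (1 + 2 * x ^ 2) ^ 2)).
  - intros y _.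
    replace (- 4 * exp (- y ^ 2) / (1 + 2 * y ^ 2) ^ 2) with
      (sqrt PI * - (2 / sqrt PI * exp (- y ^ 2)) -
       (- 2 * exp (- y ^ 2) + 4 * exp (- y ^ 2) / (1 + 2 * y ^ 2) ^ 2)) by (field; split; nra).
    apply (is_derive_minus (fun x => sqrt PI * erfc x)).
    + apply (is_derive_scal erfc), is_derive_erfc.
    + auto_derive; [simpl; nra | simpl; field; nra].
  - intros y _.
    assert (0 <= exp (- y ^ 2) / (1 + 2 * y ^ 2) ^ 2).
    { apply Rdiv_le_0_compat; [pos | apply pow_lt; nra]. }
    lra.
  - replace (Finite 0) with (Finite (sqrt PI * 0 - 0)) by (f_equal; ring).
    apply (is_lim_minus' (fun x => sqrt PI * erfc x)).
    + apply (is_lim_scal_l erfc (sqrt PI) p_infty 0), is_lim_erfc.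
    + apply (is_lim_le_le_loc (fun _ => 0) (fun x => exp (- x ^ 2))).
      * exists 1. intros y Hy. pose proof (exp_pos (- y ^ 2)). split.
        -- apply Rdiv_le_0_compat; nra.
        -- apply div_le_of_le_mul; [nra | ].
           assert (0 <= exp (- y ^ 2) * (1 + 2 * y ^ 2 - 2 * y)) by (apply Rmult_le_pos; nra). nra.
      * apply is_lim_const.
      * apply is_lim_exp_neg_sqr.
Qed.

Lemma erfc_upper (x : R) : 0 < x -> sqrt PI * erfc x <= exp (- x ^ 2) / x.
Proof.
  intros Hx. pose proof sqrt_PI_pos as Hpi.
  enough (0 <= exp (- x ^ 2) / x - sqrt PI * erfc x) by lra.
  apply (derive_nonpos_lim0_ge0
    (fun x => exp (- x ^ 2) / x - sqrt PI * erfc x)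
    (fun x => - (exp (- x ^ 2) / x ^ 2))).
  - intros y Hy.
    replace (- (exp (- y ^ 2) / y ^ 2)) with
      ((- 2 * exp (- y ^ 2) - exp (- y ^ 2) / y ^ 2) - sqrt PI * - (2 / sqrt PI * exp (- y ^ 2)))
      by (field; split; nra).
    apply (is_derive_minus (fun x => exp (- x ^ 2) / x) (fun x => sqrt PI * erfc x)).
    + auto_derive; [simpl; nra | simpl; field; nra].
    + apply (is_derive_scal erfc), is_derive_erfc.
  - intros y Hy.
    assert (0 <= exp (- y ^ 2) / y ^ 2).
    { apply Rdiv_le_0_compat; [pos | pos]. }
    lra.
  - replace (Finite 0) with (Finite (0 - sqrt PI * 0)) by (f_equal; ring).
    apply (is_lim_minus' (fun x => exp (- x ^ 2) / x) (fun x => sqrt PI * erfc x)).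
    + apply (is_lim_le_le_loc (fun _ => 0) (fun x => exp (- x ^ 2))).
      * exists 1. intros y Hy. pose proof (exp_pos (- y ^ 2)). split.
        -- apply Rdiv_le_0_compat; nra.
        -- apply div_le_of_le_mul; nra.
      * apply is_lim_const.
      * apply is_lim_exp_neg_sqr.
    + apply (is_lim_scal_l erfc (sqrt PI) p_infty 0), is_lim_erfc.
Qed.

Lemma exp_neg_taylor3_le (y : R) : 0 <= y -> 1 - y + y ^ 2 / 2 - y ^ 3 / 6 <= exp (- y) <= 1 - y + y ^ 2 / 2.
Proof.
  intros Hy.
  assert (H1 : forall y, 0 <= y -> 1 - y <= exp (- y)) by (intros z _; generalize (exp_ineq1_le (- z)); lra).
  assert (H2 : forall y, 0 <= y -> exp (- y) <= 1 - y + y ^ 2 / 2).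
  { intros z Hz.
    enough (0 <= 1 - z + z ^ 2 / 2 - exp (- z)) by lra.
    replace 0 with (1 - 0 + 0 ^ 2 / 2 - exp (- 0)) by (rewrite Ropp_0, exp_0; field).
    apply (derive_nonneg_le (fun z => 1 - z + z ^ 2 / 2 - exp (- z)) (fun z => - 1 + z + exp (- z))).
    - exact Hz.
    - intros x _. auto_derive; [exact I | field].
    - intros x Hx. specialize (H1 x ltac:(lra)). lra. }
  split; [ | apply H2, Hy].
  enough (0 <= exp (- y) - (1 - y + y ^ 2 / 2 - y ^ 3 / 6)) by lra.
  replace 0 with (exp (- 0) - (1 - 0 + 0 ^ 2 / 2 - 0 ^ 3 / 6)) by (rewrite Ropp_0, exp_0; field).
  apply (derive_nonneg_le (fun z => exp (- z) - (1 - z + z ^ 2 / 2 - z ^ 3 / 6)) (fun z => 1 - z + z ^ 2 / 2 - exp (- z))).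
  - exact Hy.
  - intros x _. auto_derive; [exact I | field].
  - intros x Hx. specialize (H2 x ltac:(lra)). lra.
Qed.

Lemma gauss_taylor (x : R) : 0 <= x ->
  x - x ^ 3 / 3 <= gauss x <= x - x ^ 3 / 3 + x ^ 5 / 10.
Proof.
  intros Hx. split.
  - enough (0 <= gauss x - (x - x ^ 3 / 3)) by lra.
    replace 0 with (gauss 0 - (0 - 0 ^ 3 / 3)) by (rewrite gauss_0; field).
    apply (derive_nonneg_le (fun x => gauss x - (x - x ^ 3 / 3)) (fun x => exp (- x ^ 2) - (1 - x ^ 2))); [exact Hx | | ].
    + intros y _. apply (is_derive_minus gauss (fun x => x - x ^ 3 / 3)); [apply is_derive_gauss | ].
      auto_derive; [exact I | simpl; field].
    + intros y _. generalize (exp_ineq1_le (- y ^ 2)). lra.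
  - enough (0 <= (x - x ^ 3 / 3 + x ^ 5 / 10) - gauss x) by lra.
    replace 0 with ((0 - 0 ^ 3 / 3 + 0 ^ 5 / 10) - gauss 0) by (rewrite gauss_0; field).
    apply (derive_nonneg_le (fun x => (x - x ^ 3 / 3 + x ^ 5 / 10) - gauss x)
             (fun x => (1 - x ^ 2 + (x ^ 2) ^ 2 / 2) - exp (- x ^ 2))); [exact Hx | | ].
    + intros y _. apply (is_derive_minus (fun x => x - x ^ 3 / 3 + x ^ 5 / 10) gauss); [ | apply is_derive_gauss].
      auto_derive; [exact I | simpl; field].
    + intros y _. destruct (exp_neg_taylor3_le (y ^ 2)) as [_ H]; [nra | ]. lra.
Qed.

(** * The Dawson function *)

Lemma continuous_exp_sqr (x : R) : continuous (fun s => exp (s ^ 2)) x.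
Proof. smooth. Qed.

Lemma is_derive_dawson (x : R) : is_derive dawson x (1 - 2 * x * dawson x).
Proof.
  unfold dawson.
  replace (1 - 2 * x * (exp (- x ^ 2) * RInt (fun s => exp (s ^ 2)) 0 x))
    with ((- 2 * x * exp (- x ^ 2)) * RInt (fun s => exp (s ^ 2)) 0 x + exp (- x ^ 2) * exp (x ^ 2)).
  - apply (is_derive_mult_R (fun x => exp (- x ^ 2)) (fun x => RInt (fun s => exp (s ^ 2)) 0 x)).
    + auto_derive; [exact I | simpl; ring].
    + apply (is_derive_RInt_upper (fun s => exp (s ^ 2))), continuous_exp_sqr.
  - rewrite <- exp_plus. replace (- x ^ 2 + x ^ 2) with 0 by ring. rewrite exp_0. ring.
Qed.

Lemma dawson_0 : dawson 0 = 0.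
Proof.
  unfold dawson. replace (RInt (fun s => exp (s ^ 2)) 0 0) with 0; [ring | ].
  symmetry. exact (RInt_point 0 (fun s => exp (s ^ 2))).
Qed.

(** The Dawson function solves $y' = 1 - 2xy$, with integrating factor $e^{x^2}$. The weighted
    difference therefore moves in the direction of the defect of [B] in this equation, which gives
    comparison with super- and subsolutions. *)
Lemma is_derive_dawson_comparison (B B' : R -> R) (x : R) :
  is_derive B x (B' x) ->
  is_derive (fun x => exp (x ^ 2) * (B x - dawson x)) x
    (exp (x ^ 2) * (B' x - (1 - 2 * x * B x))).
Proof.
  intros HB.
  replace (exp (x ^ 2) * (B' x - (1 - 2 * x * B x))) with
    ((2 * x * exp (x ^ 2)) * (B x - dawson x) + exp (x ^ 2) * (B' x - (1 - 2 * x * dawson x))) by ring.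
  apply (is_derive_mult_R (fun x => exp (x ^ 2)) (fun x => B x - dawson x)).
  - auto_derive; [exact I | simpl; ring].
  - apply (is_derive_minus B dawson); [exact HB | apply is_derive_dawson].
Qed.

Lemma dawson_le_supersolution (B B' : R -> R) (a b : R) :
  a <= b ->
  (forall x, a <= x <= b -> is_derive B x (B' x)) ->
  (forall x, a <= x <= b -> 1 - 2 * x * B x <= B' x) ->
  dawson a <= B a -> dawson b <= B b.
Proof.
  intros Hab Hd Hs Ha.
  assert (H : exp (a ^ 2) * (B a - dawson a) <= exp (b ^ 2) * (B b - dawson b)).
  { apply (derive_nonneg_le (fun x => exp (x ^ 2) * (B x - dawson x))
             (fun x => exp (x ^ 2) * (B' x - (1 - 2 * x * B x)))); [exact Hab | | ].
    - intros x Hx. apply is_derive_dawson_comparison, Hd, Hx.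
    - intros x Hx. apply Rmult_le_pos; [pos | ]. specialize (Hs x Hx). lra. }
  assert (0 <= exp (a ^ 2) * (B a - dawson a)) by pos.
  apply Rnot_lt_le. intros Hc.
  assert (0 < exp (b ^ 2) * (dawson b - B b)) by pos.
  lra.
Qed.

Lemma dawson_ge_subsolution (B B' : R -> R) (a b : R) :
  a <= b ->
  (forall x, a <= x <= b -> is_derive B x (B' x)) ->
  (forall x, a <= x <= b -> B' x <= 1 - 2 * x * B x) ->
  B a <= dawson a -> B b <= dawson b.
Proof.
  intros Hab Hd Hs Ha.
  assert (H : exp (b ^ 2) * (B b - dawson b) <= exp (a ^ 2) * (B a - dawson a)).
  { apply (derive_nonpos_le (fun x => exp (x ^ 2) * (B x - dawson x))
             (fun x => exp (x ^ 2) * (B' x - (1 - 2 * x * B x)))); [exact Hab | | ].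
    - intros x Hx. apply is_derive_dawson_comparison, Hd, Hx.
    - intros x Hx. specialize (Hs x Hx). pose proof (exp_pos (x ^ 2)). nra. }
  assert (exp (a ^ 2) * (B a - dawson a) <= 0) by (pose proof (exp_pos (a ^ 2)); nra).
  apply Rnot_lt_le. intros Hc.
  assert (0 < exp (b ^ 2) * (B b - dawson b)) by pos.
  lra.
Qed.

Lemma dawson_lower (x : R) : 0 <= x -> x / (1 + 2 * x ^ 2) <= dawson x.
Proof.
  intros Hx.
  apply (dawson_ge_subsolution (fun x => x / (1 + 2 * x ^ 2))
           (fun x => (1 - 2 * x ^ 2) / (1 + 2 * x ^ 2) ^ 2) 0 x Hx).
  - intros y _. auto_derive; [simpl; nra | simpl; field; nra].
  - intros y _.
    assert (0 <= (4 * y ^ 2) / (1 + 2 * y ^ 2) ^ 2).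
    { apply Rdiv_le_0_compat; [nra | apply pow_lt; nra]. }
    replace (1 - 2 * y * (y / (1 + 2 * y ^ 2))) with
      ((1 - 2 * y ^ 2) / (1 + 2 * y ^ 2) ^ 2 + (4 * y ^ 2) / (1 + 2 * y ^ 2) ^ 2) by (field; nra).
    lra.
  - rewrite dawson_0. unfold Rdiv. lra.
Qed.

Lemma dawson_pos (x : R) : 0 < x -> 0 < dawson x.
Proof.
  intros Hx. eapply Rlt_le_trans; [ | apply dawson_lower; lra].
  apply Rdiv_lt_0_compat; nra.
Qed.

(** The Taylor coefficients $(-2)^n/(2n+1)!!$ of $F$. *)
Fixpoint dawson_coef (n : nat) : R :=
  match n with
  | O => 1
  | S n => - 2 * dawson_coef n / (2 * INR n + 3)
  end.

Fixpoint dawson_taylor (n : nat) (x : R) : R :=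
  dawson_coef n * x ^ (2 * n + 1) +
  match n with
  | O => 0
  | S n => dawson_taylor n x
  end.

(** A partial sum misses the differential equation by a single term, whose sign is that of the last
    coefficient. Hence the partial sums are alternately super- and subsolutions, and no remainder
    estimate is needed. *)
Lemma is_derive_dawson_taylor (n : nat) (x : R) :
  is_derive (dawson_taylor n) x
    (1 - 2 * x * dawson_taylor n x + 2 * dawson_coef n * x ^ (2 * n + 2)).
Proof.
  induction n as [|n IH].
  - simpl. auto_derive; [exact I | ring].
  - assert (Hc : dawson_coef (S n) * (2 * INR n + 3) = - 2 * dawson_coef n).
    { simpl. field. generalize (pos_INR n). lra. }
    replace (1 - 2 * x * dawson_taylor (S n) x + 2 * dawson_coef (S n) * x ^ (2 * S n + 2)) with
      (dawson_coef (S n) * ((2 * INR n + 3) * x ^ (2 * n + 2)) +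
       (1 - 2 * x * dawson_taylor n x + 2 * dawson_coef n * x ^ (2 * n + 2))).
    + change (dawson_taylor (S n)) with
        (fun x => dawson_coef (S n) * x ^ (2 * S n + 1) + dawson_taylor n x).
      apply (is_derive_plus (fun x => dawson_coef (S n) * x ^ (2 * S n + 1)) (dawson_taylor n)); [ | exact IH].
      apply (is_derive_scal (fun x => x ^ (2 * S n + 1))).
      replace (2 * INR n + 3) with (INR (2 * S n + 1)).
      2: { replace (2 * S n + 1)%nat with (S (S (S (n + n)))) by lia. rewrite !S_INR, plus_INR. ring. }
      replace (INR (2 * S n + 1) * x ^ (2 * n + 2)) with (INR (2 * S n + 1) * 1 * x ^ (pred (2 * S n + 1))).
      2: { rewrite Rmult_1_r. do 2 f_equal. lia. }
      apply (is_derive_pow (fun x => x)). apply (is_derive_id (K := R_AbsRing)).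
    + change (dawson_taylor (S n) x) with (dawson_coef (S n) * x ^ (2 * S n + 1) + dawson_taylor n x).
      replace (dawson_coef (S n) * ((2 * INR n + 3) * x ^ (2 * n + 2))) with
        ((dawson_coef (S n) * (2 * INR n + 3)) * x ^ (2 * n + 2)) by ring.
      rewrite Hc.
      replace (2 * S n + 1)%nat with (S (2 * n + 2)) by lia.
      replace (2 * S n + 2)%nat with (S (S (2 * n + 2))) by lia.
      rewrite <- !tech_pow_Rmult. ring.
Qed.

Lemma dawson_coef_alt (n : nat) : 0 < dawson_coef (2 * n) /\ dawson_coef (S (2 * n)) < 0.
Proof.
  assert (Hs : forall k, 0 < 2 * INR k + 3) by (intros k; generalize (pos_INR k); lra).
  assert (H1 : forall k, 0 < dawson_coef k -> dawson_coef (S k) < 0).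
  { intros k Hk. simpl. specialize (Hs k). unfold Rdiv.
    assert (0 < / (2 * INR k + 3)) by pos. nra. }
  assert (H2 : forall k, dawson_coef k < 0 -> 0 < dawson_coef (S k)).
  { intros k Hk. simpl. specialize (Hs k). pos. }
  induction n as [|n [IH1 IH2]].
  - split; [simpl; lra | apply H1; simpl; lra].
  - replace (2 * S n)%nat with (S (S (2 * n))) by lia.
    split; [apply H2, IH2 | apply H1, H2, IH2].
Qed.

Lemma dawson_taylor_0 (n : nat) : dawson_taylor n 0 = 0.
Proof.
  induction n as [|n IH].
  - simpl. ring.
  - change (dawson_taylor (S n) 0) with (dawson_coef (S n) * 0 ^ (2 * S n + 1) + dawson_taylor n 0).
    rewrite IH, pow_i by lia. ring.
Qed.

Lemma pow_even_ge0 (x : R) (n : nat) : 0 <= x ^ (2 * n + 2).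
Proof. replace (2 * n + 2)%nat with (2 * (n + 1))%nat by lia. rewrite pow_mult. apply pow_le. nra. Qed.

Lemma dawson_le_taylor (n : nat) (x : R) : 0 <= x -> dawson x <= dawson_taylor (2 * n) x.
Proof.
  intros Hx. eapply dawson_le_supersolution; [exact Hx | intros; apply is_derive_dawson_taylor | | ].
  - intros y _. cbv beta. pose proof (pow_even_ge0 y (2 * n)).
    destruct (dawson_coef_alt n) as [H1 _]. nra.
  - rewrite dawson_0, dawson_taylor_0. lra.
Qed.

Lemma taylor_le_dawson (n : nat) (x : R) : 0 <= x -> dawson_taylor (S (2 * n)) x <= dawson x.
Proof.
  intros Hx. eapply dawson_ge_subsolution; [exact Hx | intros; apply is_derive_dawson_taylor | | ].
  - intros y _. cbv beta. pose proof (pow_even_ge0 y (S (2 * n))).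
    destruct (dawson_coef_alt n) as [_ H1]. nra.
  - rewrite dawson_0, dawson_taylor_0. lra.
Qed.

(* The [F]-dependent factor of [w] is [1 - dawsonA]; comments write [A] for [dawsonA]. *)
Definition dawsonA (x : R) : R := 2 * x * dawson x.

Lemma dawsonA_pos (x : R) : 0 < x -> 0 < dawsonA x.
Proof. intros Hx. pose proof (dawson_pos x Hx). unfold dawsonA. pos. Qed.

Lemma dawsonA_lower (x : R) : 0 <= x -> 2 * x ^ 2 / (1 + 2 * x ^ 2) <= dawsonA x.
Proof.
  intros Hx. pose proof (dawson_lower x Hx) as H. unfold dawsonA.
  replace (2 * x ^ 2 / (1 + 2 * x ^ 2)) with (2 * x * (x / (1 + 2 * x ^ 2))) by (field; nra).
  apply Rmult_le_compat_l; lra.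
Qed.

Lemma dawsonA_le_sqr (x : R) : 0 <= x -> dawsonA x <= 2 * x ^ 2.
Proof.
  intros Hx. pose proof (dawson_le_taylor 0 x Hx) as H. simpl in H. unfold dawsonA. simpl. nra.
Qed.

Lemma is_derive_dawsonA (x : R) :
  is_derive dawsonA x (2 * dawson x + 2 * x * (1 - dawsonA x)).
Proof.
  unfold dawsonA. apply (is_derive_mult_R (fun x => 2 * x) dawson).
  - auto_derive; [exact I | ring].
  - apply is_derive_dawson.
Qed.

(* [e^{x^2} (1 - A)] decreases, so [A >= 1] persists. *)
Lemma dawsonA_ge1_mono (x y : R) : 0 < x -> x <= y -> 1 <= dawsonA x -> 1 <= dawsonA y.
Proof.
  intros Hx Hxy H.
  assert (Hm : exp (y ^ 2) * (1 - dawsonA y) <= exp (x ^ 2) * (1 - dawsonA x)).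
  { apply (derive_nonpos_le (fun x => exp (x ^ 2) * (1 - dawsonA x))
             (fun x => - (2 * dawson x * exp (x ^ 2)))); [exact Hxy | | ].
    - intros z _.
      replace (- (2 * dawson z * exp (z ^ 2))) with
        ((2 * z * exp (z ^ 2)) * (1 - dawsonA z) +
         exp (z ^ 2) * (0 - (2 * dawson z + 2 * z * (1 - dawsonA z)))) by (unfold dawsonA; ring).
      apply (is_derive_mult_R (fun x => exp (x ^ 2)) (fun x => 1 - dawsonA x)).
      + auto_derive; [exact I | simpl; ring].
      + apply (is_derive_minus (fun _ => 1) dawsonA); [apply (is_derive_const 1) | apply is_derive_dawsonA].
    - intros z Hz. pose proof (dawson_pos z ltac:(lra)). pose proof (exp_pos (z ^ 2)). nra. }
  pose proof (exp_pos (x ^ 2)). pose proof (exp_pos (y ^ 2)).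
  apply Rnot_lt_le. intros Hc. nra.
Qed.

Lemma dawsonA_lt1_mono (x y : R) : 0 < x -> x <= y -> dawsonA y < 1 -> dawsonA x < 1.
Proof.
  intros Hx Hxy H. apply Rnot_le_lt. intros Hc. apply (Rlt_not_le _ _ H).
  now apply (dawsonA_ge1_mono x y).
Qed.

Lemma dawsonA_mono (x y : R) : 0 < x -> x <= y -> dawsonA y < 1 -> dawsonA x <= dawsonA y.
Proof.
  intros Hx Hxy H.
  apply (derive_nonneg_le dawsonA (fun x => 2 * dawson x + 2 * x * (1 - dawsonA x))); [exact Hxy | | ].
  - intros; apply is_derive_dawsonA.
  - intros z Hz. pose proof (dawson_pos z ltac:(lra)).
    pose proof (dawsonA_lt1_mono z y ltac:(lra) ltac:(lra) H). nra.
Qed.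

(** The sign of the derivative of $A/x^2 = 2F/x$ is exactly [dawson_lower]. *)
Lemma dawsonA_ratio_mono (x y : R) : 0 < x -> x <= y -> dawsonA y / y ^ 2 <= dawsonA x / x ^ 2.
Proof.
  intros Hx Hxy.
  apply (derive_nonpos_le (fun x => dawsonA x / x ^ 2)
          (fun x => 2 * (x - (1 + 2 * x ^ 2) * dawson x) / x ^ 2)); [exact Hxy | | ].
  - intros z Hz.
    replace (2 * (z - (1 + 2 * z ^ 2) * dawson z) / z ^ 2) with
      (((2 * dawson z + 2 * z * (1 - dawsonA z)) * z ^ 2 - dawsonA z * (2 * z)) / (z ^ 2) ^ 2)
      by (unfold dawsonA; field; lra).
    apply (is_derive_div dawsonA (fun x => x ^ 2)).
    + apply is_derive_dawsonA.
    + auto_derive; [exact I | ring].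
    + apply pow_nonzero. lra.
  - intros z Hz. pose proof (dawson_lower z ltac:(lra)) as Hl.
    assert (z <= (1 + 2 * z ^ 2) * dawson z).
    { apply (Rmult_le_compat_l (1 + 2 * z ^ 2)) in Hl; [ | nra].
      replace ((1 + 2 * z ^ 2) * (z / (1 + 2 * z ^ 2))) with z in Hl by (field; nra). exact Hl. }
    assert (0 < / z ^ 2) by (apply Rinv_0_lt_compat, pow_lt; lra).
    unfold Rdiv. nra.
Qed.

(** [A] reaches 1 at the maximum of $F$, near $x^2 = 0.854$, and at $9/10$ the Taylor sum through
    $x^7$ already certifies it. Read backwards, a point with $A < 1$ has $e^x < 9/10$; this makes
    the later case analysis finite. *)
Lemma dawsonA_ge1 (x : R) : 0 <= x -> 9 / 10 <= x ^ 2 -> 1 <= dawsonA x.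
Proof.
  intros Hx0 Hx.
  assert (Hs : sqrt (9 / 10) ^ 2 = 9 / 10) by (apply pow2_sqrt; lra).
  assert (Hp : 0 < sqrt (9 / 10)) by (apply sqrt_lt_R0; lra).
  apply (dawsonA_ge1_mono (sqrt (9 / 10)) x Hp); [nra | ].
  pose proof (taylor_le_dawson 1 (sqrt (9 / 10)) ltac:(lra)) as H.
  set (s := sqrt (9 / 10)) in *.
  assert (He : dawson_taylor 3 s = s * (1 - 2 / 3 * s ^ 2 + 4 / 15 * (s ^ 2) ^ 2 - 8 / 105 * (s ^ 2) ^ 3)).
  { simpl. field. }
  change (S (2 * 1)) with 3%nat in H. rewrite He, Hs in H. unfold dawsonA. nra.
Qed.

(** $13/6$, and $27/8$ in the next lemma, are the values of $x^2$ at which the bounds $13/(20x)$ and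
    $1/(2x) + 9/(20x^3)$ change from subsolution to supersolution. The right sides are the values of
    these bounds there, written as a multiple of $x$ so that only $x^2$ has to be known. *)
Lemma dawson_at_13_6 (x : R) : 0 <= x -> x ^ 2 = 13 / 6 -> dawson x <= x * (3 / 10).
Proof.
  intros Hx Hs. pose proof (dawson_le_taylor 5 x Hx) as H.
  assert (He : dawson_taylor (2 * 5) x = x * (1 - 2 / 3 * x ^ 2 + 4 / 15 * (x ^ 2) ^ 2 - 8 / 105 * (x ^ 2) ^ 3
   + 16 / 945 * (x ^ 2) ^ 4 - 32 / 10395 * (x ^ 2) ^ 5 + 64 / 135135 * (x ^ 2) ^ 6
   - 128 / 2027025 * (x ^ 2) ^ 7 + 256 / 34459425 * (x ^ 2) ^ 8 - 512 / 654729075 * (x ^ 2) ^ 9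
   + 1024 / 13749310575 * (x ^ 2) ^ 10)).
  { simpl. field. }
  rewrite He, Hs in H. eapply Rle_trans; [exact H | ]. apply Rmult_le_compat_l; lra.
Qed.

Lemma dawson_at_27_8 (x : R) : 0 <= x -> x ^ 2 = 27 / 8 -> dawson x <= x * (38 / 30 / (27 / 4)).
Proof.
  intros Hx Hs. pose proof (dawson_le_taylor 7 x Hx) as H.
  assert (He : dawson_taylor (2 * 7) x = x * (1 - 2 / 3 * x ^ 2 + 4 / 15 * (x ^ 2) ^ 2 - 8 / 105 * (x ^ 2) ^ 3
   + 16 / 945 * (x ^ 2) ^ 4 - 32 / 10395 * (x ^ 2) ^ 5 + 64 / 135135 * (x ^ 2) ^ 6
   - 128 / 2027025 * (x ^ 2) ^ 7 + 256 / 34459425 * (x ^ 2) ^ 8 - 512 / 654729075 * (x ^ 2) ^ 9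
   + 1024 / 13749310575 * (x ^ 2) ^ 10 - 2048 / 316234143225 * (x ^ 2) ^ 11
   + 4096 / 7905853580625 * (x ^ 2) ^ 12 - 8192 / 213458046676875 * (x ^ 2) ^ 13
   + 16384 / 6190283353629375 * (x ^ 2) ^ 14)).
  { simpl. field. }
  rewrite He, Hs in H. eapply Rle_trans; [exact H | ]. apply Rmult_le_compat_l; lra.
Qed.

(* The bound [B] is a supersolution to the right of [c] and a subsolution to the
   left, so that [e^{x^2} (B - dawson)] is smallest at [c]. *)
Lemma dawson_le_of_le_at (B B' : R -> R) (c x : R) :
  0 < c -> 0 < x ->
  (forall y, 0 < y -> is_derive B y (B' y)) ->
  (forall y, 0 < y -> y <= c -> B' y <= 1 - 2 * y * B y) ->
  (forall y, c <= y -> 1 - 2 * y * B y <= B' y) ->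
  dawson c <= B c -> dawson x <= B x.
Proof.
  intros Hc Hx Hd Hl Hr H. destruct (Rle_dec c x) as [Hcx | Hcx].
  - apply (dawson_le_supersolution B B' c x Hcx); [ | | exact H].
    + intros y Hy. apply Hd. lra.
    + intros y Hy. apply Hr. lra.
  - assert (Hm : exp (c ^ 2) * (B c - dawson c) <= exp (x ^ 2) * (B x - dawson x)).
    { apply (derive_nonpos_le (fun x => exp (x ^ 2) * (B x - dawson x))
               (fun x => exp (x ^ 2) * (B' x - (1 - 2 * x * B x)))); [lra | | ].
      - intros y Hy. apply is_derive_dawson_comparison, Hd. lra.
      - intros y Hy. specialize (Hl y ltac:(lra) ltac:(lra)). pose proof (exp_pos (y ^ 2)). nra. }
    pose proof (exp_pos (x ^ 2)).
    assert (0 <= exp (c ^ 2) * (B c - dawson c)) by pos.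
    apply Rnot_lt_le. intros Hlt. nra.
Qed.

Lemma dawsonA_le_13_10 (x : R) : 0 < x -> dawsonA x <= 13 / 10.
Proof.
  intros Hx.
  assert (Hs : sqrt (13 / 6) ^ 2 = 13 / 6) by (apply pow2_sqrt; lra).
  assert (Hp : 0 < sqrt (13 / 6)) by (apply sqrt_lt_R0; lra).
  enough (H : dawson x <= 13 / 20 / x).
  { unfold dawsonA. apply (Rmult_le_compat_l (2 * x)) in H; [ | lra].
    replace (2 * x * (13 / 20 / x)) with (13 / 10) in H by (field; lra). exact H. }
  apply (dawson_le_of_le_at (fun x => 13 / 20 / x) (fun x => - (13 / 20 / x ^ 2)) (sqrt (13 / 6))); auto.
  - intros y Hy. auto_derive; [lra | simpl; field; lra].
  - intros y Hy Hc. replace (1 - 2 * y * (13 / 20 / y)) with (- (3 / 10)) by (field; lra).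
    assert (y ^ 2 <= 13 / 6) by nra.
    enough (3 / 10 <= 13 / 20 / y ^ 2) by lra. apply le_div_of_mul_le; nra.
  - intros y Hc. replace (1 - 2 * y * (13 / 20 / y)) with (- (3 / 10)) by (field; lra).
    assert (13 / 6 <= y ^ 2) by nra.
    enough (13 / 20 / y ^ 2 <= 3 / 10) by lra. apply div_le_of_le_mul; nra.
  - eapply Rle_trans; [apply dawson_at_13_6; [lra | exact Hs] | ].
    apply le_div_of_mul_le; [exact Hp | ]. simpl in Hs. nra.
Qed.

(** [A] tends to 1 from above with $x^2 (A - 1) \to 1/2$. The uniform bound by a constant controls
    the part of the negative mass that carries the factor $1/\sqrt p$. *)
Lemma dawsonA_excess (x : R) : 0 < x -> x ^ 2 * (dawsonA x - 1) <= 9 / 10.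
Proof.
  intros Hx.
  assert (Hs : sqrt (27 / 8) ^ 2 = 27 / 8) by (apply pow2_sqrt; lra).
  assert (Hp : 0 < sqrt (27 / 8)) by (apply sqrt_lt_R0; lra).
  enough (H : dawson x <= / (2 * x) + 9 / 20 / x ^ 3).
  { unfold dawsonA. apply (Rmult_le_compat_l (2 * x ^ 3)) in H; [ | apply Rmult_le_pos; [lra | pos]].
    replace (2 * x ^ 3 * (/ (2 * x) + 9 / 20 / x ^ 3)) with (x ^ 2 + 9 / 10) in H by (field; lra). nra. }
  apply (dawson_le_of_le_at (fun x => / (2 * x) + 9 / 20 / x ^ 3)
           (fun x => - / (2 * x ^ 2) - 27 / 20 / x ^ 4) (sqrt (27 / 8))); auto.
  - intros y Hy. auto_derive; [split; [lra | split; [apply (pow_nonzero y 3); lra | exact I]] | simpl; field; lra].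
  - intros y Hy Hc.
    assert (y ^ 2 <= 27 / 8) by nra.
    enough (0 <= (1 - 2 * y * (/ (2 * y) + 9 / 20 / y ^ 3)) - (- / (2 * y ^ 2) - 27 / 20 / y ^ 4)) by lra.
    replace (1 - 2 * y * (/ (2 * y) + 9 / 20 / y ^ 3) - (- / (2 * y ^ 2) - 27 / 20 / y ^ 4))
      with ((27 / 20 - 2 / 5 * y ^ 2) / y ^ 4) by (field; lra).
    apply Rdiv_le_0_compat; [lra | pos].
  - intros y Hc.
    assert (27 / 8 <= y ^ 2) by nra.
    enough (0 <= (2 / 5 * y ^ 2 - 27 / 20) / y ^ 4).
    { replace (1 - 2 * y * (/ (2 * y) + 9 / 20 / y ^ 3))
      with ((- / (2 * y ^ 2) - 27 / 20 / y ^ 4) - (2 / 5 * y ^ 2 - 27 / 20) / y ^ 4) by (field; lra). lra. }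
    apply Rdiv_le_0_compat; [lra | pos].
  - eapply Rle_trans; [apply dawson_at_27_8; [lra | exact Hs] | ].
    set (s := sqrt (27 / 8)) in *.
    replace (/ (2 * s) + 9 / 20 / s ^ 3) with ((s ^ 2 + 9 / 10) / (2 * s * s ^ 2)) by (field; lra).
    rewrite Hs. apply le_div_of_mul_le; [lra | ]. simpl in Hs. nra.
Qed.

(** * Fourier bounds and the Fejer kernel *)

(** The Gamma integrand in a logarithmic variable: its integral over the line is $\Gamma(b)/q^b$,
    used for $b = 1/2$ and $b = 3/2$. *)
Definition phi (b q t : R) : R := exp (b * t - q * exp t).

Lemma phi_pos (b q t : R) : 0 < phi b q t.
Proof. apply exp_pos. Qed.

Lemma continuous_phi (b q t : R) : continuous (phi b q) t.
Proof. unfold phi. smooth. Qed.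

(* Real and imaginary part of [e^{b z - q e^z + i xi z}] at [z = t + i y]. *)
Definition shift_re (b q xi t y : R) : R :=
  exp (b * t - q * exp t * cos y - xi * y) * cos (b * y - q * exp t * sin y + xi * t).
Definition shift_im (b q xi t y : R) : R :=
  exp (b * t - q * exp t * cos y - xi * y) * sin (b * y - q * exp t * sin y + xi * t).

Definition shift_im_dt (b q xi t y : R) : R :=
  exp (b * t - q * exp t * cos y - xi * y) *
    ((b - q * exp t * cos y) * sin (b * y - q * exp t * sin y + xi * t) +
     (xi - q * exp t * sin y) * cos (b * y - q * exp t * sin y + xi * t)).

Lemma is_derive_shift_im (b q xi t y : R) :
  is_derive (fun t => shift_im b q xi t y) t (shift_im_dt b q xi t y).
Proof.
  unfold shift_im, shift_im_dt. auto_derive; [exact I | ].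
  rewrite ?Rmult_1_l, ?Rmult_1_r. unfold Rminus. ring.
Qed.

Lemma is_derive_shift_re (b q xi t y : R) :
  is_derive (fun y => shift_re b q xi t y) y (- shift_im_dt b q xi t y).
Proof.
  unfold shift_re, shift_im_dt. auto_derive; [exact I | ].
  unfold Rminus. ring.
Qed.

Lemma continuity_2d_pt_comp1 (f : R -> R) (g : R -> R -> R) (x y : R) :
  (forall z, ex_derive f z) -> continuity_2d_pt g x y ->
  continuity_2d_pt (fun u v => f (g u v)) x y.
Proof.
  intros Hf Hg. apply (continuity_1d_2d_pt_comp f g); [ | exact Hg].
  apply continuity_pt_filterlim, (ex_derive_continuous f), Hf.
Qed.

Ltac cont2d := cbv beta;
  match goal with
  | |- continuity_2d_pt (fun u v => - @?f u v) _ _ => apply (continuity_2d_pt_opp f); cont2d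
  | |- continuity_2d_pt (fun u v => @?f u v + @?g u v) _ _ => apply (continuity_2d_pt_plus f g); cont2d
  | |- continuity_2d_pt (fun u v => @?f u v - @?g u v) _ _ => apply (continuity_2d_pt_minus f g); cont2d
  | |- continuity_2d_pt (fun u v => @?f u v * @?g u v) _ _ => apply (continuity_2d_pt_mult f g); cont2d
  | |- continuity_2d_pt (fun u v => exp (@?f u v)) _ _ =>
      apply (continuity_2d_pt_comp1 exp f); [intros; now auto_derive | cont2d]
  | |- continuity_2d_pt (fun u v => sin (@?f u v)) _ _ =>
      apply (continuity_2d_pt_comp1 sin f); [intros; now auto_derive | cont2d]
  | |- continuity_2d_pt (fun u v => cos (@?f u v)) _ _ =>
      apply (continuity_2d_pt_comp1 cos f); [intros; now auto_derive | cont2d]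
  | |- continuity_2d_pt (fun u v => u) _ _ => apply continuity_2d_pt_id1
  | |- continuity_2d_pt (fun u v => v) _ _ => apply continuity_2d_pt_id2
  | |- continuity_2d_pt (fun u v => ?c) _ _ => apply continuity_2d_pt_const
  end.

(** Cauchy's theorem in differential form: by the Cauchy-Riemann equations the [y]-derivative of the
    integrand is an exact [t]-derivative, so the horizontal integral changes only through the values
    at its two ends. *)
Lemma is_derive_RInt_shift (b q xi T y : R) :
  is_derive (fun y => RInt (fun t => shift_re b q xi t y) (- T) T) y
    (- (shift_im b q xi T y - shift_im b q xi (- T) y)).
Proof.
  assert (HI : RInt (fun t => Derive (fun y => shift_re b q xi t y) y) (- T) T
    = - (shift_im b q xi T y - shift_im b q xi (- T) y)).
  { rewrite (RInt_ext_R _ (fun t => - shift_im_dt b q xi t y)).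
    2: { intros t. apply is_derive_unique, is_derive_shift_re. }
    apply is_RInt_unique.
    replace (- (shift_im b q xi T y - shift_im b q xi (- T) y))
      with (- shift_im b q xi T y - - shift_im b q xi (- T) y) by ring.
    apply (is_RInt_derive (fun t => - shift_im b q xi t y) (fun t => - shift_im_dt b q xi t y)).
    - intros t _. apply (is_derive_opp (fun t => shift_im b q xi t y)), is_derive_shift_im.
    - intros t _. unfold shift_im_dt. smooth. }
  rewrite <- HI.
  apply (is_derive_RInt_param (fun y t => shift_re b q xi t y) (- T) T y).
  - apply filter_forall. intros z t _. eexists. apply is_derive_shift_re.
  - intros t _.
    apply (continuity_2d_pt_ext (fun u v => - shift_im_dt b q xi v u)).
    { intros u v. symmetry. apply is_derive_unique, is_derive_shift_re. }
    unfold shift_im_dt. cont2d.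
  - apply filter_forall. intros z. apply ex_RInt_everywhere. intros t.
    unfold shift_re. smooth.
Qed.

Lemma cos_ge_half (y : R) : 0 <= y <= PI / 3 -> 1 / 2 <= cos y.
Proof.
  intros Hy. pose proof PI_RGT_0. rewrite <- cos_PI3. apply cos_decr_1; lra.
Qed.

Lemma exp_shift_le (b q xi t y : R) : 0 < q -> 0 <= xi -> 0 <= y <= PI / 3 ->
  exp (b * t - q * exp t * cos y - xi * y) <= exp (- (xi * y)) * phi b (q / 2) t.
Proof.
  intros Hq Hxi Hy. unfold phi. rewrite <- exp_plus. apply exp_le_mono.
  pose proof (cos_ge_half y Hy) as Hc. pose proof (exp_pos t) as He.
  assert (q * exp t * (1 / 2) <= q * exp t * cos y).
  { apply Rmult_le_compat_l; [ | exact Hc]. pos. }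
  lra.
Qed.

Lemma Rabs_mult_le (x y c : R) : 0 <= x <= c -> - 1 <= y <= 1 -> Rabs (x * y) <= c.
Proof. intros Hx Hy. apply Rabs_le. split; nra. Qed.

(* Moving the line of integration to height [PI / 3]. *)
Lemma fourier_phi_bound (b q xi T : R) : 0 < q -> 0 <= xi -> 0 <= T ->
  Rabs (RInt (fun t => phi b q t * cos (xi * t)) (- T) T) <=
    exp (- (xi * (PI / 3))) * RInt (phi b (q / 2)) (- T) T
    + 2 * (phi b (q / 2) T + phi b (q / 2) (- T)).
Proof.
  intros Hq Hxi HT. pose proof PI_RGT_0 as Hpi. pose proof PI_4 as Hpi4.
  set (Q := fun y => RInt (fun t => shift_re b q xi t y) (- T) T).
  assert (H0 : RInt (fun t => phi b q t * cos (xi * t)) (- T) T = Q 0).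
  { unfold Q. apply RInt_ext_R. intros t. unfold shift_re, phi.
    rewrite cos_0, sin_0. f_equal; f_equal; ring. }
  rewrite H0.
  (* The mean value theorem in the height takes the place of the two vertical sides of the contour;
     their length $\pi/3$ is at most 2, hence the factor 2 in the bound. *)
  destruct (MVT_gen Q 0 (PI / 3) (fun y => - (shift_im b q xi T y - shift_im b q xi (- T) y))) as [c [Hc He]].
  { intros y _. apply is_derive_RInt_shift. }
  { intros y _. apply continuity_pt_filterlim, (ex_derive_continuous Q). eexists. apply is_derive_RInt_shift. }
  rewrite Rmin_left, Rmax_right in Hc by lra.
  assert (Him : forall t, Rabs (shift_im b q xi t c) <= phi b (q / 2) t).
  { intros t. unfold shift_im. apply Rabs_mult_le; [ | apply SIN_bound].
    split; [pos | ].
    eapply Rle_trans; [apply exp_shift_le; auto | ].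
    rewrite <- (Rmult_1_l (phi b (q / 2) t)) at 2.
    apply Rmult_le_compat_r; [left; apply phi_pos | ].
    rewrite <- exp_0. apply exp_le_mono. nra. }
  assert (HQ : Rabs (Q (PI / 3)) <= exp (- (xi * (PI / 3))) * RInt (phi b (q / 2)) (- T) T).
  { unfold Q. rewrite <- RInt_scal_R by apply ex_RInt_everywhere, continuous_phi.
    assert (Hcont : forall t, continuous (fun t => shift_re b q xi t (PI / 3)) t).
    { intros t. unfold shift_re. smooth. }
    eapply Rle_trans; [apply abs_RInt_le; [lra | now apply ex_RInt_everywhere] | ].
    apply RInt_le; [lra | | | ].
    - apply ex_RInt_everywhere. intros t.
      apply (continuous_comp (fun t => shift_re b q xi t (PI / 3)) Rabs); [apply Hcont | apply continuous_Rabs].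
    - apply ex_RInt_everywhere. intros t.
      unfold phi. smooth.
    - intros t _. unfold shift_re. apply Rabs_mult_le; [ | apply COS_bound].
      split; [pos | ]. apply exp_shift_le; auto. lra. }
  pose proof (Him T) as H1. pose proof (Him (- T)) as H2.
  set (i1 := shift_im b q xi T c) in *. set (i2 := shift_im b q xi (- T) c) in *.
  set (p1 := phi b (q / 2) T) in *. set (p2 := phi b (q / 2) (- T)) in *.
  apply Rabs_le_between in H1. apply Rabs_le_between in H2. apply Rabs_le_between in HQ.
  apply Rabs_le. 
  assert (0 <= p1) by (left; apply phi_pos). assert (0 <= p2) by (left; apply phi_pos).
  assert (Hm : - (2 * (p1 + p2)) <= - (i1 - i2) * (PI / 3 - 0) <= 2 * (p1 + p2)) by (split; nra).
  cbv beta in He. lra.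
Qed.

Fixpoint dirichlet (n : nat) (x : R) : R :=
  match n with
  | O => 1
  | S n => dirichlet n x + 2 * cos (INR (S n) * x)
  end.

(* Not normalised: this is [n] times the Fejer kernel. *)
Fixpoint fejer_sum (n : nat) (x : R) : R :=
  match n with
  | O => 0
  | S n => fejer_sum n x + dirichlet n x
  end.

Lemma dirichlet_sin (n : nat) (x : R) :
  dirichlet n (2 * x) * sin x = sin ((2 * INR n + 1) * x).
Proof.
  induction n as [|n IH].
  - simpl. rewrite Rmult_0_r, Rplus_0_l, !Rmult_1_l. reflexivity.
  - change (dirichlet (S n) (2 * x)) with (dirichlet n (2 * x) + 2 * cos (INR (S n) * (2 * x))).
    rewrite Rmult_plus_distr_r, IH, S_INR.
    replace ((2 * INR n + 1) * x) with ((INR n + 1) * (2 * x) - x) by ring.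
    replace ((2 * (INR n + 1) + 1) * x) with ((INR n + 1) * (2 * x) + x) by ring.
    rewrite sin_minus, sin_plus. ring.
Qed.

Lemma fejer_sum_sin (n : nat) (x : R) :
  fejer_sum n (2 * x) * sin x ^ 2 = sin (INR n * x) ^ 2.
Proof.
  induction n as [|n IH].
  - change (0 * sin x ^ 2 = sin (0 * x) ^ 2). rewrite (Rmult_0_l x), sin_0. ring.
  - change (fejer_sum (S n) (2 * x)) with (fejer_sum n (2 * x) + dirichlet n (2 * x)).
    rewrite Rmult_plus_distr_r, IH.
    replace (dirichlet n (2 * x) * sin x ^ 2) with ((dirichlet n (2 * x) * sin x) * sin x) by ring.
    rewrite dirichlet_sin, S_INR.
    replace ((2 * INR n + 1) * x) with (INR n * x + (INR n + 1) * x) by ring.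
    replace (sin x) with (sin ((INR n + 1) * x - INR n * x)) by (f_equal; ring).
    rewrite sin_plus, sin_minus.
    pose proof (sin2_cos2 (INR n * x)) as H1. pose proof (sin2_cos2 ((INR n + 1) * x)) as H2.
    unfold Rsqr in H1, H2. nra.
Qed.

Lemma sin_mult_0 (n : nat) (x : R) : sin x = 0 -> sin (INR n * x) = 0.
Proof.
  intros H. induction n as [|n IH].
  - rewrite Rmult_0_l. apply sin_0.
  - rewrite S_INR. replace ((INR n + 1) * x) with (INR n * x + x) by ring.
    rewrite sin_plus, IH, H. ring.
Qed.

(** The closed form settles the sign except where the sine vanishes, and there every cosine equals
    1. *)
Lemma fejer_sum_ge0 (n : nat) (x : R) : 0 <= fejer_sum n x.
Proof.
  replace x with (2 * (x / 2)) by field. set (y := x / 2).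
  destruct (Req_dec (sin y) 0) as [H | H].
  - assert (Hd : forall k, 1 <= dirichlet k (2 * y)).
    { induction k as [|k IH]; simpl; [lra | ].
      change (match k with O => 1 | S _ => INR k + 1 end) with (INR (S k)).
      replace (INR (S k) * (2 * y)) with (2 * (INR (S k) * y)) by ring.
      rewrite cos_2a_sin, (sin_mult_0 (S k) y H). lra. }
    induction n as [|n IH]; simpl; [lra | ]. specialize (Hd n). lra.
  - pose proof (fejer_sum_sin n y) as He. 
    assert (0 < sin y ^ 2) by (apply pow2_gt_0, H).
    apply Rnot_lt_le. intros Hc. assert (0 <= sin (INR n * y) ^ 2) by apply pow2_ge_0. nra.
Qed.

Lemma ex_derive_dirichlet (n : nat) (c x : R) : ex_derive (fun t => dirichlet n (c * t)) x.
Proof.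
  induction n as [|n IH]; simpl.
  - apply ex_derive_const.
  - apply (ex_derive_plus (fun t => dirichlet n (c * t))); [exact IH | ].
    now auto_derive.
Qed.

Lemma ex_derive_fejer_sum (n : nat) (c x : R) : ex_derive (fun t => fejer_sum n (c * t)) x.
Proof.
  induction n as [|n IH]; simpl.
  - apply ex_derive_const.
  - apply (ex_derive_plus (fun t => fejer_sum n (c * t))); [exact IH | apply ex_derive_dirichlet].
Qed.

Lemma continuous_dirichlet (n : nat) (c x : R) : continuous (fun t => dirichlet n (c * t)) x.
Proof. apply (ex_derive_continuous (fun t => dirichlet n (c * t))), ex_derive_dirichlet. Qed.

Lemma continuous_fejer_sum (n : nat) (c x : R) : continuous (fun t => fejer_sum n (c * t)) x.
Proof. apply (ex_derive_continuous (fun t => fejer_sum n (c * t))), ex_derive_fejer_sum. Qed.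

Lemma RInt_dirichlet_period (n : nat) (h : R) : 0 < h ->
  RInt (fun t => dirichlet n (2 * PI / h * t)) (- (h / 2)) (h / 2) = h.
Proof.
  intros Hh. pose proof PI_RGT_0. induction n as [|n IH].
  - simpl. rewrite RInt_const. unfold scal; simpl; unfold mult; simpl. eqR. field.
  - change (RInt (fun t => dirichlet n (2 * PI / h * t) + 2 * cos (INR (S n) * (2 * PI / h * t))) (- (h / 2)) (h / 2) = h).
    assert (Hn : 0 < INR (S n)) by (apply lt_0_INR; lia).
    rewrite RInt_plus_R, IH.
    + enough (E : RInt (fun t => 2 * cos (INR (S n) * (2 * PI / h * t))) (- (h / 2)) (h / 2) = 0)
        by (rewrite E; eqR; ring).
      apply is_RInt_unique.
      set (c := INR (S n) * (2 * PI / h)).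
      assert (Hc : c <> 0).
      { unfold c. apply Rmult_integral_contrapositive_currified; [lra | ].
        apply Rgt_not_eq, Rdiv_lt_0_compat; lra. }
      replace 0 with (2 / c * sin (c * (h / 2)) - 2 / c * sin (c * - (h / 2))).
      * apply (is_RInt_derive (fun t => 2 / c * sin (c * t)) (fun t => 2 * cos (INR (S n) * (2 * PI / h * t)))).
        -- intros t _. replace (INR (S n) * (2 * PI / h * t)) with (c * t) by (unfold c; ring).
           auto_derive; [exact I | field; exact Hc].
        -- intros t _. smooth.
      * replace (c * - (h / 2)) with (- (c * (h / 2))) by ring. rewrite sin_neg.
        replace (c * (h / 2)) with (INR (S n) * PI) by (unfold c; field; lra).
        rewrite (sin_mult_0 (S n) PI sin_PI). ring.
    + apply ex_RInt_everywhere. intros; apply continuous_dirichlet.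
    + apply ex_RInt_everywhere. intros t.
      smooth.
Qed.

Lemma RInt_fejer_sum_period (n : nat) (h : R) : 0 < h ->
  RInt (fun t => fejer_sum n (2 * PI / h * t)) (- (h / 2)) (h / 2) = INR n * h.
Proof.
  intros Hh. induction n as [|n IH].
  - simpl. rewrite RInt_const. unfold scal; simpl; unfold mult; simpl. eqR. ring.
  - change (RInt (fun t => fejer_sum n (2 * PI / h * t) + dirichlet n (2 * PI / h * t)) (- (h / 2)) (h / 2) = INR (S n) * h).
    rewrite RInt_plus_R, IH, RInt_dirichlet_period, S_INR; [eqR; ring | exact Hh | | ].
    + apply ex_RInt_everywhere. intros; apply continuous_fejer_sum.
    + apply ex_RInt_everywhere. intros; apply continuous_dirichlet.
Qed.

Lemma cos_period_Z (y : R) (k : Z) : cos (y + 2 * IZR k * PI) = cos y.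
Proof.
  destruct (Z_le_dec 0 k) as [Hk | Hk].
  - replace k with (Z.of_nat (Z.to_nat k)) by lia. rewrite <- INR_IZR_INZ. apply cos_period.
  - rewrite <- (cos_period (y + 2 * IZR k * PI) (Z.to_nat (- k))). f_equal.
    rewrite INR_IZR_INZ, Z2Nat.id, opp_IZR by lia. ring.
Qed.

Lemma dirichlet_period (n : nat) (x : R) (k : Z) : dirichlet n (x + 2 * IZR k * PI) = dirichlet n x.
Proof.
  induction n as [|n IH]; [reflexivity | ].
  change (dirichlet n (x + 2 * IZR k * PI) + 2 * cos (INR (S n) * (x + 2 * IZR k * PI)) =
          dirichlet n x + 2 * cos (INR (S n) * x)).
  rewrite IH. do 2 f_equal.
  rewrite <- (cos_period_Z (INR (S n) * x) (Z.of_nat (S n) * k)). f_equal.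
  rewrite mult_IZR, <- INR_IZR_INZ. ring.
Qed.

Lemma fejer_sum_period (n : nat) (x : R) (k : Z) : fejer_sum n (x + 2 * IZR k * PI) = fejer_sum n x.
Proof.
  induction n as [|n IH]; [reflexivity | ]. simpl. now rewrite IH, dirichlet_period.
Qed.

Notation fejer n h t := (fejer_sum n (2 * PI / h * t)).

(** * Finite sums over integer intervals *)

Lemma Z_interval_ind (P : Z -> Prop) (lo : Z) :
  P (lo - 1)%Z ->
  (forall m, (lo <= m + 1)%Z -> P m -> P (m + 1)%Z) ->
  forall hi, (lo <= hi + 1)%Z -> P hi.
Proof.
  intros H0 HS hi Hhi.
  replace hi with (lo - 1 + Z.of_nat (Z.to_nat (hi + 1 - lo)))%Z by lia.
  induction (Z.to_nat (hi + 1 - lo)) as [|n IH].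
  - now replace (lo - 1 + Z.of_nat 0)%Z with (lo - 1)%Z by lia.
  - replace (lo - 1 + Z.of_nat (S n))%Z with (lo - 1 + Z.of_nat n + 1)%Z by lia.
    apply HS; [lia | exact IH].
Qed.

Lemma sum_Z_empty (f : Z -> R) (lo hi : Z) : (hi < lo)%Z -> sum_Z f lo hi = 0.
Proof.
  intros H. unfold sum_Z. replace (Z.to_nat (hi - lo + 1)) with 0%nat by lia.
  rewrite sum_n_m_zero by lia. reflexivity.
Qed.

Lemma sum_Z_last (f : Z -> R) (lo hi : Z) :
  (lo <= hi + 1)%Z -> sum_Z f lo (hi + 1) = sum_Z f lo hi + f (hi + 1)%Z.
Proof.
  intros H. unfold sum_Z.
  replace (Z.to_nat (hi + 1 - lo + 1)) with (S (Z.to_nat (hi - lo + 1))) by lia.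
  rewrite sum_n_Sm by lia. unfold plus; simpl. f_equal. f_equal. lia.
Qed.

Lemma sum_Z_split (f : Z -> R) (lo mid hi : Z) :
  (lo <= mid + 1)%Z -> (mid <= hi)%Z -> sum_Z f lo hi = sum_Z f lo mid + sum_Z f (mid + 1) hi.
Proof.
  intros H1 H2.
  apply (Z_interval_ind (fun hi => sum_Z f lo hi = sum_Z f lo mid + sum_Z f (mid + 1) hi) (mid + 1)); [ | | lia].
  - rewrite (sum_Z_empty f (mid + 1)) by lia. replace (mid + 1 - 1)%Z with mid by lia. ring.
  - intros m Hm IH. rewrite !sum_Z_last, IH by lia. ring.
Qed.

Lemma sum_Z_single (f : Z -> R) (k : Z) : sum_Z f k k = f k.
Proof.
  replace (sum_Z f k k) with (sum_Z f k (k - 1 + 1)) by (f_equal; lia).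
  rewrite sum_Z_last, sum_Z_empty by lia. replace (k - 1 + 1)%Z with k by lia. ring.
Qed.

Lemma sum_Z_first (f : Z -> R) (lo hi : Z) :
  (lo <= hi)%Z -> sum_Z f lo hi = f lo + sum_Z f (lo + 1) hi.
Proof. intros H. rewrite (sum_Z_split f lo lo hi), sum_Z_single by lia. reflexivity. Qed.

Lemma sum_Z_rel (r : R -> R -> Prop) (f g : Z -> R) (lo hi : Z) :
  r 0 0 ->
  (forall a b c d, r a b -> r c d -> r (a + c) (b + d)) ->
  (forall k, (lo <= k <= hi)%Z -> r (f k) (g k)) ->
  r (sum_Z f lo hi) (sum_Z g lo hi).
Proof.
  intros H0 Hp H.
  destruct (Z_le_dec lo (hi + 1)) as [Hl | Hl]; [ | rewrite !sum_Z_empty by lia; exact H0].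
  enough (forall m, (lo <= m + 1)%Z -> (m <= hi)%Z -> r (sum_Z f lo m) (sum_Z g lo m)) as Hm by (apply Hm; lia).
  apply (Z_interval_ind (fun m => (m <= hi)%Z -> r (sum_Z f lo m) (sum_Z g lo m))).
  - intros _. rewrite !sum_Z_empty by lia. exact H0.
  - intros m Hm IH Hmh. rewrite !sum_Z_last by lia. apply Hp; [apply IH; lia | apply H; lia].
Qed.

Lemma sum_Z_ext (f g : Z -> R) (lo hi : Z) :
  (forall k, (lo <= k <= hi)%Z -> f k = g k) -> sum_Z f lo hi = sum_Z g lo hi.
Proof. apply (sum_Z_rel eq); [reflexivity | intros; congruence]. Qed.

Lemma sum_Z_le (f g : Z -> R) (lo hi : Z) :
  (forall k, (lo <= k <= hi)%Z -> f k <= g k) -> sum_Z f lo hi <= sum_Z g lo hi.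
Proof. apply (sum_Z_rel Rle); [lra | intros; lra]. Qed.

Lemma sum_Z_ge0 (f : Z -> R) (lo hi : Z) :
  (forall k, (lo <= k <= hi)%Z -> 0 <= f k) -> 0 <= sum_Z f lo hi.
Proof. apply (sum_Z_rel (fun x _ => 0 <= x) f f); [lra | intros; lra]. Qed.

Lemma sum_Z_scal (f : Z -> R) (c : R) (lo hi : Z) :
  sum_Z (fun k => c * f k) lo hi = c * sum_Z f lo hi.
Proof. apply (sum_Z_rel (fun x y => x = c * y)); [ring | intros; subst; ring | reflexivity]. Qed.

Lemma sum_Z_plus (f g : Z -> R) (lo hi : Z) :
  sum_Z (fun k => f k + g k) lo hi = sum_Z f lo hi + sum_Z g lo hi.
Proof.
  destruct (Z_le_dec lo (hi + 1)) as [Hl | Hl]; [ | rewrite !sum_Z_empty by lia; ring].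
  revert hi Hl. apply Z_interval_ind.
  - rewrite !sum_Z_empty by lia. ring.
  - intros m Hm IH. rewrite !sum_Z_last, IH by lia. ring.
Qed.

Lemma is_lim_seq_sum_Z (u : Z -> nat -> R) (l : Z -> R) (lo hi : Z) :
  (forall k, is_lim_seq (u k) (l k)) ->
  is_lim_seq (fun n => sum_Z (fun k => u k n) lo hi) (sum_Z l lo hi).
Proof.
  intros H.
  assert (He : forall hi, (hi < lo)%Z -> is_lim_seq (fun n => sum_Z (fun k => u k n) lo hi) (sum_Z l lo hi)).
  { intros m Hm. apply (is_lim_seq_ext (fun _ => 0)); [intros; now rewrite sum_Z_empty by exact Hm | ].
    rewrite sum_Z_empty by exact Hm. apply is_lim_seq_const. }
  destruct (Z_le_dec lo (hi + 1)) as [Hl | Hl]; [ | apply He; lia].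
  revert hi Hl. apply Z_interval_ind; [apply He; lia | ].
  intros m Hm IH. rewrite sum_Z_last by exact Hm.
  apply (is_lim_seq_ext (fun n => sum_Z (fun k => u k n) lo m + u (m + 1)%Z n)).
  { intros n. rewrite sum_Z_last by exact Hm. reflexivity. }
  apply is_lim_seq_plus'; [exact IH | apply H].
Qed.

Lemma fejer_sum_le (n : nat) (h t d : R) : 0 < h -> 0 < d <= h / 2 -> d <= Rabs t <= h / 2 ->
  fejer n h t <= / sin (PI / h * d) ^ 2.
Proof.
  intros Hh Hd Ht. pose proof PI_RGT_0 as Hpi.
  assert (Hc : 0 < PI / h) by pos.
  assert (Hhalf : PI / h * (h / 2) = PI / 2) by (field; lra).
  assert (H1 : 0 < PI / h * d) by pos.
  assert (H2 : PI / h * d <= PI / h * Rabs t) by (apply Rmult_le_compat_l; lra).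
  assert (H3 : PI / h * Rabs t <= PI / 2) by (rewrite <- Hhalf; apply Rmult_le_compat_l; lra).
  assert (Hs0 : 0 < sin (PI / h * d)) by (apply sin_gt_0; lra).
  assert (Hs1 : sin (PI / h * d) <= sin (PI / h * Rabs t)) by (apply sin_incr_1; lra).
  assert (Hs2 : sin (PI / h * t) ^ 2 = sin (PI / h * Rabs t) ^ 2).
  { unfold Rabs. destruct (Rcase_abs t); [ | reflexivity].
    replace (PI / h * - t) with (- (PI / h * t)) by ring. rewrite sin_neg. ring. }
  pose proof (fejer_sum_sin n (PI / h * t)) as He. rewrite Hs2 in He.
  replace (2 * PI / h * t) with (2 * (PI / h * t)) by (field; lra).
  assert (Hb : sin (INR n * (PI / h * t)) ^ 2 <= 1).
  { pose proof (SIN_bound (INR n * (PI / h * t))). nra. }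
  pose proof (fejer_sum_ge0 n (2 * (PI / h * t))) as Hf.
  replace (/ sin (PI / h * d) ^ 2) with (1 / sin (PI / h * d) ^ 2) by (unfold Rdiv; ring).
  apply le_div_of_mul_le; [apply pow_lt, Hs0 | ].
  eapply Rle_trans; [ | exact Hb]. rewrite <- He. apply Rmult_le_compat_l; [exact Hf | ].
  apply pow_incr. lra.
Qed.

Lemma fejer_approximate_identity (psi : R -> R) (h M : R) : 0 < h ->
  (forall x, continuous psi x) -> (forall x, Rabs (psi x) <= M) ->
  is_lim_seq (fun n => / INR n * RInt (fun t => psi t * fejer n h t) (- (h / 2)) (h / 2))
    (h * psi 0).
Proof.
  intros Hh Hcont HM.
  apply is_lim_seq_spec. intros eps. pose proof (cond_pos eps) as Heps.
  assert (Hc0 : continuity_pt psi 0) by apply continuity_pt_filterlim, Hcont.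
  destruct (Hc0 (eps / (2 * h))) as [d0 [Hd0 Hd]].
  { pos. }
  set (d := Rmin (d0 / 2) (h / 2)).
  assert (Hdp : 0 < d <= h / 2).
  { unfold d. split; [apply Rmin_pos; lra | apply Rmin_r]. }
  assert (Hdd : d < d0) by (pose proof (Rmin_l (d0 / 2) (h / 2)); unfold d; lra).
  set (s := / sin (PI / h * d) ^ 2).
  assert (HM0 : 0 <= M) by (eapply Rle_trans; [apply Rabs_pos | apply (HM 0)]).
  pose proof PI_RGT_0 as Hpi.
  assert (Hs : 0 < s).
  { apply Rinv_0_lt_compat, pow_lt, sin_gt_0.
    - apply Rmult_lt_0_compat; [pos | lra].
    - assert (PI / h * d <= PI / h * (h / 2)).
      { apply Rmult_le_compat_l; [pos | lra]. }
      replace (PI / h * (h / 2)) with (PI / 2) in H by (field; lra). lra. }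
  assert (Hcf : forall n x, continuous (fun t => psi t * fejer n h t) x).
  { intros n x. apply (continuous_mult psi (fun t => fejer n h t)); [apply Hcont | apply continuous_fejer_sum]. }
  assert (Hcg : forall n x, continuous (fun t => psi 0 * fejer n h t) x).
  { intros n x. apply (continuous_mult (fun _ => psi 0) (fun t => fejer n h t)); [apply continuous_const | apply continuous_fejer_sum]. }
  (* Continuity of [psi] at 0 gives the first term where $|t| < d$; elsewhere in the period the
     kernel is at most [s], independently of [n], and division by [n] removes that term. *)
  assert (Hmain : forall n,
    Rabs (RInt (fun t => psi t * fejer n h t) (- (h / 2)) (h / 2) - psi 0 * (INR n * h))
      <= eps / (2 * h) * (INR n * h) + 2 * M * s * h).
  { intros n. rewrite <- (RInt_fejer_sum_period n h Hh).
    rewrite <- !RInt_scal_R by (apply ex_RInt_everywhere; intros; apply continuous_fejer_sum).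
    rewrite <- RInt_minus_R by (apply ex_RInt_everywhere; intros; apply Hcf || apply Hcg).
    assert (Hcd : forall x, continuous (fun t => psi t * fejer n h t - psi 0 * fejer n h t) x).
    { intros x. apply (continuous_minus (fun t => psi t * fejer n h t)); [apply Hcf | apply Hcg]. }
    assert (Hce : forall x, continuous (fun t => eps / (2 * h) * fejer n h t) x).
    { intros x. apply (continuous_mult (fun _ => eps / (2 * h)) (fun t => fejer n h t)); [apply continuous_const | apply continuous_fejer_sum]. }
    replace (2 * M * s * h) with (RInt (fun _ => 2 * M * s) (- (h / 2)) (h / 2)).
    2: { rewrite RInt_const. unfold scal; simpl; unfold mult; simpl. eqR. field. }
    rewrite <- RInt_plus_R; [ | apply ex_RInt_everywhere; intros; apply Hce | apply ex_RInt_const].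
    eapply Rle_trans; [apply abs_RInt_le; [lra | apply ex_RInt_everywhere; intros; apply Hcd] | ].
    apply RInt_le; [lra | | | ].
    - apply ex_RInt_everywhere. intros x.
      apply (continuous_comp (fun t => psi t * fejer n h t - psi 0 * fejer n h t) Rabs);
        [apply Hcd | apply continuous_Rabs].
    - apply ex_RInt_everywhere. intros x.
      apply (continuous_plus (fun t => eps / (2 * h) * fejer n h t) (fun _ => 2 * M * s));
        [apply Hce | apply continuous_const].
    - intros t Ht.
      replace (psi t * fejer n h t - psi 0 * fejer n h t)
        with ((psi t - psi 0) * fejer n h t) by ring.
      rewrite Rabs_mult, (Rabs_right (fejer_sum n _)) by (apply Rle_ge, fejer_sum_ge0).
      pose proof (fejer_sum_ge0 n (2 * PI / h * t)) as Hf.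
      destruct (Rlt_dec (Rabs t) d) as [Htd | Htd].
      + assert (Rabs (psi t - psi 0) <= eps / (2 * h)).
        { destruct (Req_dec t 0) as [-> | Ht0].
          - rewrite Rminus_diag, Rabs_R0. pos.
          - left. apply (Hd t). split; [split; [exact I | auto] | ].
            unfold dist; simpl; unfold R_dist. rewrite Rminus_0_r. lra. }
        assert (0 <= 2 * M * s) by pos.
        enough (Rabs (psi t - psi 0) * fejer n h t <= eps / (2 * h) * fejer n h t) by lra.
        apply Rmult_le_compat_r; assumption.
      + assert (Hfs : fejer n h t <= s).
        { apply fejer_sum_le; [exact Hh | exact Hdp | ]. split; [lra | apply Rabs_le; lra]. }
        assert (Rabs (psi t - psi 0) <= 2 * M).
        { pose proof (HM t) as H1. pose proof (HM 0) as H2.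
          pose proof (Rabs_triang (psi t) (- psi 0)) as H3. rewrite Rabs_Ropp in H3.
          unfold Rminus. lra. }
        assert (0 <= eps / (2 * h) * fejer n h t).
        { apply Rmult_le_pos; [pos | exact Hf]. }
        enough (Rabs (psi t - psi 0) * fejer n h t <= 2 * M * s) by lra.
        apply Rmult_le_compat; [apply Rabs_pos | exact Hf | assumption | assumption]. }
  destruct (nfloor_ex (4 * M * s * h / eps)) as [N HN].
  { apply Rdiv_le_0_compat; [ | exact Heps]. pos. }
  exists (S (S N)). intros n Hn.
  assert (Hn1 : INR N + 2 <= INR n).
  { apply le_INR in Hn. rewrite !S_INR in Hn. lra. }
  pose proof (pos_INR N) as HN0.
  specialize (Hmain n).
  set (I := RInt (fun t => psi t * fejer n h t) (- (h / 2)) (h / 2)) in *.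
  replace (/ INR n * I - h * psi 0) with (/ INR n * (I - psi 0 * (INR n * h))) by (field; lra).
  rewrite Rabs_mult, Rabs_right by (apply Rle_ge, Rlt_le, Rinv_0_lt_compat; lra).
  apply Rmult_lt_reg_l with (INR n); [lra | ].
  rewrite <- Rmult_assoc, Rinv_r, Rmult_1_l by lra.
  eapply Rle_lt_trans; [exact Hmain | ].
  assert (4 * M * s * h < eps * INR n).
  { destruct HN as [_ HN]. apply (Rmult_lt_compat_r eps) in HN; [ | exact Heps].
    replace (4 * M * s * h / eps * eps) with (4 * M * s * h) in HN by (field; lra). nra. }
  replace (eps / (2 * h) * (INR n * h)) with (eps * INR n / 2) by (field; lra). lra.
Qed.

(** The part of the Fejer integral from the period centred at the node $kh$. Divided by [n] it tends
    to $h f(kh)$; the trapezoidal sum arises in this way, and Poisson summation is avoided. *)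
Definition fejer_cell (f : R -> R) (h : R) (n : nat) (k : Z) : R :=
  RInt (fun t => f (IZR k * h + t) * fejer n h t) (- (h / 2)) (h / 2).

Lemma continuous_mul_fejer (f : R -> R) (h x : R) (n : nat) : (forall x, continuous f x) ->
  continuous (fun t => f t * fejer n h t) x.
Proof.
  intros Hf. apply (continuous_mult f (fun t => fejer n h t)); [apply Hf | apply continuous_fejer_sum].
Qed.

Lemma continuous_translate (f : R -> R) (c x : R) : (forall x, continuous f x) ->
  continuous (fun t => f (c + t)) x.
Proof.
  intros Hf. apply (continuous_comp (fun t => c + t) f); [ | apply Hf].
  smooth.
Qed.

Lemma fejer_cell_eq (f : R -> R) (h : R) (n : nat) (k : Z) : 0 < h -> (forall x, continuous f x) ->
  RInt (fun t => f t * fejer n h t) ((IZR k - 1 / 2) * h) ((IZR k + 1 / 2) * h)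
  = fejer_cell f h n k.
Proof.
  intros Hh Hf.
  replace ((IZR k - 1 / 2) * h) with (1 * - (h / 2) + IZR k * h) by field.
  replace ((IZR k + 1 / 2) * h) with (1 * (h / 2) + IZR k * h) by field.
  rewrite <- (RInt_comp_lin_R (fun t => f t * fejer n h t)).
  - unfold fejer_cell. apply RInt_ext_R. intros t.
    rewrite !Rmult_1_l.
    replace (2 * PI / h * (t + IZR k * h)) with (2 * PI / h * t + 2 * IZR k * PI) by (field; lra).
    rewrite fejer_sum_period. now rewrite (Rplus_comm t).
  - apply ex_RInt_everywhere. intros; now apply continuous_mul_fejer.
Qed.

Lemma RInt_fejer_cells (f : R -> R) (h : R) (n : nat) (lo hi : Z) : 0 < h -> (forall x, continuous f x) ->
  (lo <= hi + 1)%Z ->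
  RInt (fun t => f t * fejer n h t) ((IZR lo - 1 / 2) * h) ((IZR hi + 1 / 2) * h)
  = sum_Z (fejer_cell f h n) lo hi.
Proof.
  intros Hh Hf. revert hi. apply Z_interval_ind.
  - rewrite sum_Z_empty, minus_IZR by lia.
    replace ((IZR lo - 1 + 1 / 2) * h) with ((IZR lo - 1 / 2) * h) by field.
    exact (RInt_point _ (fun t => f t * fejer n h t)).
  - intros m Hm IH. rewrite sum_Z_last, <- IH, <- (fejer_cell_eq f h n (m + 1) Hh Hf), plus_IZR by lia.
    replace ((IZR m + 1 - 1 / 2) * h) with ((IZR m + 1 / 2) * h) by field.
    symmetry. apply RInt_Chasles_R; apply ex_RInt_everywhere; intros; now apply continuous_mul_fejer.
Qed.

Lemma fejer_cell_bounds (f : R -> R) (h c : R) (n : nat) (k : Z) : 0 < h -> (forall x, continuous f x) ->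
  (forall t, - (h / 2) <= t <= h / 2 -> 0 <= f (IZR k * h + t) <= c) ->
  0 <= fejer_cell f h n k <= INR n * h * c.
Proof.
  intros Hh Hf Hc.
  assert (Hcont : forall x, continuous (fun t => f (IZR k * h + t) * fejer n h t) x).
  { intros x. apply (continuous_mul_fejer (fun t => f (IZR k * h + t))). intros y. now apply continuous_translate. }
  unfold fejer_cell. split.
  - apply RInt_ge_0; [lra | now apply ex_RInt_everywhere | ].
    intros t Ht. apply Rmult_le_pos; [apply Hc; lra | apply fejer_sum_ge0].
  - rewrite <- (RInt_fejer_sum_period n h Hh), (Rmult_comm _ c), <- RInt_scal_R
      by (apply ex_RInt_everywhere; intros; apply continuous_fejer_sum).
    apply RInt_le; [lra | now apply ex_RInt_everywhere | | ].
    + apply ex_RInt_everywhere. intros x.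
      apply (continuous_mult (fun _ => c) (fun t => fejer n h t)); [apply continuous_const | apply continuous_fejer_sum].
    + intros t Ht. apply Rmult_le_compat_r; [apply fejer_sum_ge0 | apply Hc; lra].
Qed.

(** * The trapezoidal rule *)

(* [e^{2 pi d / h}] for the half-width [d = PI / 3] of the strip. *)
Definition strip_factor (h : R) : R := exp (2 * PI ^ 2 / (3 * h)).

Lemma strip_factor_gt1 (h : R) : 0 < h -> 1 < strip_factor h.
Proof.
  intros Hh. unfold strip_factor. rewrite <- exp_0. apply exp_increasing.
  pose proof PI_RGT_0. apply Rdiv_lt_0_compat; [apply Rmult_lt_0_compat; [lra | pos] | lra].
Qed.

Lemma strip_factor_pow (h : R) (n : nat) : 0 < h ->
  exp (- (INR n * (2 * PI / h) * (PI / 3))) = / strip_factor h ^ n.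
Proof.
  intros Hh. rewrite exp_Ropp. f_equal. unfold strip_factor.
  induction n as [|n IH].
  - simpl. rewrite !Rmult_0_l. apply exp_0.
  - rewrite S_INR, <- tech_pow_Rmult, <- IH, <- exp_plus. f_equal. field. lra.
Qed.

Definition phi_edge (b q T : R) : R := phi b q T + phi b q (- T).

Lemma continuous_phi_dirichlet (b q h x : R) (n : nat) :
  continuous (fun t => phi b q t * dirichlet n (2 * PI / h * t)) x.
Proof.
  apply (continuous_mult (phi b q) (fun t => dirichlet n (2 * PI / h * t)));
    [apply continuous_phi | apply continuous_dirichlet].
Qed.

(** The $k$-th frequency contributes $X^{-k}$, and $X^{-1} + \dots + X^{-n} = (1 - X^{-n})/(X -
    1)$. *)
Lemma phi_dirichlet_bound (b q h T : R) (n : nat) : 0 < q -> 0 < h -> 0 <= T ->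
  Rabs (RInt (fun t => phi b q t * dirichlet n (2 * PI / h * t)) (- T) T - RInt (phi b q) (- T) T)
  <= 2 * RInt (phi b (q / 2)) (- T) T * ((1 - / strip_factor h ^ n) / (strip_factor h - 1))
     + 4 * INR n * phi_edge b (q / 2) T.
Proof.
  intros Hq Hh HT. pose proof (strip_factor_gt1 h Hh) as HX. pose proof PI_RGT_0 as Hpi.
  induction n as [|n IH].
  - simpl. rewrite (RInt_ext_R _ (phi b q)) by (intros; ring).
    rewrite Rminus_diag, Rabs_R0, Rinv_1. unfold Rdiv. lra.
  - set (xi := INR (S n) * (2 * PI / h)).
    assert (Hc : forall x, continuous (fun t => phi b q t * cos (xi * t)) x).
    { intros x. unfold phi. smooth. }
    rewrite (RInt_ext_R _ (fun t => phi b q t * dirichlet n (2 * PI / h * t) + 2 * (phi b q t * cos (xi * t)))).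
    2: { intros t. change (dirichlet (S n) (2 * PI / h * t))
           with (dirichlet n (2 * PI / h * t) + 2 * cos (INR (S n) * (2 * PI / h * t))).
         replace (INR (S n) * (2 * PI / h * t)) with (xi * t) by (unfold xi; ring). ring. }
    rewrite RInt_plus_R, RInt_scal_R.
    2: { apply ex_RInt_everywhere, Hc. }
    2: { apply ex_RInt_everywhere. intros; apply continuous_phi_dirichlet. }
    2: { apply ex_RInt_everywhere. intros x. apply (continuous_mult (fun _ => 2) (fun t => phi b q t * cos (xi * t)));
           [apply continuous_const | apply Hc]. }
    assert (Hxi : 0 <= xi).
    { unfold xi. apply Rmult_le_pos; [apply pos_INR | pos]. }
    pose proof (fourier_phi_bound b q xi T Hq Hxi HT) as HF.
    unfold xi in HF at 2. rewrite (strip_factor_pow h (S n) Hh) in HF.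
    set (X := strip_factor h) in *. set (N := RInt (phi b (q / 2)) (- T) T) in *.
    fold (phi_edge b (q / 2) T) in HF. set (e := phi_edge b (q / 2) T) in *.
    set (I0 := RInt (phi b q) (- T) T) in *.
    set (I1 := RInt (fun t => phi b q t * dirichlet n (2 * PI / h * t)) (- T) T) in *.
    set (I2 := RInt (fun t => phi b q t * cos (xi * t)) (- T) T) in *.
    replace (I1 + 2 * I2 - I0) with ((I1 - I0) + 2 * I2) by ring.
    eapply Rle_trans; [apply Rabs_triang | ].
    rewrite (Rabs_mult 2 I2), (Rabs_right 2) by lra.
    assert (HXn : 0 < X ^ n) by pos.
    replace ((1 - / X ^ S n) / (X - 1)) with ((1 - / X ^ n) / (X - 1) + / X ^ S n).
    2: { rewrite <- tech_pow_Rmult. field. split; lra. }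
    rewrite S_INR. lra.
Qed.

Lemma RInt_phi_ge0 (b q T : R) : 0 <= T -> 0 <= RInt (phi b q) (- T) T.
Proof.
  intros HT. apply RInt_ge_0; [lra | apply ex_RInt_everywhere, continuous_phi | ].
  intros; left; apply phi_pos.
Qed.

(** The main error is only linear in [n], since the geometric sum is bounded. The edge term is
    quadratic, which does no harm because $T \to \infty$ is taken at fixed [n]. *)
Lemma phi_fejer_bound (b q h T : R) (n : nat) : 0 < q -> 0 < h -> 0 <= T ->
  Rabs (RInt (fun t => phi b q t * fejer n h t) (- T) T - INR n * RInt (phi b q) (- T) T)
  <= INR n * (2 * RInt (phi b (q / 2)) (- T) T / (strip_factor h - 1))
     + 4 * INR n ^ 2 * phi_edge b (q / 2) T.
Proof.
  intros Hq Hh HT. pose proof (strip_factor_gt1 h Hh) as HX.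
  assert (He : 0 <= phi_edge b (q / 2) T).
  { unfold phi_edge. pose proof (phi_pos b (q / 2) T). pose proof (phi_pos b (q / 2) (- T)). lra. }
  pose proof (RInt_phi_ge0 b (q / 2) T HT) as HN.
  induction n as [|n IH].
  - simpl. rewrite (RInt_ext_R _ (fun _ => 0)) by (intros; ring).
    rewrite RInt_const. unfold scal; simpl; unfold mult; simpl.
    rewrite Rmult_0_r, !Rmult_0_l, Rminus_0_r, Rabs_R0. lra.
  - rewrite (RInt_ext_R _ (fun t => phi b q t * fejer n h t + phi b q t * dirichlet n (2 * PI / h * t))).
    2: { intros t. simpl. ring. }
    rewrite RInt_plus_R.
    2: { apply ex_RInt_everywhere. intros; apply continuous_mul_fejer, continuous_phi. }
    2: { apply ex_RInt_everywhere. intros; apply continuous_phi_dirichlet. }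
    pose proof (phi_dirichlet_bound b q h T n Hq Hh HT) as HD.
    set (X := strip_factor h) in *. set (N := RInt (phi b (q / 2)) (- T) T) in *.
    set (e := phi_edge b (q / 2) T) in *. set (I0 := RInt (phi b q) (- T) T) in *.
    set (I1 := RInt (fun t => phi b q t * dirichlet n (2 * PI / h * t)) (- T) T) in *.
    set (I2 := RInt (fun t => phi b q t * fejer n h t) (- T) T) in *.
    rewrite S_INR. replace (I2 + I1 - (INR n + 1) * I0) with ((I2 - INR n * I0) + (I1 - I0)) by ring.
    eapply Rle_trans; [apply Rabs_triang | ].
    assert (HXn : 0 < / X ^ n) by (apply Rinv_0_lt_compat, pow_lt; lra).
    assert (2 * N * ((1 - / X ^ n) / (X - 1)) <= 2 * N / (X - 1)).
    { unfold Rdiv. rewrite <- Rmult_assoc. apply Rmult_le_compat_r; [pos | nra]. }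
    pose proof (pos_INR n).
    assert (0 <= (4 * INR n + 4) * e) by pos.
    nra.
Qed.

(** The bound is uniform in $q \ge p$ because [dens] will be a mixture over $q = p + 1 - v^2$ and
    the tails must be integrated over $v$. *)
Lemma phi_dominated (b q p t : R) : 1 / 2 <= b <= 3 / 2 -> 0 < p <= q ->
  phi b q t <= (1 + 2 / p ^ 2) * exp (- Rabs t / 2).
Proof.
  intros Hb Hp. assert (Hp2 : 0 < p ^ 2) by pos.
  assert (H2p : 0 < 2 / p ^ 2) by pos.
  pose proof (exp_pos t) as He. unfold phi, Rabs. destruct (Rcase_abs t) as [Ht | Ht].
  - apply Rle_trans with (1 * exp (- - t / 2)).
    + rewrite Rmult_1_l. apply exp_le_mono. nra.
    + apply Rmult_le_compat_r; [pos | lra].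
  - apply Rle_trans with (2 / p ^ 2 * exp (- t / 2)).
    + replace (b * t - q * exp t) with ((b * t + t / 2 - q * exp t) + - t / 2) by field.
      rewrite exp_plus. apply Rmult_le_compat_r; [pos | ].
      (* As $b + 1/2 \le 2$, the growth is at most $e^{2t}$, and the quadratic term of $\exp(p e^t)$
         outweighs it. *)
      apply Rle_trans with (exp (2 * t + - (p * exp t))); [apply exp_le_mono; nra | ].
      rewrite exp_plus, exp_Ropp. apply div_le_of_le_mul; [apply exp_pos | ].
      replace (exp (2 * t)) with (exp t * exp t) by (rewrite <- exp_plus; f_equal; ring).
      pose proof (exp_quad_le (p * exp t) ltac:(nra)) as H.
      apply Rle_trans with (2 / p ^ 2 * ((p * exp t) ^ 2 / 2)); [right; field; lra | ].
      apply Rmult_le_compat_l; [lra | nra].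
    + apply Rmult_le_compat_r; [pos | lra].
Qed.

(** A geometric series over the cells $|k| > K$, on which $|t| \ge (|k| - 1/2) h$; the half cell is
    the source of $e^{h/4}$, and the leading 2 counts both sides. *)
Definition cell_tail (h C : R) (K : nat) : R :=
  2 * (h * C * exp (h / 4)) * (exp (- h / 2) ^ (S K) / (1 - exp (- h / 2))).

Lemma is_lim_seq_cell_tail (h C : R) : 0 < h -> is_lim_seq (cell_tail h C) 0.
Proof.
  intros Hh. unfold cell_tail.
  assert (Hr : 0 < exp (- h / 2) < 1).
  { split; [apply exp_pos | rewrite <- exp_0; apply exp_increasing; lra]. }
  set (c := 2 * (h * C * exp (h / 4))).
  apply (is_lim_seq_ext (fun K => c / (1 - exp (- h / 2)) * exp (- h / 2) ^ S K)).
  { intros K. unfold Rdiv. ring. }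
  replace (Finite 0) with (Rbar_mult (c / (1 - exp (- h / 2))) 0) by (simpl; f_equal; ring).
  apply is_lim_seq_scal_l. apply (is_lim_seq_incr_1 (fun K => exp (- h / 2) ^ K)).
  apply is_lim_seq_geom. rewrite Rabs_right; lra.
Qed.

Lemma sum_Z_dominated_tail (c : Z -> R) (h C m : R) (K K' : nat) : 0 < h -> 0 <= C -> 0 <= m -> (K <= K')%nat ->
  (forall k, (Z.of_nat K < Z.abs k)%Z -> 0 <= c k <= m * h * (C * exp (- ((Rabs (IZR k) - 1 / 2) * h) / 2))) ->
  sum_Z c (- Z.of_nat K) (Z.of_nat K) <= sum_Z c (- Z.of_nat K') (Z.of_nat K')
    <= sum_Z c (- Z.of_nat K) (Z.of_nat K) + m * cell_tail h C K.
Proof.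
  intros Hh HC Hm HK Hc.
  assert (Hr : 0 < exp (- h / 2) < 1).
  { split; [apply exp_pos | rewrite <- exp_0; apply exp_increasing; lra]. }
  set (r := exp (- h / 2)) in *.
  set (D := h * C * exp (h / 4)).
  assert (HD : 0 <= D) by (unfold D; repeat apply Rmult_le_pos; try lra; pos).
  assert (Hgeo : forall k : nat, h * (C * exp (- ((INR k - 1 / 2) * h) / 2)) = D * r ^ k).
  { intros k. unfold D, r.
    replace (- ((INR k - 1 / 2) * h) / 2) with (h / 4 + INR k * (- h / 2)) by field.
    rewrite exp_plus.
    replace (exp (INR k * (- h / 2))) with (exp (- h / 2) ^ k).
    - ring.
    - induction k as [|k IH]; [simpl; rewrite Rmult_0_l, exp_0; reflexivity | ].
      rewrite <- tech_pow_Rmult, IH, S_INR, <- exp_plus. f_equal. ring. }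
  enough (H : sum_Z c (- Z.of_nat K) (Z.of_nat K) <= sum_Z c (- Z.of_nat K') (Z.of_nat K')
    <= sum_Z c (- Z.of_nat K) (Z.of_nat K) + m * (2 * D * ((r ^ S K - r ^ S K') / (1 - r)))).
  { split; [apply H | ]. eapply Rle_trans; [apply H | ]. apply Rplus_le_compat_l, Rmult_le_compat_l; [exact Hm | ].
    unfold cell_tail. fold r D. apply Rmult_le_compat_l; [lra | ].
    unfold Rdiv. apply Rmult_le_compat_r; [pos | ].
    assert (0 < r ^ S K') by pos. lra. }
  induction HK as [|K' HK IH].
  - rewrite Rminus_diag. unfold Rdiv. lra.
  - replace (- Z.of_nat (S K'))%Z with (- Z.of_nat K' - 1)%Z by lia.
    replace (Z.of_nat (S K')) with (Z.of_nat K' + 1)%Z by lia.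
    rewrite sum_Z_last, (sum_Z_first c (- Z.of_nat K' - 1)) by lia.
    replace (- Z.of_nat K' - 1 + 1)%Z with (- Z.of_nat K')%Z by lia.
    assert (Hk : forall k, Z.abs k = Z.of_nat (S K') -> 0 <= c k <= m * (D * r ^ S K')).
    { intros k Hk. rewrite <- Hgeo.
      replace (INR (S K')) with (Rabs (IZR k)) by (rewrite <- abs_IZR, Hk, <- INR_IZR_INZ; reflexivity).
      rewrite <- Rmult_assoc. apply Hc. lia. }
    pose proof (Hk (Z.of_nat K' + 1)%Z ltac:(lia)) as H1.
    pose proof (Hk (- Z.of_nat K' - 1)%Z ltac:(lia)) as H2.
    split; [lra | ].
    replace ((r ^ S K - r ^ S (S K')) / (1 - r)) with ((r ^ S K - r ^ S K') / (1 - r) + r ^ S K')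
      by (rewrite <- (tech_pow_Rmult r (S K')); field; lra).
    lra.
Qed.

Lemma trapezoid_phi (b q p h J J2 : R) (K : nat) :
  1 / 2 <= b <= 3 / 2 -> 0 < p <= q -> 0 < h ->
  is_lim (fun T => RInt (phi b q) (- T) T) p_infty J ->
  (forall T, 0 <= T -> RInt (phi b (q / 2)) (- T) T <= J2) ->
  Rabs (h * sum_Z (fun k => phi b q (IZR k * h)) (- Z.of_nat K) (Z.of_nat K) - J)
  <= 2 * J2 / (strip_factor h - 1) + cell_tail h (1 + 2 / p ^ 2) K.
Proof.
  intros Hb Hp Hh HJ HJ2. set (C := 1 + 2 / p ^ 2).
  assert (HC : 0 <= C).
  { unfold C. assert (0 < 2 / p ^ 2) by pos. lra. }
  pose proof (strip_factor_gt1 h Hh) as HX. set (X := strip_factor h) in *.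
  assert (Hedge : is_lim (phi_edge b (q / 2)) p_infty 0).
  { set (C2 := 1 + 2 / (p / 2) ^ 2).
    apply (is_lim_le_le_loc (fun _ => 0) (fun T => 2 * C2 * exp (- T / 2))).
    - exists 0. intros T HT. unfold phi_edge.
      pose proof (phi_dominated b (q / 2) (p / 2) T Hb ltac:(lra)) as H1.
      pose proof (phi_dominated b (q / 2) (p / 2) (- T) Hb ltac:(lra)) as H2.
      rewrite Rabs_Ropp in H2. rewrite Rabs_right in H1, H2 by lra.
      pose proof (phi_pos b (q / 2) T). pose proof (phi_pos b (q / 2) (- T)). unfold C2. lra.
    - apply is_lim_const.
    - replace (Finite 0) with (Rbar_mult (2 * C2) 0) by (simpl; f_equal; ring).
      apply is_lim_scal_l.
      apply (is_lim_comp exp (fun T => - T / 2) p_infty 0 m_infty).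
      + apply is_lim_exp_m.
      + apply (is_lim_ext (fun T => (- / 2) * T)); [intros; field | ].
        replace m_infty with (Rbar_mult (- / 2) p_infty).
        * apply is_lim_scal_l, is_lim_id.
        * simpl. destruct (Rle_dec 0 (- / 2)) as [H | H]; [exfalso; lra | reflexivity].
      + exists 0. intros y _. discriminate. }
  assert (HTK : is_lim_seq (fun K => (IZR (Z.of_nat K) + 1 / 2) * h) p_infty).
  { apply (is_lim_seq_ext (fun K => h * INR K + h / 2)).
    { intros n. rewrite <- INR_IZR_INZ. field. }
    apply (is_lim_seq_plus _ _ p_infty (h / 2)); [ | apply is_lim_seq_const | reflexivity].
    rewrite <- (Rbar_mult_pos_p_infty h Hh). apply is_lim_seq_scal_l, is_lim_seq_INR. }
  set (S := fun n : nat => sum_Z (fejer_cell (phi b q) h n) (- Z.of_nat K) (Z.of_nat K)).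
  (* First limit: [n] is fixed and the integration window grows, so the edge terms vanish while the
     cells beyond [K] remain under control. *)
  assert (Hfin : forall n : nat,
    INR n * (J - 2 * J2 / (X - 1) - cell_tail h C K) <= S n <= INR n * (J + 2 * J2 / (X - 1))).
  { intros n.
    set (T := fun K' : nat => (IZR (Z.of_nat K') + 1 / 2) * h).
    assert (HB : forall K', (K <= K')%nat ->
      S n <= INR n * RInt (phi b q) (- T K') (T K') + INR n * (2 * J2 / (X - 1)) + 4 * INR n ^ 2 * phi_edge b (q / 2) (T K')
      /\ INR n * RInt (phi b q) (- T K') (T K') - INR n * (2 * J2 / (X - 1)) - 4 * INR n ^ 2 * phi_edge b (q / 2) (T K')
         - INR n * cell_tail h C K <= S n).
    { intros K' HK'.
      assert (HT : 0 <= T K').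
      { unfold T. rewrite <- INR_IZR_INZ. pose proof (pos_INR K'). nra. }
      pose proof (phi_fejer_bound b q h (T K') n ltac:(lra) Hh HT) as HF.
      replace (RInt (fun t => phi b q t * fejer n h t) (- T K') (T K'))
        with (sum_Z (fejer_cell (phi b q) h n) (- Z.of_nat K') (Z.of_nat K')) in HF.
      2: { rewrite <- (RInt_fejer_cells (phi b q) h n); [ | exact Hh | apply continuous_phi | lia].
           f_equal. rewrite opp_IZR. unfold T. ring. }
      pose proof (HJ2 (T K') HT) as HN. fold X in HF.
      assert (HN2 : INR n * (2 * RInt (phi b (q / 2)) (- T K') (T K') / (X - 1)) <= INR n * (2 * J2 / (X - 1))).
      { apply Rmult_le_compat_l; [apply pos_INR | ]. unfold Rdiv.
        apply Rmult_le_compat_r; [pos | lra]. }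
      pose proof (sum_Z_dominated_tail (fejer_cell (phi b q) h n) h C (INR n) K K' Hh HC (pos_INR n) HK') as Htl.
      fold (S n) in Htl.
      assert (Hcells : forall k, (Z.of_nat K < Z.abs k)%Z ->
        0 <= fejer_cell (phi b q) h n k <= INR n * h * (C * exp (- ((Rabs (IZR k) - 1 / 2) * h) / 2))).
      { intros k _. apply fejer_cell_bounds; [exact Hh | apply continuous_phi | ].
        intros t Ht. split; [left; apply phi_pos | ].
        eapply Rle_trans; [apply (phi_dominated b q p _ Hb Hp) | ].
        apply Rmult_le_compat_l; [exact HC | ]. apply exp_le_mono.
        pose proof (Rabs_triang_inv (IZR k * h) (- t)) as Htr.
        rewrite Rabs_mult, (Rabs_right h), Rabs_Ropp in Htr by lra.
        assert (Rabs t <= h / 2) by (apply Rabs_le; lra).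
        unfold Rminus in Htr. rewrite Ropp_involutive in Htr. lra. }
      specialize (Htl Hcells). apply Rabs_le_between in HF. split; lra. }
    assert (HlimT : forall c e1 e2 : R, is_lim_seq
       (fun K' => INR n * RInt (phi b q) (- T K') (T K') + e1 + e2 * phi_edge b (q / 2) (T K') + c)
       (INR n * J + e1 + e2 * 0 + c)).
    { intros c e1 e2.
      assert (L1 : is_lim_seq (fun K' => RInt (phi b q) (- T K') (T K')) J).
      { apply (is_lim_comp_seq (fun T => RInt (phi b q) (- T) T) T p_infty J HJ); [ | exact HTK].
        exists 0%nat. intros; discriminate. }
      assert (L2 : is_lim_seq (fun K' => phi_edge b (q / 2) (T K')) 0).
      { apply (is_lim_comp_seq (phi_edge b (q / 2)) T p_infty 0 Hedge); [ | exact HTK].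
        exists 0%nat. intros; discriminate. }
      repeat apply is_lim_seq_plus'; try apply is_lim_seq_const.
      - apply (is_lim_seq_scal_l _ (INR n) J L1).
      - apply (is_lim_seq_scal_l _ e2 0 L2). }
    split.
    - pose proof (HlimT (- (INR n * cell_tail h C K)) (- (INR n * (2 * J2 / (X - 1)))) (- (4 * INR n ^ 2))) as HL.
      apply (is_lim_seq_le_loc _ (fun _ => S n) _ (S n)) in HL.
      + simpl in HL. lra.
      + exists K. intros K' HK'. destruct (HB K' HK') as [_ H]. lra.
      + apply is_lim_seq_const.
    - pose proof (HlimT 0 (INR n * (2 * J2 / (X - 1))) (4 * INR n ^ 2)) as HL.
      apply (is_lim_seq_le_loc (fun _ => S n) _ (S n)) in HL.
      + simpl in HL. lra.
      + exists K. intros K' HK'. destruct (HB K' HK') as [H _]. lra.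
      + apply is_lim_seq_const. }
  (* Second limit: [n] grows with [K] fixed, and each of the finitely many cells tends to its node
     value. *)
  assert (HS : is_lim_seq (fun n => / INR n * S n) (h * sum_Z (fun k => phi b q (IZR k * h)) (- Z.of_nat K) (Z.of_nat K))).
  { rewrite <- sum_Z_scal.
    assert (Hcell : forall k, is_lim_seq (fun n => / INR n * fejer_cell (phi b q) h n k) (h * phi b q (IZR k * h))).
    { intros k. replace (phi b q (IZR k * h)) with (phi b q (IZR k * h + 0)) by (f_equal; ring).
      apply (fejer_approximate_identity (fun t => phi b q (IZR k * h + t)) h C Hh).
      - intros x. apply continuous_translate, continuous_phi.
      - intros x. rewrite Rabs_right by (apply Rle_ge, Rlt_le, phi_pos).
        eapply Rle_trans; [apply (phi_dominated b q p _ Hb Hp) | ].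
        fold C. rewrite <- (Rmult_1_r C) at 2. apply Rmult_le_compat_l; [exact HC | ].
        rewrite <- exp_0. apply exp_le_mono. pose proof (Rabs_pos (IZR k * h + x)). lra. }
    apply (is_lim_seq_ext (fun n => sum_Z (fun k => / INR n * fejer_cell (phi b q) h n k) (- Z.of_nat K) (Z.of_nat K))).
    { intros n. apply sum_Z_scal. }
    apply (is_lim_seq_sum_Z (fun k n => / INR n * fejer_cell (phi b q) h n k)), Hcell. }
  set (L := h * sum_Z (fun k => phi b q (IZR k * h)) (- Z.of_nat K) (Z.of_nat K)) in *.
  assert (HtK : 0 <= cell_tail h C K).
  { unfold cell_tail. assert (Hr : 0 < exp (- h / 2) < 1).
    { split; [apply exp_pos | rewrite <- exp_0; apply exp_increasing; lra]. }
    apply Rmult_le_pos.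
    - apply Rmult_le_pos; [lra | ]. apply Rmult_le_pos; [pos | pos].
    - apply Rdiv_le_0_compat; [pos | lra]. }
  assert (HL1 : J - 2 * J2 / (X - 1) - cell_tail h C K <= L).
  { apply (is_lim_seq_le_loc (fun _ => J - 2 * J2 / (X - 1) - cell_tail h C K) (fun n => / INR n * S n)
      (J - 2 * J2 / (X - 1) - cell_tail h C K) L); [ | apply is_lim_seq_const | exact HS].
    exists 1%nat. intros n Hn. assert (Hn1 : 0 < INR n) by (apply lt_0_INR; lia).
    destruct (Hfin n) as [H _]. apply Rmult_le_reg_l with (INR n); [exact Hn1 | ].
    rewrite <- Rmult_assoc, Rinv_r, Rmult_1_l by lra. exact H. }
  assert (HL2 : L <= J + 2 * J2 / (X - 1)).
  { apply (is_lim_seq_le_loc (fun n => / INR n * S n) (fun _ => J + 2 * J2 / (X - 1))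
      L (J + 2 * J2 / (X - 1))); [ | exact HS | apply is_lim_seq_const].
    exists 1%nat. intros n Hn. assert (Hn1 : 0 < INR n) by (apply lt_0_INR; lia).
    destruct (Hfin n) as [_ H]. apply Rmult_le_reg_l with (INR n); [exact Hn1 | ].
    rewrite <- Rmult_assoc, Rinv_r, Rmult_1_l by lra. exact H. }
  apply Rabs_le. lra.
Qed.

(** * Closed-form integrals and the mixture representation *)

Lemma exp_half_sqr (x : R) : exp (x / 2) ^ 2 = exp x.
Proof. simpl. rewrite Rmult_1_r, <- exp_plus. f_equal. field. Qed.

Lemma is_lim_exp_half (f : R -> R) (l : Rbar) : is_lim f p_infty l ->
  is_lim (fun T => f (exp (T / 2))) p_infty l.
Proof.
  intros H. apply (is_lim_comp f (fun T => exp (T / 2)) p_infty l p_infty); [exact H | | ].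
  - apply (is_lim_comp exp (fun T => T / 2) p_infty p_infty p_infty); [apply is_lim_exp_p | | ].
    + apply (is_lim_ext (fun T => / 2 * T)); [intros; field | ].
      rewrite <- (Rbar_mult_pos_p_infty (/ 2)) at 2 by lra. apply is_lim_scal_l, is_lim_id.
    + exists 0. intros; discriminate.
  - exists 0. intros; discriminate.
Qed.

Lemma is_lim_exp_mhalf : is_lim (fun T => exp (- T / 2)) p_infty 0.
Proof.
  apply (is_lim_ext (fun T => / exp (T / 2))).
  - intros T. rewrite <- exp_Ropp. f_equal. field.
  - apply (is_lim_exp_half (fun x => / x)).
    apply (is_lim_inv (fun x => x) p_infty p_infty); [apply is_lim_id | discriminate].
Qed.

Lemma is_lim_phi_edges (b q : R) : 1 / 2 <= b <= 3 / 2 -> 0 < q ->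
  is_lim (phi b q) p_infty 0 /\ is_lim (fun T => phi b q (- T)) p_infty 0.
Proof.
  intros Hb Hq. set (C := 1 + 2 / q ^ 2).
  assert (HC : is_lim (fun T => C * exp (- T / 2)) p_infty 0).
  { replace (Finite 0) with (Rbar_mult C 0) by (simpl; f_equal; ring).
    apply is_lim_scal_l, is_lim_exp_mhalf. }
  split; (apply (is_lim_le_le_loc (fun _ => 0) (fun T => C * exp (- T / 2))); [ | apply is_lim_const | exact HC]);
    exists 0; intros T HT; (split; [left; apply phi_pos | ]).
  - eapply Rle_trans; [apply (phi_dominated b q q); lra | ]. rewrite Rabs_right by lra. apply Rle_refl.
  - eapply Rle_trans; [apply (phi_dominated b q q); lra | ]. rewrite Rabs_Ropp, Rabs_right by lra. apply Rle_refl.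
Qed.

Lemma is_lim_erf_scaled (c : R) : 0 < c ->
  is_lim (fun T => erf (c * exp (T / 2))) p_infty 1.
Proof.
  intros Hc. apply (is_lim_exp_half (fun x => erf (c * x))).
  apply (is_lim_comp erf (fun x => c * x) p_infty 1 p_infty); [apply is_lim_erf | | ].
  - rewrite <- (Rbar_mult_pos_p_infty c Hc) at 2. apply is_lim_scal_l, is_lim_id.
  - exists 0. intros; discriminate.
Qed.

Lemma is_lim_erf_scaled_m (c : R) : 0 < c ->
  is_lim (fun T => erf (c * exp (- T / 2))) p_infty 0.
Proof.
  intros Hc. rewrite <- erf_0.
  apply (is_lim_comp_continuous (fun T => c * exp (- T / 2)) erf p_infty 0).
  - replace (Finite 0) with (Rbar_mult c 0) by (simpl; f_equal; ring).
    apply is_lim_scal_l, is_lim_exp_mhalf.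
  - apply (ex_derive_continuous erf). eexists. apply is_derive_erf.
Qed.

Definition phi_half_prim (q t : R) : R := sqrt PI / sqrt q * erf (sqrt q * exp (t / 2)).

Lemma is_derive_erf_exp_half (c t : R) :
  is_derive (fun t => erf (c * exp (t / 2))) t (c * exp (t / 2) / 2 * (2 / sqrt PI * exp (- (c * exp (t / 2)) ^ 2))).
Proof.
  apply (is_derive_comp erf (fun t => c * exp (t / 2))).
  - apply is_derive_erf.
  - auto_derive; [exact I | unfold Rdiv; field].
Qed.

Lemma is_derive_phi_half_prim (q t : R) : 0 < q -> is_derive (phi_half_prim q) t (phi (1 / 2) q t).
Proof.
  intros Hq. assert (Hs : 0 < sqrt q) by (apply sqrt_lt_R0, Hq). pose proof sqrt_PI_pos.
  replace (phi (1 / 2) q t) with (sqrt PI / sqrt q *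
    (sqrt q * exp (t / 2) / 2 * (2 / sqrt PI * exp (- (sqrt q * exp (t / 2)) ^ 2)))).
  - apply (is_derive_scal (fun t => erf (sqrt q * exp (t / 2)))), is_derive_erf_exp_half.
  - rewrite Rpow_mult_distr, exp_half_sqr, pow2_sqrt by lra.
    unfold phi. replace (1 / 2 * t - q * exp t) with (t / 2 + - (q * exp t)) by field.
    rewrite exp_plus. field. split; lra.
Qed.

Lemma RInt_phi_prim (b q : R) (G : R -> R) (T : R) :
  (forall t, is_derive G t (phi b q t)) -> RInt (phi b q) (- T) T = G T - G (- T).
Proof.
  intros HG. apply is_RInt_unique. apply (is_RInt_derive G (phi b q)).
  - intros t _. apply HG.
  - intros t _. apply continuous_phi.
Qed.

Lemma RInt_phi_half_lim (q : R) : 0 < q ->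
  is_lim (fun T => RInt (phi (1 / 2) q) (- T) T) p_infty (sqrt PI / sqrt q).
Proof.
  intros Hq. assert (Hs : 0 < sqrt q) by (apply sqrt_lt_R0, Hq).
  apply (is_lim_ext (fun T => phi_half_prim q T - phi_half_prim q (- T))).
  { intros T. symmetry. apply RInt_phi_prim. intros; now apply is_derive_phi_half_prim. }
  replace (sqrt PI / sqrt q) with (sqrt PI / sqrt q * 1 - sqrt PI / sqrt q * 0) by ring.
  apply (is_lim_minus' (phi_half_prim q) (fun T => phi_half_prim q (- T))).
  - apply (is_lim_scal_l (fun t => erf (sqrt q * exp (t / 2))) _ p_infty 1), is_lim_erf_scaled, Hs.
  - apply (is_lim_scal_l (fun t => erf (sqrt q * exp (- t / 2))) _ p_infty 0), is_lim_erf_scaled_m, Hs.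
Qed.

(** Integration by parts: the derivative of [phi (1 / 2) q] is half of itself minus $q$ times
    [phi (3 / 2) q]. *)
Definition phi_3half_prim (q t : R) : R := / q * (/ 2 * phi_half_prim q t - phi (1 / 2) q t).

Lemma is_derive_phi_3half_prim (q t : R) : 0 < q -> is_derive (phi_3half_prim q) t (phi (3 / 2) q t).
Proof.
  intros Hq.
  replace (phi (3 / 2) q t) with (/ q * (/ 2 * phi (1 / 2) q t - (1 / 2 - q * exp t) * phi (1 / 2) q t)).
  - apply (is_derive_scal (fun t => / 2 * phi_half_prim q t - phi (1 / 2) q t)).
    apply (is_derive_minus (fun t => / 2 * phi_half_prim q t)).
    + apply (is_derive_scal (phi_half_prim q)), is_derive_phi_half_prim, Hq.
    + unfold phi. auto_derive; [exact I | unfold Rminus; ring].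
  - unfold phi. replace (3 / 2 * t - q * exp t) with (t + (1 / 2 * t - q * exp t)) by field.
    rewrite (exp_plus t). field. lra.
Qed.

Lemma RInt_phi_3half_lim (q : R) : 0 < q ->
  is_lim (fun T => RInt (phi (3 / 2) q) (- T) T) p_infty (sqrt PI / (2 * q * sqrt q)).
Proof.
  intros Hq. assert (Hs : 0 < sqrt q) by (apply sqrt_lt_R0, Hq).
  apply (is_lim_ext (fun T => / q * (/ 2 * RInt (phi (1 / 2) q) (- T) T - (phi (1 / 2) q T - phi (1 / 2) q (- T))))).
  { intros T. rewrite (RInt_phi_prim (3 / 2) q (phi_3half_prim q)) by (intros; now apply is_derive_phi_3half_prim).
    rewrite (RInt_phi_prim (1 / 2) q (phi_half_prim q)) by (intros; now apply is_derive_phi_half_prim).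
    unfold phi_3half_prim. ring. }
  replace (Finite (sqrt PI / (2 * q * sqrt q))) with (Rbar_mult (/ q) (/ 2 * (sqrt PI / sqrt q) - (0 - 0)))
    by (simpl; f_equal; field; lra).
  apply is_lim_scal_l.
  destruct (is_lim_phi_edges (1 / 2) q ltac:(lra) Hq) as [H1 H2].
  apply (is_lim_minus' (fun T => / 2 * RInt (phi (1 / 2) q) (- T) T) (fun T => phi (1 / 2) q T - phi (1 / 2) q (- T))).
  - apply (is_lim_scal_l (fun T => RInt (phi (1 / 2) q) (- T) T) (/ 2) p_infty (sqrt PI / sqrt q)).
    apply RInt_phi_half_lim, Hq.
  - apply (is_lim_minus' (phi (1 / 2) q) (fun T => phi (1 / 2) q (- T))); assumption.
Qed.

Lemma RInt_phi_le_lim (b q J T : R) : 0 <= T ->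
  is_lim (fun T => RInt (phi b q) (- T) T) p_infty J -> RInt (phi b q) (- T) T <= J.
Proof.
  intros HT HJ.
  apply (is_lim_le_loc (fun _ => RInt (phi b q) (- T) T) (fun T => RInt (phi b q) (- T) T) p_infty
    (RInt (phi b q) (- T) T) J); [ | apply is_lim_const | exact HJ].
  exists T. intros U HU.
  assert (Hex : forall x y, ex_RInt (phi b q) x y) by (intros; apply ex_RInt_everywhere, continuous_phi).
  rewrite <- (RInt_Chasles_R (phi b q) (- U) (- T) U), <- (RInt_Chasles_R (phi b q) (- T) T U) by apply Hex.
  assert (0 <= RInt (phi b q) (- U) (- T)) by (apply RInt_ge_0; [lra | apply Hex | intros; left; apply phi_pos]).
  assert (0 <= RInt (phi b q) T U) by (apply RInt_ge_0; [lra | apply Hex | intros; left; apply phi_pos]).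
  lra.
Qed.

Lemma trapezoid_phi_half (q p h : R) (K : nat) : 0 < p <= q -> 0 < h ->
  Rabs (h * sum_Z (fun k => phi (1 / 2) q (IZR k * h)) (- Z.of_nat K) (Z.of_nat K) - sqrt PI / sqrt q)
  <= 2 * sqrt 2 / (strip_factor h - 1) * (sqrt PI / sqrt q) + cell_tail h (1 + 2 / p ^ 2) K.
Proof.
  intros Hp Hh. assert (Hs : 0 < sqrt q) by (apply sqrt_lt_R0; lra).
  assert (H2 : 0 < sqrt 2) by (apply sqrt_lt_R0; lra).
  pose proof (strip_factor_gt1 h Hh).
  replace (2 * sqrt 2 / (strip_factor h - 1) * (sqrt PI / sqrt q))
    with (2 * (sqrt PI / sqrt (q / 2)) / (strip_factor h - 1)).
  2: { rewrite sqrt_div_alt by lra. field. repeat split; lra. }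
  apply trapezoid_phi; [lra | exact Hp | exact Hh | apply RInt_phi_half_lim; lra | ].
  intros T HT. apply RInt_phi_le_lim; [exact HT | apply RInt_phi_half_lim; lra].
Qed.

Lemma trapezoid_phi_3half (q p h : R) (K : nat) : 0 < p <= q -> 0 < h ->
  Rabs (h * sum_Z (fun k => phi (3 / 2) q (IZR k * h)) (- Z.of_nat K) (Z.of_nat K) - sqrt PI / (2 * q * sqrt q))
  <= 4 * sqrt 2 / (strip_factor h - 1) * (sqrt PI / (2 * q * sqrt q)) + cell_tail h (1 + 2 / p ^ 2) K.
Proof.
  intros Hp Hh. assert (Hs : 0 < sqrt q) by (apply sqrt_lt_R0; lra).
  assert (H2 : 0 < sqrt 2) by (apply sqrt_lt_R0; lra).
  pose proof (strip_factor_gt1 h Hh).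
  replace (4 * sqrt 2 / (strip_factor h - 1) * (sqrt PI / (2 * q * sqrt q)))
    with (2 * (sqrt PI / (2 * (q / 2) * sqrt (q / 2))) / (strip_factor h - 1)).
  2: { rewrite sqrt_div_alt by lra. field. repeat split; lra. }
  apply trapezoid_phi; [lra | exact Hp | exact Hh | apply RInt_phi_3half_lim; lra | ].
  intros T HT. apply RInt_phi_le_lim; [exact HT | apply RInt_phi_3half_lim; lra].
Qed.

(* Writes the factor as a difference of a Gaussian and a positive mixture of Gaussians,
   so that [dens] is built from the functions [phi], to which Fejer means apply. *)
Lemma one_minus_dawsonA (z : R) :
  1 - dawsonA z = exp (- z ^ 2) - 2 * z ^ 2 * RInt (fun v => (1 - v) * exp (- (z ^ 2 * (1 - v ^ 2)))) 0 1.
Proof.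
  assert (Hc : forall x, continuous (fun v => exp (- (z ^ 2 * (1 - v ^ 2)))) x).
  { intros x. smooth. }
  assert (Hc2 : forall x, continuous (fun v => v * exp (- (z ^ 2 * (1 - v ^ 2)))) x).
  { intros x. smooth. }
  rewrite (RInt_ext_R _ (fun v => exp (- (z ^ 2 * (1 - v ^ 2))) - v * exp (- (z ^ 2 * (1 - v ^ 2))))) by (intros; ring).
  rewrite RInt_minus_R by now apply ex_RInt_everywhere.
  assert (H1 : dawson z = z * RInt (fun v => exp (- (z ^ 2 * (1 - v ^ 2)))) 0 1).
  { unfold dawson. replace (RInt (fun s => exp (s ^ 2)) 0 z) with (RInt (fun s => exp (s ^ 2)) (z * 0 + 0) (z * 1 + 0)) by (f_equal; ring).
    rewrite <- RInt_comp_lin_R by apply ex_RInt_everywhere, continuous_exp_sqr.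
    rewrite <- !RInt_scal_R.
    - apply RInt_ext_R. intros v.
      replace (- (z ^ 2 * (1 - v ^ 2))) with (- z ^ 2 + (z * v + 0) ^ 2) by ring. rewrite exp_plus. ring.
    - now apply ex_RInt_everywhere.
    - apply ex_RInt_everywhere. intros v. smooth. }
  (* With the weight $v$ the integrand is an exact derivative. Subtracting it replaces the weight 1
     in the formula for [A] by $1 - v$ and leaves the Gaussian $e^{-z^2}$ behind. *)
  assert (H2 : 2 * z ^ 2 * RInt (fun v => v * exp (- (z ^ 2 * (1 - v ^ 2)))) 0 1 = 1 - exp (- z ^ 2)).
  { rewrite <- RInt_scal_R by now apply ex_RInt_everywhere.
    apply is_RInt_unique.
    replace (1 - exp (- z ^ 2)) with (exp (- (z ^ 2 * (1 - 1 ^ 2))) - exp (- (z ^ 2 * (1 - 0 ^ 2)))).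
    - apply (is_RInt_derive (fun v => exp (- (z ^ 2 * (1 - v ^ 2))))
              (fun v => 2 * z ^ 2 * (v * exp (- (z ^ 2 * (1 - v ^ 2)))))).
      + intros v _. auto_derive; [exact I | simpl; unfold Rminus; ring].
      + intros v _. apply (continuous_mult (fun _ => 2 * z ^ 2) (fun v => v * exp (- (z ^ 2 * (1 - v ^ 2)))));
          [apply continuous_const | apply Hc2].
    - replace (- (z ^ 2 * (1 - 1 ^ 2))) with 0 by ring. replace (- (z ^ 2 * (1 - 0 ^ 2))) with (- z ^ 2) by ring.
      now rewrite exp_0. }
  unfold dawsonA. rewrite H1. nra.
Qed.

(* The integrand relative to [sqrt s / (s + a)], with [p = s / a]; its integral is [1]. *)
Definition dens (p x : R) : R :=
  (1 + p) / (sqrt PI * sqrt p) * exp (x / 2) * exp (- (p * exp x)) * (1 - dawsonA (exp (x / 2))).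

Lemma dens_mixture (p x : R) : dens p x =
  (1 + p) / (sqrt PI * sqrt p) *
    (phi (1 / 2) (p + 1) x - RInt (fun v => 2 * (1 - v) * phi (3 / 2) (p + 1 - v ^ 2) x) 0 1).
Proof.
  unfold dens. rewrite one_minus_dawsonA, exp_half_sqr.
  assert (E1 : phi (1 / 2) (p + 1) x = exp (x / 2) * exp (- (p * exp x)) * exp (- exp x)).
  { unfold phi. rewrite <- !exp_plus. f_equal. field. }
  assert (E2 : RInt (fun v => 2 * (1 - v) * phi (3 / 2) (p + 1 - v ^ 2) x) 0 1 =
    exp (x / 2) * exp (- (p * exp x)) * (2 * exp x * RInt (fun v => (1 - v) * exp (- (exp x * (1 - v ^ 2)))) 0 1)).
  { rewrite <- !RInt_scal_R.
    - apply RInt_ext_R. intros v. unfold phi.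
      replace (3 / 2 * x - (p + 1 - v ^ 2) * exp x)
        with (x / 2 + (- (p * exp x) + (x + - (exp x * (1 - v ^ 2))))) by field.
      rewrite !exp_plus. ring.
    - apply ex_RInt_everywhere. intros v.
      smooth.
    - apply ex_RInt_everywhere. intros v.
      smooth. }
  rewrite E1, E2. ring.
Qed.

(** After normalisation the two parts of the mixture have masses $m_1 = \sqrt{1 + 1/p}$ and $m_3 =
    m_1 - 1$. Their errors $2\sqrt 2\, m_1$ and $4\sqrt 2\, m_3$, over $X - 1$, add up to this. *)
Definition trapezoid_error (p h : R) : R :=
  2 * sqrt 2 * (3 * sqrt (1 + / p) - 2) / (strip_factor h - 1).

Lemma RInt_mixture_weight (p : R) : 0 < p ->
  is_RInt (fun v => 2 * (1 - v) * (sqrt PI / (2 * (p + 1 - v ^ 2) * sqrt (p + 1 - v ^ 2)))) 0 1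
    (sqrt PI * (/ sqrt (p + 1) - sqrt p / (p + 1))).
Proof.
  intros Hp.
  set (G := fun v => sqrt PI * (v / ((p + 1) * sqrt (p + 1 - v ^ 2)) - / sqrt (p + 1 - v ^ 2))).
  assert (Hs : 0 < sqrt p) by (apply sqrt_lt_R0, Hp).
  assert (Hs1 : 0 < sqrt (p + 1)) by (apply sqrt_lt_R0; lra).
  replace (sqrt PI * (/ sqrt (p + 1) - sqrt p / (p + 1))) with (G 1 - G 0).
  - apply (is_RInt_derive G).
    + intros v Hv. rewrite Rmin_left, Rmax_right in Hv by lra.
      assert (HR : 0 < p + 1 - v ^ 2) by nra.
      assert (Hq : 0 < sqrt (p + 1 - v ^ 2)) by (apply sqrt_lt_R0, HR).
      assert (Hqq : sqrt (p + 1 - v ^ 2) ^ 2 = p + 1 - v ^ 2) by (apply pow2_sqrt; lra).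
      unfold G. auto_derive.
      * replace (p + 1 + - (v * (v * 1))) with (p + 1 - v ^ 2) by ring.
        repeat split; try lra. apply Rgt_not_eq, Rmult_lt_0_compat; lra.
      * replace (p + 1 + - (v * (v * 1))) with (p + 1 - v ^ 2) by ring.
        set (q := sqrt (p + 1 - v ^ 2)) in *. clearbody q.
        assert (Hv2 : p = q ^ 2 + v ^ 2 - 1) by lra. clear - Hq Hv2 HR. subst p.
        field. repeat split; nra.
    + intros v Hv. rewrite Rmin_left, Rmax_right in Hv by lra.
      assert (HR : 0 < p + 1 - v ^ 2) by nra.
      assert (Hq : 0 < sqrt (p + 1 - v ^ 2)) by (apply sqrt_lt_R0, HR).
      apply (ex_derive_continuous (fun v => 2 * (1 - v) * (sqrt PI / (2 * (p + 1 - v ^ 2) * sqrt (p + 1 - v ^ 2))))).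
      auto_derive.
      replace (p + 1 + - (v * (v * 1))) with (p + 1 - v ^ 2) by ring.
      repeat split; try lra. apply Rgt_not_eq. pos.
  - unfold G. replace (p + 1 - 1 ^ 2) with p by ring. replace (p + 1 - 0 ^ 2) with (p + 1) by ring.
    assert (Hpp : p = sqrt p ^ 2) by (symmetry; apply pow2_sqrt; lra).
    set (q := sqrt (p + 1)) in *. clearbody q. set (r := sqrt p) in *. clearbody r.
    clear - Hpp Hs Hs1. subst p. field. repeat split; nra.
Qed.

Lemma ex_derive_phi_param (b p x v : R) : ex_derive (fun v => 2 * (1 - v) * phi b (p + 1 - v ^ 2) x) v.
Proof. unfold phi. now auto_derive. Qed.

Lemma RInt_sum_Z (f : Z -> R -> R) (lo hi : Z) (a b : R) : (forall k x, continuous (f k) x) ->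
  RInt (fun v => sum_Z (fun k => f k v) lo hi) a b = sum_Z (fun k => RInt (f k) a b) lo hi /\
  (forall x, continuous (fun v => sum_Z (fun k => f k v) lo hi) x).
Proof.
  intros Hf.
  assert (He : forall hi, (hi < lo)%Z ->
    RInt (fun v => sum_Z (fun k => f k v) lo hi) a b = sum_Z (fun k => RInt (f k) a b) lo hi /\
    (forall x, continuous (fun v => sum_Z (fun k => f k v) lo hi) x)).
  { intros m Hm. split.
    - rewrite (RInt_ext_R _ (fun _ => 0)) by (intros; now rewrite sum_Z_empty by exact Hm).
      rewrite RInt_const, sum_Z_empty by exact Hm. unfold scal; simpl; unfold mult; simpl. eqR. ring.
    - intros x. apply (continuous_ext (fun _ => 0)); [intros; now rewrite sum_Z_empty by exact Hm | apply continuous_const]. }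
  destruct (Z_le_dec lo (hi + 1)) as [Hl | Hl]; [ | apply He; lia].
  revert hi Hl. apply Z_interval_ind; [apply He; lia | ].
  intros m Hm [IH1 IH2]. split.
  - rewrite (RInt_ext_R _ (fun v => sum_Z (fun k => f k v) lo m + f (m + 1)%Z v))
      by (intros; now rewrite sum_Z_last by exact Hm).
    rewrite RInt_plus_R by now apply ex_RInt_everywhere.
    now rewrite IH1, sum_Z_last by exact Hm.
  - intros x. apply (continuous_ext (fun v => sum_Z (fun k => f k v) lo m + f (m + 1)%Z v));
      [intros; now rewrite sum_Z_last by exact Hm | ].
    apply (continuous_plus (fun v => sum_Z (fun k => f k v) lo m)); [apply IH2 | apply Hf].
Qed.

Lemma trapezoid_dens (p h : R) : 0 < p -> 0 < h ->
  exists t : nat -> R, is_lim_seq t 0 /\ forall K,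
    Rabs (h * sum_Z (fun k => dens p (IZR k * h)) (- Z.of_nat K) (Z.of_nat K) - 1)
    <= trapezoid_error p h + t K.
Proof.
  intros Hp Hh.
  assert (Hs : 0 < sqrt p) by (apply sqrt_lt_R0, Hp).
  assert (Hs1 : 0 < sqrt (p + 1)) by (apply sqrt_lt_R0; lra).
  pose proof sqrt_PI_pos as Hpi.
  set (c := (1 + p) / (sqrt PI * sqrt p)).
  assert (Hc : 0 < c) by pos.
  set (tl := cell_tail h (1 + 2 / p ^ 2)).
  exists (fun K => 2 * c * tl K). split.
  { replace (Finite 0) with (Rbar_mult (2 * c) 0) by (simpl; f_equal; ring).
    apply is_lim_seq_scal_l, is_lim_seq_cell_tail, Hh. }
  intros K.
  set (lo := (- Z.of_nat K)%Z). set (hi := Z.of_nat K).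
  set (X := strip_factor h - 1). assert (HX : 0 < X) by (pose proof (strip_factor_gt1 h Hh); unfold X; lra).
  set (f := fun (k : Z) v => 2 * (1 - v) * phi (3 / 2) (p + 1 - v ^ 2) (IZR k * h)).
  assert (Hf : forall k x, continuous (f k) x).
  { intros k x. apply (ex_derive_continuous (f k)), ex_derive_phi_param. }
  destruct (RInt_sum_Z f lo hi 0 1 Hf) as [HI HIc].
  set (S1 := sum_Z (fun k => phi (1 / 2) (p + 1) (IZR k * h)) lo hi).
  set (S3 := RInt (fun v => sum_Z (fun k => f k v) lo hi) 0 1).
  assert (HS : h * sum_Z (fun k => dens p (IZR k * h)) lo hi = c * (h * S1 - h * S3)).
  { rewrite (sum_Z_ext _ (fun k => c * (phi (1 / 2) (p + 1) (IZR k * h) + -1 * RInt (f k) 0 1))).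
    2: { intros k _. rewrite dens_mixture. fold c (f k). unfold f. ring. }
    rewrite sum_Z_scal, sum_Z_plus, sum_Z_scal, <- HI. fold S1 S3. ring. }
  rewrite HS.
  set (J1 := sqrt PI / sqrt (p + 1)).
  set (J3 := sqrt PI * (/ sqrt (p + 1) - sqrt p / (p + 1))).
  assert (H1 : Rabs (h * S1 - J1) <= 2 * sqrt 2 / X * J1 + tl K).
  { apply trapezoid_phi_half; [lra | exact Hh]. }
  pose proof (RInt_mixture_weight p Hp) as HW.
  set (wt := fun v => 2 * (1 - v) * (sqrt PI / (2 * (p + 1 - v ^ 2) * sqrt (p + 1 - v ^ 2)))) in *.
  assert (Hwex : ex_RInt wt 0 1) by (eexists; exact HW).
  assert (HWe : RInt wt 0 1 = J3) by (apply is_RInt_unique; exact HW). clear HW. rename HWe into HW.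
  assert (Hcf : forall x, continuous (fun v => h * sum_Z (fun k => f k v) lo hi) x).
  { intros x. apply (continuous_mult (fun _ => h) (fun v => sum_Z (fun k => f k v) lo hi)); [apply continuous_const | apply HIc]. }
  assert (Hcl : forall cc x, continuous (fun v => 2 * (1 - v) * cc) x).
  { intros cc x. smooth. }
  assert (Htl1 : RInt (fun v => 2 * (1 - v) * tl K) 0 1 = tl K).
  { apply is_RInt_unique.
    assert (HH : is_RInt (fun v => 2 * (1 - v) * tl K) 0 1 ((2 * 1 - 1 ^ 2) * tl K - (2 * 0 - 0 ^ 2) * tl K)).
    { apply (is_RInt_derive (fun v => (2 * v - v ^ 2) * tl K) (fun v => 2 * (1 - v) * tl K)).
      - intros v _. auto_derive; [exact I | ring].
      - intros v _. apply Hcl. }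
    replace ((2 * 1 - 1 ^ 2) * tl K - (2 * 0 - 0 ^ 2) * tl K) with (tl K) in HH by ring. exact HH. }
  assert (H3 : Rabs (h * S3 - J3) <= 4 * sqrt 2 / X * J3 + tl K).
  { set (e := fun v => 4 * sqrt 2 / X * wt v + 2 * (1 - v) * tl K).
    assert (Hpt : forall v, 0 < v < 1 -> Rabs (h * sum_Z (fun k => f k v) lo hi - wt v) <= e v).
    { intros v Hv. unfold e, wt, f. rewrite sum_Z_scal.
      assert (Hq : 0 < p <= p + 1 - v ^ 2) by nra.
      pose proof (trapezoid_phi_3half (p + 1 - v ^ 2) p h K Hq Hh) as HT. fold lo hi X (tl K) in HT.
      set (S := sum_Z (fun k => phi (3 / 2) (p + 1 - v ^ 2) (IZR k * h)) lo hi) in *.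
      set (J := sqrt PI / (2 * (p + 1 - v ^ 2) * sqrt (p + 1 - v ^ 2))) in *.
      replace (h * (2 * (1 - v) * S) - 2 * (1 - v) * J) with (2 * (1 - v) * (h * S - J)) by ring.
      replace (4 * sqrt 2 / X * (2 * (1 - v) * J) + 2 * (1 - v) * tl K)
        with (2 * (1 - v) * (4 * sqrt 2 / X * J + tl K)) by ring.
      rewrite Rabs_mult, (Rabs_right (2 * (1 - v))) by lra.
      apply Rmult_le_compat_l; [lra | exact HT]. }
    assert (Hex1 : ex_RInt (fun v => h * sum_Z (fun k => f k v) lo hi) 0 1) by now apply ex_RInt_everywhere.
    assert (Hex2 : ex_RInt (fun v => 4 * sqrt 2 / X * wt v) 0 1) by (apply (ex_RInt_scal wt), Hwex).
    assert (Hex3 : ex_RInt (fun v => 2 * (1 - v) * tl K) 0 1) by (apply ex_RInt_everywhere, Hcl).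
    assert (Hexe : ex_RInt e 0 1) by (apply (ex_RInt_plus (fun v => 4 * sqrt 2 / X * wt v)); assumption).
    assert (HE : RInt e 0 1 = 4 * sqrt 2 / X * J3 + tl K).
    { unfold e. rewrite RInt_plus_R, RInt_scal_R, HW, Htl1 by assumption. reflexivity. }
    assert (HD : h * S3 - J3 = RInt (fun v => h * sum_Z (fun k => f k v) lo hi - wt v) 0 1).
    { rewrite RInt_minus_R, RInt_scal_R, HW by (assumption || now apply ex_RInt_everywhere). reflexivity. }
    assert (Hexd : ex_RInt (fun v => h * sum_Z (fun k => f k v) lo hi - wt v) 0 1).
    { apply (ex_RInt_minus (fun v => h * sum_Z (fun k => f k v) lo hi) wt); assumption. }
    rewrite HD, <- HE. apply Rabs_le. split.
    - replace (- RInt e 0 1) with (RInt (fun v => -1 * e v) 0 1) by (rewrite RInt_scal_R by assumption; eqR; ring).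
      apply RInt_le; [lra | apply (ex_RInt_scal e), Hexe | exact Hexd | ].
      intros v Hv. specialize (Hpt v Hv). apply Rabs_le_between in Hpt. lra.
    - apply RInt_le; [lra | exact Hexd | exact Hexe | ].
      intros v Hv. specialize (Hpt v Hv). apply Rabs_le_between in Hpt. lra. }
  assert (Hone : c * (J1 - J3) = 1).
  { unfold c, J1, J3. field. repeat split; lra. }
  assert (Hsq : sqrt (1 + / p) = sqrt (p + 1) / sqrt p).
  { rewrite <- sqrt_div_alt by lra. f_equal. field. lra. }
  assert (Hc1 : c * J1 = sqrt (1 + / p)).
  { rewrite Hsq. unfold c, J1. 
    replace (1 + p) with (sqrt (p + 1) ^ 2) by (rewrite pow2_sqrt; lra).
    field. repeat split; lra. }
  replace (c * (h * S1 - h * S3) - 1) with (c * ((h * S1 - J1) - (h * S3 - J3))) by (rewrite <- Hone; ring).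
  rewrite Rabs_mult, (Rabs_right c) by lra.
  apply Rle_trans with (c * ((2 * sqrt 2 / X * J1 + tl K) + (4 * sqrt 2 / X * J3 + tl K))).
  - apply Rmult_le_compat_l; [lra | ]. unfold Rminus at 1.
    eapply Rle_trans; [apply Rabs_triang | ]. rewrite Rabs_Ropp. lra.
  - right. unfold trapezoid_error. fold X. rewrite <- Hc1.
    replace (c * (2 * sqrt 2 / X * J1 + tl K + (4 * sqrt 2 / X * J3 + tl K))) with
      (2 * sqrt 2 * (3 * (c * J1) - 2 * (c * (J1 - J3))) / X + 2 * c * tl K) by (field; lra).
    rewrite Hone. field. lra.
Qed.

(** * Monotonicity and decay of the density *)

Lemma sum_Z_telescope (G : Z -> R) (lo hi : Z) : (lo <= hi + 1)%Z ->
  sum_Z (fun k => G (k + 1)%Z - G k) lo hi = G (hi + 1)%Z - G lo.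
Proof.
  revert hi. apply Z_interval_ind.
  - rewrite sum_Z_empty by lia. replace (lo - 1 + 1)%Z with lo by lia. ring.
  - intros m Hm IH. rewrite sum_Z_last, IH by exact Hm. ring.
Qed.

Lemma exp_cubic_le (y : R) : 0 <= y -> 1 + y + y ^ 2 / 2 + y ^ 3 / 6 <= exp y.
Proof.
  intros Hy.
  enough (0 <= exp y - (1 + y + y ^ 2 / 2 + y ^ 3 / 6)) by lra.
  replace 0 with (exp 0 - (1 + 0 + 0 ^ 2 / 2 + 0 ^ 3 / 6)) by (rewrite exp_0; field).
  apply (derive_nonneg_le (fun y => exp y - (1 + y + y ^ 2 / 2 + y ^ 3 / 6))
           (fun y => exp y - (1 + y + y ^ 2 / 2))); [exact Hy | | ].
  - intros x _. auto_derive; [exact I | field].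
  - intros x Hx. generalize (exp_quad_le x ltac:(lra)). lra.
Qed.

Notation dens_sum p h := (sum_Z (fun k => h * dens p (IZR k * h))).

Definition base (p x : R) : R :=
  (1 + p) / (sqrt PI * sqrt p) * exp (x / 2) * exp (- (p * exp x)).

Definition dA (x : R) : R := dawsonA (exp (x / 2)).

Lemma dens_base (p x : R) : dens p x = base p x * (1 - dA x).
Proof. reflexivity. Qed.

Lemma base_pos (p x : R) : 0 < p -> 0 < base p x.
Proof.
  intros Hp. unfold base. pose proof sqrt_PI_pos. pose proof (sqrt_lt_R0 p Hp).
  repeat apply Rmult_lt_0_compat; try apply exp_pos; try lra.
  apply Rinv_0_lt_compat, Rmult_lt_0_compat; lra.
Qed.

Lemma dA_pos (x : R) : 0 < dA x.
Proof. apply dawsonA_pos, exp_pos. Qed.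

Lemma dA_lower (x : R) : 2 * exp x / (1 + 2 * exp x) <= dA x.
Proof. rewrite <- (exp_half_sqr x). apply dawsonA_lower. pos. Qed.

Lemma dA_le (x : R) : dA x <= 2 * exp x.
Proof. rewrite <- (exp_half_sqr x). apply dawsonA_le_sqr. pos. Qed.

Lemma exp_half_mono (x y : R) : x <= y -> exp (x / 2) <= exp (y / 2).
Proof. intros H. apply exp_le_mono. lra. Qed.

Lemma dA_lt1_mono (x y : R) : x <= y -> dA y < 1 -> dA x < 1.
Proof. intros H. apply dawsonA_lt1_mono; [apply exp_pos | now apply exp_half_mono]. Qed.

Lemma dA_mono (x y : R) : x <= y -> dA y < 1 -> dA x <= dA y.
Proof. intros H. apply dawsonA_mono; [apply exp_pos | now apply exp_half_mono]. Qed.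

Lemma is_derive_dA (x : R) : is_derive dA x (dA x / 2 + exp x * (1 - dA x)).
Proof.
  unfold dA at 1.
  replace (dA x / 2 + exp x * (1 - dA x)) with
    (exp (x / 2) / 2 * (2 * dawson (exp (x / 2)) + 2 * exp (x / 2) * (1 - dawsonA (exp (x / 2))))).
  - apply (is_derive_comp dawsonA (fun x => exp (x / 2))).
    + apply is_derive_dawsonA.
    + auto_derive; [exact I | unfold Rdiv; ring].
  - unfold dA. rewrite <- (exp_half_sqr x). unfold dawsonA. field.
Qed.

(* The logarithmic derivative of [dens], multiplied by [2 (1 - A)]. *)
Definition slope (p x : R) : R := (1 - 2 * (p + 1) * exp x) * (1 - dA x) - dA x.

Lemma is_derive_dens (p x : R) : is_derive (dens p) x (base p x * (slope p x / 2)).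
Proof.
  apply (is_derive_ext (fun x => base p x * (1 - dA x))); [reflexivity | ].
  replace (base p x * (slope p x / 2)) with
    (((1 / 2 - p * exp x) * base p x) * (1 - dA x) + base p x * (0 - (dA x / 2 + exp x * (1 - dA x))))
    by (unfold slope; field).
  apply (is_derive_mult_R (base p) (fun x => 1 - dA x)).
  - unfold base. auto_derive; [exact I | ]. unfold Rdiv. ring.
  - apply (is_derive_minus (fun _ => 1) dA); [apply (is_derive_const 1) | apply is_derive_dA].
Qed.

(* An antiderivative of [dens]; [f_trunc] in the variable [p = s / a]. *)
Definition cum (p x : R) : R :=
  2 / (sqrt PI * sqrt p) * exp (- (p * exp x)) * dawson (exp (x / 2)) + erf (sqrt p * exp (x / 2)).

Lemma sqrt_mul_exp_half_sqr (p x : R) : 0 < p -> (sqrt p * exp (x / 2)) ^ 2 = p * exp x.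
Proof. intros Hp. rewrite Rpow_mult_distr, exp_half_sqr, pow2_sqrt; lra. Qed.

Lemma is_derive_cum (p x : R) : 0 < p -> is_derive (cum p) x (dens p x).
Proof.
  intros Hp. pose proof sqrt_PI_pos as Hpi. pose proof (sqrt_lt_R0 p Hp) as Hs.
  set (k := 2 / (sqrt PI * sqrt p)).
  assert (Hk : (1 + p) / (sqrt PI * sqrt p) = k * (1 + p) / 2) by (unfold k; field; lra).
  assert (Hk2 : sqrt p * (/ sqrt PI) = k * p / 2).
  { unfold k. assert (Hpp : p = sqrt p ^ 2) by (symmetry; apply pow2_sqrt; lra).
    set (r := sqrt p) in *. clearbody r. rewrite Hpp. field. lra. }
  replace (dens p x) with
    (((- k * p * exp x * exp (- (p * exp x))) * dawson (exp (x / 2)) +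
      (k * exp (- (p * exp x))) * (exp (x / 2) / 2 * (1 - 2 * exp (x / 2) * dawson (exp (x / 2))))) +
     (sqrt p * exp (x / 2) / 2 * (2 / sqrt PI * exp (- (sqrt p * exp (x / 2)) ^ 2)))).
  - apply (is_derive_plus (fun x => k * exp (- (p * exp x)) * dawson (exp (x / 2)))).
    + apply (is_derive_mult_R (fun x => k * exp (- (p * exp x))) (fun x => dawson (exp (x / 2)))).
      * auto_derive; [exact I | ring].
      * apply (is_derive_comp dawson (fun x => exp (x / 2))); [apply is_derive_dawson | ].
        auto_derive; [exact I | unfold Rdiv; ring].
    + apply is_derive_erf_exp_half.
  - rewrite sqrt_mul_exp_half_sqr by exact Hp. unfold dens, dawsonA. rewrite Hk, <- (exp_half_sqr x).
    replace (sqrt p * exp (x / 2) / 2 * (2 / sqrt PI * exp (- (p * exp (x / 2) ^ 2))))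
      with (sqrt p * / sqrt PI * exp (x / 2) * exp (- (p * exp (x / 2) ^ 2))) by (field; lra).
    rewrite Hk2. field.
Qed.

(** In the variable $v = \sqrt p\, e^{x/2}$ the right cutoff simply means $v \ge E$, and the
    increments of [cum] become statements on the Mills ratio. *)
Lemma cum_dA (p x : R) : 0 < p -> let v := sqrt p * exp (x / 2) in
  cum p x = dA x * exp (- v ^ 2) / (sqrt PI * v) + erf v.
Proof.
  intros Hp v. pose proof sqrt_PI_pos as Hpi. pose proof (sqrt_lt_R0 p Hp) as Hs.
  unfold cum, v. rewrite sqrt_mul_exp_half_sqr by exact Hp. unfold dA, dawsonA.
  pose proof (exp_pos (x / 2)). field. repeat split; lra.
Qed.

(** While $A < 1$, both factors of the product in [slope] decrease in $x$ and the subtracted [A]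
    increases; the first factor is nonnegative because the slope is. So the region of increase
    extends to the left without end. *)
Lemma slope_ge0_mono (p x y : R) : 0 < p -> y <= x -> dA x < 1 -> 0 <= slope p x -> 0 <= slope p y.
Proof.
  intros Hp Hyx HA Hs. unfold slope in *.
  pose proof (dA_mono y x Hyx HA) as HA2. pose proof (dA_pos x) as Hx. pose proof (dA_pos y) as Hy.
  assert (He : exp y <= exp x) by now apply exp_le_mono.
  assert (H1 : 0 <= 1 - 2 * (p + 1) * exp x) by nra.
  assert (H2 : 1 - 2 * (p + 1) * exp x <= 1 - 2 * (p + 1) * exp y) by nra.
  assert ((1 - 2 * (p + 1) * exp x) * (1 - dA x) <= (1 - 2 * (p + 1) * exp y) * (1 - dA y)).
  { apply Rmult_le_compat; lra. }
  lra.
Qed.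

Lemma dens_increasing (p x y z : R) : 0 < p -> y <= z <= x -> dA x < 1 -> 0 <= slope p x -> dens p y <= dens p z.
Proof.
  intros Hp Hyz HA Hs.
  apply (derive_nonneg_le (dens p) (fun x => base p x * (slope p x / 2))); [lra | | ].
  - intros; apply is_derive_dens.
  - intros t Ht. pose proof (base_pos p t Hp).
    pose proof (slope_ge0_mono p x t Hp ltac:(lra) HA Hs). pos.
Qed.

Lemma cum_cell (p y h x : R) : 0 < p -> 0 <= h -> y + h <= x -> dA x < 1 -> 0 <= slope p x ->
  h * dens p y <= cum p (y + h) - cum p y <= h * dens p (y + h).
Proof.
  intros Hp Hh Hx HA Hs. split.
  - enough (cum p y - y * dens p y <= cum p (y + h) - (y + h) * dens p y) by lra.
    apply (derive_nonneg_le (fun t => cum p t - t * dens p y) (fun t => dens p t - dens p y)); [lra | | ].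
    + intros t _. apply (is_derive_minus (cum p) (fun t => t * dens p y)); [apply is_derive_cum, Hp | ].
      auto_derive; [exact I | ring].
    + intros t Ht. pose proof (dens_increasing p x y t Hp ltac:(lra) HA Hs). lra.
  - enough (y * dens p (y + h) - cum p y <= (y + h) * dens p (y + h) - cum p (y + h)) by lra.
    apply (derive_nonneg_le (fun t => t * dens p (y + h) - cum p t) (fun t => dens p (y + h) - dens p t)); [lra | | ].
    + intros t _. apply (is_derive_minus (fun t => t * dens p (y + h)) (cum p)); [ | apply is_derive_cum, Hp].
      auto_derive; [exact I | ring].
    + intros t Ht. pose proof (dens_increasing p x t (y + h) Hp ltac:(lra) HA Hs). lra.
Qed.

(** Each node is the right end of its cell, so the cells begin one step before [lo]. *)
Lemma sum_dens_increasing (p h : R) (lo hi : Z) : 0 < p -> 0 < h -> (lo <= hi + 1)%Z ->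
  dA (IZR hi * h) < 1 -> 0 <= slope p (IZR hi * h) ->
  cum p (IZR hi * h) - cum p ((IZR lo - 1) * h) <= dens_sum p h lo hi.
Proof.
  intros Hp Hh Hl HA Hs.
  replace (cum p (IZR hi * h) - cum p ((IZR lo - 1) * h)) with
    (sum_Z (fun k => cum p ((IZR (k + 1) - 1) * h) - cum p ((IZR k - 1) * h)) lo hi).
  - apply sum_Z_le. intros k Hk.
    replace ((IZR (k + 1) - 1) * h) with ((IZR k - 1) * h + h) by (rewrite plus_IZR; ring).
    replace (IZR k * h) with ((IZR k - 1) * h + h) by ring.
    assert (IZR k <= IZR hi) by (apply IZR_le; lia).
    apply (cum_cell p ((IZR k - 1) * h) h (IZR hi * h)); auto; nra.
  - rewrite (sum_Z_telescope (fun k => cum p ((IZR k - 1) * h))) by exact Hl.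
    do 2 f_equal. rewrite plus_IZR. ring.
Qed.

(** Here each node is the left end of its cell; the cells reach $(hi + 1) h$, and the density must
    increase up to that point. *)
Lemma sum_dens_left_tail (p h : R) (lo hi : Z) : 0 < p -> 0 < h -> (lo <= hi + 1)%Z ->
  dA ((IZR hi + 1) * h) < 1 -> 0 <= slope p ((IZR hi + 1) * h) ->
  0 <= dens_sum p h lo hi <= cum p ((IZR hi + 1) * h) - cum p (IZR lo * h).
Proof.
  intros Hp Hh Hl HA Hs. split.
  - apply sum_Z_ge0. intros k Hk. rewrite dens_base.
    assert (IZR k <= IZR hi) by (apply IZR_le; lia).
    assert (dA (IZR k * h) < 1) by (apply (dA_lt1_mono _ ((IZR hi + 1) * h)); [nra | exact HA]).
    pose proof (base_pos p (IZR k * h) Hp). apply Rmult_le_pos; [lra | ]. pos.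
  - replace (cum p ((IZR hi + 1) * h) - cum p (IZR lo * h)) with
      (sum_Z (fun k => cum p (IZR (k + 1) * h) - cum p (IZR k * h)) lo hi).
    + apply sum_Z_le. intros k Hk.
      replace (IZR (k + 1) * h) with (IZR k * h + h) by (rewrite plus_IZR; ring).
      assert (IZR k <= IZR hi) by (apply IZR_le; lia).
      apply (cum_cell p (IZR k * h) h ((IZR hi + 1) * h)); auto; nra.
    + rewrite (sum_Z_telescope (fun k => cum p (IZR k * h))) by exact Hl. now rewrite plus_IZR.
Qed.

Lemma cum_pos (p x : R) : 0 < p -> 0 < cum p x.
Proof.
  intros Hp. pose proof sqrt_PI_pos as Hpi. pose proof (sqrt_lt_R0 p Hp) as Hs. pose proof (exp_pos (x / 2)) as He.
  unfold cum. apply Rplus_lt_le_0_compat.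
  - apply Rmult_lt_0_compat; [ | apply dawson_pos, He].
    apply Rmult_lt_0_compat; [ | apply exp_pos].
    pos.
  - rewrite <- erf_0. apply erf_le. pos.
Qed.

(* The average over [0 <= t <= h] of [g h - g t], where [g t = m t + w (e^t - 1 - t)]. *)
Definition decay_gain (m w h : R) : R :=
  m * h / 2 + w * (exp h - 1 - h - (exp h - 1 - h - h ^ 2 / 2) / h).

(* If [log f] decreases at least as fast as [- g], the tangent-line bound
   [e^s >= e^d (1 + s - d)] makes the integral of [f] over a cell exceed [h f] at its
   right end by the factor [e^d], with [d] the average [decay_gain]. *)
Lemma riemann_decay_cell (f f' F : R -> R) (y h m w : R) : 0 < h ->
  (forall x, y <= x <= y + h -> is_derive f x (f' x)) ->
  (forall x, y <= x <= y + h -> is_derive F x (f x)) ->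
  (forall x, y <= x <= y + h -> f' x <= - (m + w * (exp (x - y) - 1)) * f x) ->
  0 <= f (y + h) ->
  exp (decay_gain m w h) * (h * f (y + h)) <= F (y + h) - F y.
Proof.
  intros Hh Hf HF Hd Hpos.
  set (e := fun x => m * (x - y) + w * (exp (x - y) - 1 - (x - y))).
  set (g := decay_gain m w h).
  assert (Hcmp : forall x, y <= x <= y + h -> f (y + h) * exp (e (y + h)) <= f x * exp (e x)).
  { intros x Hx.
    apply (derive_nonpos_le (fun x => f x * exp (e x))
      (fun x => f' x * exp (e x) + f x * ((m + w * (exp (x - y) - 1)) * exp (e x)))); [lra | | ].
    - intros t Ht. apply (is_derive_mult_R f (fun x => exp (e x))); [apply Hf; lra |].
      unfold e. auto_derive; [exact I | unfold Rminus; ring].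
    - intros t Ht. specialize (Hd t ltac:(lra)). pose proof (exp_pos (e t)). nra. }
  assert (Hlow : forall x, y <= x <= y + h -> f (y + h) * exp g * (1 + (e (y + h) - e x) - g) <= f x).
  { intros x Hx. specialize (Hcmp x Hx).
    apply Rle_trans with (f (y + h) * exp (e (y + h) - e x)).
    - rewrite Rmult_assoc. apply Rmult_le_compat_l; [exact Hpos | ].
      replace (e (y + h) - e x) with (g + (e (y + h) - e x - g)) at 2 by ring.
      rewrite exp_plus. apply Rmult_le_compat_l; [pos | ].
      pose proof (exp_ineq1_le (e (y + h) - e x - g)). lra.
    - unfold Rminus. rewrite exp_plus, exp_Ropp, <- Rmult_assoc.
      apply div_le_of_le_mul; [apply exp_pos | exact Hcmp]. }
  (* An antiderivative of the tangent-line bound $1 + (e(y+h) - e(x)) - g$. As $g$ is the mean of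
     $e(y+h) - e(x)$ over the cell, the increment of [P] is exactly $h$. *)
  set (P := fun x => (1 + e (y + h) - g) * (x - y) -
              (m * (x - y) ^ 2 / 2 + w * (exp (x - y) - 1 - (x - y) - (x - y) ^ 2 / 2))).
  assert (HP : P (y + h) - P y = h).
  { unfold P, e, g, decay_gain. replace (y + h - y) with h by ring. replace (y - y) with 0 by ring.
    rewrite exp_0. field. lra. }
  enough (F y - f (y + h) * exp g * P y <= F (y + h) - f (y + h) * exp g * P (y + h)).
  { replace (exp g * (h * f (y + h))) with (f (y + h) * exp g * (P (y + h) - P y)) by (rewrite HP; ring). lra. }
  apply (derive_nonneg_le (fun x => F x - f (y + h) * exp g * P x)
     (fun x => f x - f (y + h) * exp g * (1 + (e (y + h) - e x) - g))); [lra | | ].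
  - intros x Hx. apply (is_derive_minus F (fun x => f (y + h) * exp g * P x)); [apply HF, Hx | ].
    apply (is_derive_scal P). unfold P, e. auto_derive; [exact I | ].
    unfold Rminus, Rdiv. simpl. field.
  - intros x Hx. specialize (Hlow x Hx). lra.
Qed.

Lemma riemann_decay (f f' F : R -> R) (h m w : R) (lo hi : Z) : 0 < h -> 0 <= w -> (lo <= hi)%Z ->
  (forall x, IZR lo * h <= x <= IZR hi * h -> is_derive f x (f' x)) ->
  (forall x, IZR lo * h <= x <= IZR hi * h -> is_derive F x (f x)) ->
  (forall x, IZR lo * h <= x <= IZR hi * h -> f' x <= - (m + w * (exp (x - IZR lo * h) - 1)) * f x) ->
  (forall x, IZR lo * h <= x <= IZR hi * h -> 0 <= f x) ->
  exp (decay_gain m w h) * sum_Z (fun k => h * f (IZR k * h)) (lo + 1) hi <= F (IZR hi * h) - F (IZR lo * h).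
Proof.
  intros Hh Hw Hl Hf HF Hd Hpos. rewrite <- sum_Z_scal.
  replace (F (IZR hi * h) - F (IZR lo * h)) with
    (sum_Z (fun k => F (IZR (k + 1 - 1) * h) - F (IZR (k - 1) * h)) (lo + 1) hi).
  - apply sum_Z_le. intros k Hk.
    replace (IZR (k + 1 - 1) * h) with (IZR (k - 1) * h + h) by (rewrite !minus_IZR, plus_IZR; ring).
    replace (IZR k * h) with (IZR (k - 1) * h + h) by (rewrite !minus_IZR; ring).
    assert (H1 : IZR lo <= IZR (k - 1)) by (apply IZR_le; lia).
    assert (H2 : IZR (k - 1) + 1 <= IZR hi) by (rewrite <- plus_IZR; apply IZR_le; lia).
    assert (Hin : forall x, IZR (k - 1) * h <= x <= IZR (k - 1) * h + h -> IZR lo * h <= x <= IZR hi * h)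
      by (intros x Hx; split; nra).
    apply (riemann_decay_cell f f' F); auto.
    (* Since $w \ge 0$, the decay rate only grows with the distance from [lo]. Restarting it at the
       left end of the cell weakens it, and every cell has the same gain. *)
    + intros x Hx. eapply Rle_trans; [apply Hd, Hin, Hx | ].
      assert (exp (x - IZR (k - 1) * h) <= exp (x - IZR lo * h)) by (apply exp_le_mono; nra).
      pose proof (Hpos x (Hin x Hx)).
      assert (0 <= w * (exp (x - IZR lo * h) - exp (x - IZR (k - 1) * h))) by pos.
      nra.
    + apply Hpos, Hin. lra.
  - rewrite (sum_Z_telescope (fun k => F (IZR (k - 1) * h))) by lia.
    replace (hi + 1 - 1)%Z with hi by lia. replace (lo + 1 - 1)%Z with lo by lia. reflexivity.
Qed.

Lemma decay_gain_lower (m w h : R) : 0 < h -> 0 <= w ->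
  m * h / 2 + w * (h ^ 2 / 3 + h ^ 3 / 8) <= decay_gain m w h.
Proof.
  intros Hh Hw. unfold decay_gain. apply Rplus_le_compat_l, Rmult_le_compat_l; [exact Hw | ].
  replace (exp h - 1 - h - (exp h - 1 - h - h ^ 2 / 2) / h) with (((h - 1) * exp h + 1 - h ^ 2 / 2) / h) by (field; lra).
  apply le_div_of_mul_le; [exact Hh | ].
  enough (0 <= (h - 1) * exp h + 1 - h ^ 2 / 2 - h ^ 3 / 3 - h ^ 4 / 8) by lra.
  replace 0 with ((0 - 1) * exp 0 + 1 - 0 ^ 2 / 2 - 0 ^ 3 / 3 - 0 ^ 4 / 8) by (rewrite exp_0; field).
  apply (derive_nonneg_le (fun h => (h - 1) * exp h + 1 - h ^ 2 / 2 - h ^ 3 / 3 - h ^ 4 / 8)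
     (fun h => h * (exp h - (1 + h + h ^ 2 / 2)))); [lra | | ].
  - intros x _. auto_derive; [exact I | simpl; field].
  - intros x Hx. pose proof (exp_quad_le x ltac:(lra)). pos.
Qed.

(** * Above one: the discarded negative part *)

Lemma PI_bounds : 31415 / 10000 <= PI <= 31416 / 10000.
Proof.
  pose proof (PI_2_3_7_ineq 2) as [H1 H2].
  unfold tg_alt, PI_2_3_7_tg, Ratan_seq in H1, H2. simpl in H1, H2. lra.
Qed.

Lemma sqrt_PI_bounds : 17724 / 10000 <= sqrt PI <= 17725 / 10000.
Proof.
  pose proof PI_bounds as [H1 H2]. pose proof PI_RGT_0. pose proof sqrt_PI_pos.
  pose proof (pow2_sqrt PI ltac:(lra)) as Hs. split; nra.
Qed.

Lemma sqrt_2_bounds : 0 < sqrt 2 <= 141422 / 100000.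
Proof.
  pose proof (sqrt_lt_R0 2 ltac:(lra)). pose proof (pow2_sqrt 2 ltac:(lra)). split; nra.
Qed.

Lemma erfc_ge_taylor (x : R) : 0 <= x ->
  sqrt PI - 2 * (x - x ^ 3 / 3 + x ^ 5 / 10) <= sqrt PI * erfc x.
Proof.
  intros Hx. pose proof sqrt_PI_pos. destruct (gauss_taylor x Hx) as [_ H1].
  replace (sqrt PI * erfc x) with (sqrt PI - 2 * gauss x) by (unfold erfc; rewrite erf_gauss; field; lra).
  lra.
Qed.

Lemma erfc_anti (x y : R) : x <= y -> erfc y <= erfc x.
Proof. intros H. unfold erfc. pose proof (erf_le x y H). lra. Qed.

Lemma erfc_ge0 (x : R) : 0 <= erfc x.
Proof. unfold erfc. pose proof (erf_le_1 x). lra. Qed.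

(** As $\delta < 1$, this applies to $E$. The exact threshold is $0.4769\ldots$, and $47/100$ is the
    left end of all later ranges for $E$. *)
Lemma erfc_half_lower (x : R) : erfc x < 1 / 2 -> 47 / 100 <= x.
Proof.
  intros H. apply Rnot_lt_le. intros Hc.
  pose proof (erfc_anti x (47 / 100) ltac:(lra)) as H1.
  pose proof (erfc_ge_taylor (47 / 100) ltac:(lra)) as H2.
  pose proof sqrt_PI_bounds. nra.
Qed.

(* The Mills ratio [e^{-x^2} / (x erfc x)] decreases. *)
Lemma mills_mono (c x k : R) : 0 < c <= x -> 0 < k -> 1 <= k * (c * (exp (c ^ 2) * (sqrt PI * erfc c))) ->
  exp (- x ^ 2) / x <= k * (sqrt PI * erfc x).
Proof.
  intros Hc Hk H.
  assert (Hm : c * (exp (c ^ 2) * (sqrt PI * erfc c)) <= x * (exp (x ^ 2) * (sqrt PI * erfc x))).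
  { apply (derive_nonneg_le (fun x => x * (exp (x ^ 2) * (sqrt PI * erfc x)))
      (fun x => (1 + 2 * x ^ 2) * exp (x ^ 2) * (sqrt PI * erfc x) - 2 * x)); [lra | | ].
    - intros y _. pose proof sqrt_PI_pos.
      replace ((1 + 2 * y ^ 2) * exp (y ^ 2) * (sqrt PI * erfc y) - 2 * y) with
        (1 * (exp (y ^ 2) * (sqrt PI * erfc y)) +
         y * ((2 * y * exp (y ^ 2)) * (sqrt PI * erfc y) + exp (y ^ 2) * (sqrt PI * - (2 / sqrt PI * exp (- y ^ 2))))).
      + apply (is_derive_mult_R (fun x => x) (fun x => exp (x ^ 2) * (sqrt PI * erfc x))).
        * apply (is_derive_id (K := R_AbsRing)).
        * apply (is_derive_mult_R (fun x => exp (x ^ 2)) (fun x => sqrt PI * erfc x)).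
          -- auto_derive; [exact I | simpl; ring].
          -- apply (is_derive_scal erfc), is_derive_erfc.
      + rewrite exp_Ropp. pose proof (exp_pos (y ^ 2)). field. split; lra.
    - intros y Hy. pose proof (erfc_lower y ltac:(lra)) as He. rewrite exp_Ropp in He.
      pose proof (exp_pos (y ^ 2)) as Hp.
      apply (Rmult_le_compat_l ((1 + 2 * y ^ 2) * exp (y ^ 2))) in He; [ | apply Rmult_le_pos; nra].
      replace ((1 + 2 * y ^ 2) * exp (y ^ 2) * (2 * y * / exp (y ^ 2) / (1 + 2 * y ^ 2))) with (2 * y) in He
        by (field; split; nra). lra. }
  rewrite exp_Ropp. pose proof (exp_pos (x ^ 2)) as Hp.
  apply div_le_of_le_mul; [lra | ].
  apply Rmult_le_reg_r with (exp (x ^ 2)); [exact Hp | ].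
  rewrite Rinv_l by lra. nra.
Qed.

Lemma mills_47 (x : R) : 47 / 100 <= x -> exp (- x ^ 2) / x <= 1905 / 1000 * (sqrt PI * erfc x).
Proof.
  intros Hx. apply (mills_mono (47 / 100)); [lra | lra | ].
  pose proof (erfc_ge_taylor (47 / 100) ltac:(lra)) as H1. pose proof sqrt_PI_bounds.
  pose proof (exp_cubic_le ((47 / 100) ^ 2) ltac:(lra)) as H2.
  set (e := exp ((47 / 100) ^ 2)) in *. set (s := sqrt PI * erfc (47 / 100)) in *.
  assert (12470 / 10000 * (8970 / 10000) <= e * s) by (apply Rmult_le_compat; lra).
  lra.
Qed.

Lemma mills_7 (x : R) : 7 / 10 <= x -> exp (- x ^ 2) / x <= 155 / 100 * (sqrt PI * erfc x).
Proof.
  intros Hx. apply (mills_mono (7 / 10)); [lra | lra | ].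
  pose proof (erfc_ge_taylor (7 / 10) ltac:(lra)) as H1. pose proof sqrt_PI_bounds.
  pose proof (exp_cubic_le ((7 / 10) ^ 2) ltac:(lra)) as H2.
  set (e := exp ((7 / 10) ^ 2)) in *. set (s := sqrt PI * erfc (7 / 10)) in *.
  assert (16296 / 10000 * (5674 / 10000) <= e * s) by (apply Rmult_le_compat; lra).
  lra.
Qed.

(* A decreasing majorant of [- sqrt PI * dens], its antiderivative being explicit. *)
Definition neg_majorant (p x : R) : R :=
  (3 / 10 * (sqrt p * exp (x / 2)) + 9 / 10 / (sqrt p * exp (x / 2))) * exp (- (p * exp x)).

(** Minus an antiderivative of [neg_majorant], in $v = \sqrt p\, e^{x/2}$: with $dx = 2\,dv/v$ the
    term $3v/10$ gives the first summand and $9/(10v)$ the second. *)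
Definition neg_tail (v : R) : R :=
  3 / 10 * (sqrt PI * erfc v) + 9 / 5 * (exp (- v ^ 2) / v - sqrt PI * erfc v).

(** With $z = e^{x/2}$ the factor $(1+p) z (A-1)/\sqrt p$ splits into $\sqrt p\, z (A-1)$ and $z^2
    (A-1)/(\sqrt p\, z)$. The bounds $A \le 13/10$ and $z^2(A-1) \le 9/10$ serve one term each. *)
Lemma dens_ge_neg_majorant (p x : R) : 0 < p -> - (neg_majorant p x / sqrt PI) <= dens p x.
Proof.
  intros Hp. pose proof sqrt_PI_pos as Hpi. pose proof (sqrt_lt_R0 p Hp) as Hs. pose proof (exp_pos (x / 2)) as He.
  pose proof (pow2_sqrt p ltac:(lra)) as Hss.
  unfold dens, neg_majorant.
  pose proof (dawsonA_le_13_10 (exp (x / 2)) He) as H1. pose proof (dawsonA_excess (exp (x / 2)) He) as H2.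
  set (A := dawsonA (exp (x / 2))) in *. set (z := exp (x / 2)) in *. set (ex := exp (- (p * exp x))).
  assert (Hex : 0 < ex) by apply exp_pos.
  set (s := sqrt p) in *.
  enough (H : (1 + s ^ 2) / s * z * (A - 1) <= 3 / 10 * (s * z) + 9 / 10 / (s * z)).
  { assert (Hq : 0 <= (3 / 10 * (s * z) + 9 / 10 / (s * z) - (1 + s ^ 2) / s * z * (A - 1)) * (ex / sqrt PI)).
    { apply Rmult_le_pos; [lra | pos]. }
    rewrite <- Hss.
    replace ((1 + s ^ 2) / (sqrt PI * s) * z * ex * (1 - A)) with
      (- ((3 / 10 * (s * z) + 9 / 10 / (s * z)) * ex / sqrt PI) +
       (3 / 10 * (s * z) + 9 / 10 / (s * z) - (1 + s ^ 2) / s * z * (A - 1)) * (ex / sqrt PI)) by (field; lra).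
    lra. }
  replace ((1 + s ^ 2) / s * z * (A - 1)) with (s * z * (A - 1) + (z ^ 2 * (A - 1)) / (s * z)) by (field; lra).
  assert (Hsz : 0 < s * z) by pos.
  apply Rplus_le_compat; [nra | ].
  unfold Rdiv. apply Rmult_le_compat_r; [apply Rlt_le, Rinv_0_lt_compat, Hsz | lra].
Qed.

Lemma is_derive_neg_tail (v : R) : 0 < v ->
  is_derive neg_tail v (- (3 / 5 + 9 / 5 / v ^ 2) * exp (- v ^ 2)).
Proof.
  intros Hv. pose proof sqrt_PI_pos.
  replace (- (3 / 5 + 9 / 5 / v ^ 2) * exp (- v ^ 2)) with
    (3 / 10 * (sqrt PI * - (2 / sqrt PI * exp (- v ^ 2))) +
     9 / 5 * ((- 2 * exp (- v ^ 2) - exp (- v ^ 2) / v ^ 2) - sqrt PI * - (2 / sqrt PI * exp (- v ^ 2))))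
    by (field; split; lra).
  assert (Hd : is_derive (fun v => sqrt PI * erfc v) v (sqrt PI * - (2 / sqrt PI * exp (- v ^ 2))))
    by apply (is_derive_scal erfc), is_derive_erfc.
  apply (is_derive_plus (fun v => 3 / 10 * (sqrt PI * erfc v))
     (fun v => 9 / 5 * (exp (- v ^ 2) / v - sqrt PI * erfc v))).
  - apply (is_derive_scal (fun v => sqrt PI * erfc v)), Hd.
  - apply (is_derive_scal (fun v => exp (- v ^ 2) / v - sqrt PI * erfc v)).
    apply (is_derive_minus (fun v => exp (- v ^ 2) / v) (fun v => sqrt PI * erfc v)); [ | exact Hd].
    auto_derive; [simpl; lra | simpl; field; lra].
Qed.

Lemma neg_tail_anti (u v : R) : 0 < u <= v -> neg_tail v <= neg_tail u.
Proof.
  intros Hu.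
  apply (derive_nonpos_le neg_tail (fun v => - (3 / 5 + 9 / 5 / v ^ 2) * exp (- v ^ 2))); [lra | | ].
  - intros x Hx. apply is_derive_neg_tail. lra.
  - intros x Hx. assert (0 < 9 / 5 / x ^ 2) by pos.
    pose proof (exp_pos (- x ^ 2)). nra.
Qed.

Lemma neg_tail_ge0 (v : R) : 0 < v -> 0 <= neg_tail v.
Proof.
  intros Hv. unfold neg_tail. pose proof (erfc_upper v Hv). pose proof (erfc_ge0 v). pose proof sqrt_PI_pos.
  assert (0 <= sqrt PI * erfc v) by pos. lra.
Qed.

Lemma is_derive_neg_tail_x (p x : R) : 0 < p ->
  is_derive (fun x => - neg_tail (sqrt p * exp (x / 2))) x (neg_majorant p x).
Proof.
  intros Hp. pose proof (sqrt_lt_R0 p Hp) as Hs. pose proof (exp_pos (x / 2)) as He.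
  assert (Hv : 0 < sqrt p * exp (x / 2)) by pos.
  replace (neg_majorant p x) with
    (- (sqrt p * exp (x / 2) / 2 *
      (- (3 / 5 + 9 / 5 / (sqrt p * exp (x / 2)) ^ 2) * exp (- (sqrt p * exp (x / 2)) ^ 2)))).
  - apply (is_derive_opp (fun x => neg_tail (sqrt p * exp (x / 2)))).
    apply (is_derive_comp neg_tail (fun x => sqrt p * exp (x / 2))); [apply is_derive_neg_tail, Hv | ].
    auto_derive; [exact I | unfold Rdiv; ring].
  - unfold neg_majorant. rewrite <- (sqrt_mul_exp_half_sqr p x Hp).
    set (v := sqrt p * exp (x / 2)) in *. field. lra.
Qed.

Lemma dens_sum_lower (p h E : R) (N M : Z) : 0 < p -> 0 < h -> 47 / 100 <= E -> (N <= M)%Z ->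
  E <= sqrt p * exp (IZR N * h / 2) ->
  - (exp (- (325 / 1000 * h)) * (neg_tail E / sqrt PI)) <= dens_sum p h (N + 1) M.
Proof.
  intros Hp Hh HE HNM Hv0. pose proof sqrt_PI_pos as Hpi. pose proof (sqrt_lt_R0 p Hp) as Hs.
  set (f' := fun x => - (1 / 2) * exp (- (p * exp x)) *
    (3 / 2 * (sqrt p * exp (x / 2)) + 9 / 10 / (sqrt p * exp (x / 2)) + 3 / 5 * (sqrt p * exp (x / 2)) ^ 3)).
  (* $65/100$ is a lower bound for the logarithmic decay rate of [neg_majorant] where $v \ge
     47/100$, almost attained at the left end. *)
  pose proof (riemann_decay (neg_majorant p) f' (fun x => - neg_tail (sqrt p * exp (x / 2))) h (65 / 100) 0 N M
    Hh ltac:(lra) HNM) as HR.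
  assert (HvN : forall x, IZR N * h <= x -> 47 / 100 <= sqrt p * exp (x / 2)).
  { intros x Hx. eapply Rle_trans; [exact HE | ]. eapply Rle_trans; [exact Hv0 | ].
    apply Rmult_le_compat_l; [lra | apply exp_half_mono, Hx]. }
  assert (HR2 : exp (decay_gain (65 / 100) 0 h) * sum_Z (fun k => h * neg_majorant p (IZR k * h)) (N + 1) M
    <= neg_tail E).
  { eapply Rle_trans; [apply HR | ].
    - intros x Hx. specialize (HvN x ltac:(lra)).
      unfold neg_majorant, f'.
      replace (- (1 / 2) * exp (- (p * exp x)) *
        (3 / 2 * (sqrt p * exp (x / 2)) + 9 / 10 / (sqrt p * exp (x / 2)) + 3 / 5 * (sqrt p * exp (x / 2)) ^ 3))
      with ((3 / 20 * (sqrt p * exp (x / 2)) - 9 / 20 / (sqrt p * exp (x / 2))) * exp (- (p * exp x)) +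
        (3 / 10 * (sqrt p * exp (x / 2)) + 9 / 10 / (sqrt p * exp (x / 2))) * (- (p * exp x) * exp (- (p * exp x)))).
      + apply (is_derive_mult_R (fun x => 3 / 10 * (sqrt p * exp (x / 2)) + 9 / 10 / (sqrt p * exp (x / 2)))
                (fun x => exp (- (p * exp x)))); [ | auto_derive; [exact I | ring]].
        auto_derive; [lra | ]. unfold Rdiv. pose proof (exp_pos (x * / 2)). field. split; lra.
      + rewrite <- (sqrt_mul_exp_half_sqr p x Hp). set (v := sqrt p * exp (x / 2)) in *. field. lra.
    - intros x _. apply is_derive_neg_tail_x, Hp.
    - intros x Hx. specialize (HvN x ltac:(lra)). unfold neg_majorant, f'.
      set (v := sqrt p * exp (x / 2)) in *. set (e := exp (- (p * exp x))).
      assert (He : 0 < e) by apply exp_pos.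
      enough (0 <= (111 / 100 * v + 3 / 5 * v ^ 3 - 27 / 100 / v) * e) by lra.
      apply Rmult_le_pos; [ | lra].
      replace (111 / 100 * v + 3 / 5 * v ^ 3 - 27 / 100 / v) with
        ((111 / 100 * v ^ 2 + 3 / 5 * (v ^ 2) ^ 2 - 27 / 100) / v) by (field; lra).
      apply Rdiv_le_0_compat; [ | lra]. assert (2209 / 10000 <= v ^ 2) by nra. nra.
    - intros x Hx. specialize (HvN x ltac:(lra)). unfold neg_majorant.
      apply Rmult_le_pos; [ | pos].
      assert (0 < 9 / 10 / (sqrt p * exp (x / 2))) by pos. lra.
    - pose proof (neg_tail_anti E (sqrt p * exp (IZR N * h / 2)) ltac:(lra)).
      assert (IZR N <= IZR M) by (apply IZR_le, HNM).
      pose proof (neg_tail_ge0 (sqrt p * exp (IZR M * h / 2)) ltac:(specialize (HvN (IZR M * h) ltac:(nra)); lra)).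
      lra. }
  replace (decay_gain (65 / 100) 0 h) with (325 / 1000 * h) in HR2 by (unfold decay_gain; field; lra).
  apply Rle_trans with (sum_Z (fun k => - / sqrt PI * (h * neg_majorant p (IZR k * h))) (N + 1) M).
  - rewrite sum_Z_scal.
    set (S := sum_Z (fun k => h * neg_majorant p (IZR k * h)) (N + 1) M) in *.
    rewrite exp_Ropp. pose proof (exp_pos (325 / 1000 * h)) as He.
    enough (S / sqrt PI <= neg_tail E / exp (325 / 1000 * h) / sqrt PI).
    { unfold Rdiv in *. lra. }
    unfold Rdiv at 1 2. apply Rmult_le_compat_r; [apply Rlt_le, Rinv_0_lt_compat, Hpi | ].
    apply le_div_of_mul_le; lra.
  - apply sum_Z_le. intros k _. pose proof (dens_ge_neg_majorant p (IZR k * h) Hp) as H.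
    apply (Rmult_le_compat_l h) in H; [ | lra]. unfold Rdiv in H. lra.
Qed.

(** With $Y = \sqrt{1 + 1/p}$ one has $3Y - 2 \le \frac98 Y^2$, with equality at $Y = 4/3$, and
    $2\sqrt 2 \cdot \frac98 < 3.183$. *)
Lemma trapezoid_error_le (p h delta : R) : 0 < p -> 0 < h -> 0 < delta ->
  10 * (1 + / p) / delta <= strip_factor h - 1 ->
  trapezoid_error p h <= 3183 / 10000 * (10 * (1 + / p) / (strip_factor h - 1)).
Proof.
  intros Hp Hh Hd HX. unfold trapezoid_error.
  assert (Hp2 : 0 < / p) by apply Rinv_0_lt_compat, Hp.
  assert (HB : 0 < 10 * (1 + / p) / delta) by pos.
  pose proof (pow2_sqrt (1 + / p) ltac:(lra)) as HY. pose proof sqrt_2_bounds as H2.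
  set (Y := sqrt (1 + / p)) in *. rewrite <- HY.
  unfold Rdiv. rewrite <- Rmult_assoc. apply Rmult_le_compat_r; [pos | ].
  assert (Hy : 3 * Y - 2 <= 9 / 8 * Y ^ 2).
  { assert (0 <= (3 * Y - 4) ^ 2) by apply pow2_ge_0. nra. }
  nra.
Qed.

(** $6579/1000$ is $2\pi^2/3$ rounded down. *)
Lemma strip_factor_ge (h c : R) : 0 < h -> c * h <= 6579 / 1000 -> exp c <= strip_factor h.
Proof.
  intros Hh Hc. unfold strip_factor. apply exp_le_mono. apply le_div_of_mul_le; [lra | ].
  pose proof PI_bounds as [H1 _]. nra.
Qed.

(** For $E \ge 7/10$ the negative tail takes at most $0.645\,\delta$, and every $h$ works. For
    smaller $E$ its share can be $0.9645$, but then $\delta \ge 0.64$: a large $h$ shrinks the lost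
    sum against its integral, and a small $h$ makes $X$ so large that the trapezoidal error is
    tiny. *)
Lemma overshoot_numeric (p h delta E : R) : 0 < p -> 0 < h -> 0 < delta < 1 ->
  erfc E = delta / 2 -> 10 * (1 + / p) / delta <= strip_factor h - 1 ->
  exp (- (325 / 1000 * h)) * (neg_tail E / sqrt PI) + trapezoid_error p h <= delta.
Proof.
  intros Hp Hh Hd HE HX.
  pose proof (erfc_half_lower E ltac:(lra)) as HE47. pose proof sqrt_PI_bounds as Hpi.
  assert (Hp2 : 0 < / p) by apply Rinv_0_lt_compat, Hp.
  set (X1 := strip_factor h - 1) in *.
  assert (HB : 10 * (1 + / p) <= delta * X1).
  { apply (Rmult_le_compat_r delta) in HX; [ | lra]. unfold Rdiv in HX. rewrite Rmult_assoc, Rinv_l in HX; lra. }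
  assert (HX1 : 0 < X1) by nra.
  assert (Hnt : forall k, exp (- E ^ 2) / E <= k * (sqrt PI * erfc E) ->
     neg_tail E / sqrt PI <= delta * (15 / 100 + 9 / 10 * (k - 1))).
  { intros k Hk. apply div_le_of_le_mul; [lra | ]. unfold neg_tail. rewrite HE in *. lra. }
  assert (Htr : trapezoid_error p h <= 3183 / 10000 * delta).
  { eapply Rle_trans; [apply (trapezoid_error_le p h delta); assumption || lra | ].
    apply Rmult_le_compat_l; [lra | ]. apply div_le_of_le_mul; [exact HX1 | exact HB]. }
  assert (Hexp : forall c b, c <= h -> 0 <= c -> 1 <= b * (1 + 325 / 1000 * c + (325 / 1000 * c) ^ 2 / 2) ->
    exp (- (325 / 1000 * h)) <= b).
  { intros c b Hc Hc0 Hb. apply Rle_trans with (exp (- (325 / 1000 * c))); [apply exp_le_mono; lra | ].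
    rewrite exp_Ropp. pose proof (exp_quad_le (325 / 1000 * c) ltac:(lra)) as Hq.
    pose proof (exp_pos (325 / 1000 * c)).
    apply Rmult_le_reg_r with (exp (325 / 1000 * c)); [assumption | ]. rewrite Rinv_l by lra.
    assert (0 < b) by nra. nra. }
  assert (He0 : 0 < exp (- (325 / 1000 * h))) by apply exp_pos.
  assert (Hn0 : 0 <= neg_tail E / sqrt PI).
  { apply Rdiv_le_0_compat; [apply neg_tail_ge0; lra | lra]. }
  assert (He1 : exp (- (325 / 1000 * h)) <= 1) by (apply (Hexp 0); lra).
  destruct (Rle_dec (7 / 10) E) as [HE7 | HE7].
  - pose proof (Hnt _ (mills_7 E HE7)) as H1. nra.
  - pose proof (Hnt _ (mills_47 E HE47)) as H1.
    assert (Hd64 : 64 / 100 <= delta).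
    { pose proof (erfc_anti E (7 / 10) ltac:(lra)) as H2.
      pose proof (erfc_ge_taylor (7 / 10) ltac:(lra)) as H3. nra. }
    (* The quadratic bound on $3Y - 2$ with a free coefficient: $3Y \le c Y^2 + 9/(4c)$. A small $c$
       pays off when $X$ is large, because the constant term is divided by $X - 1$. *)
    assert (Htr2 : forall c, 0 < c -> 9 / (4 * c) >= 2 ->
       trapezoid_error p h <= 28285 / 10000 * (delta * (c / 10) + (9 / (4 * c) - 2) / X1)).
    { intros c Hc Hc2. unfold trapezoid_error. fold X1. pose proof sqrt_2_bounds as H2.
      pose proof (pow2_sqrt (1 + / p) ltac:(lra)) as HY. set (Y := sqrt (1 + / p)) in *.
      apply div_le_of_le_mul; [exact HX1 | ].
      replace (28285 / 10000 * (delta * (c / 10) + (9 / (4 * c) - 2) / X1) * X1) with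
        (28285 / 10000 * (c / 10 * (delta * X1) + (9 / (4 * c) - 2))) by (field; lra).
      assert (Hy : 3 * Y - 2 <= c * Y ^ 2 + (9 / (4 * c) - 2)).
      { enough (0 <= (2 * c * Y - 3) ^ 2 / (4 * c)).
        { replace (c * Y ^ 2 + (9 / (4 * c) - 2)) with (3 * Y - 2 + (2 * c * Y - 3) ^ 2 / (4 * c)) by (field; lra). lra. }
        apply Rdiv_le_0_compat; [apply pow2_ge_0 | lra]. }
      assert (Hy2 : c * Y ^ 2 <= c / 10 * (delta * X1)) by (rewrite HY; nra).
      assert (0 <= c / 10 * (delta * X1) + (9 / (4 * c) - 2)) by nra.
      nra. }
    destruct (Rle_dec (11 / 10) h) as [Hh1 | Hh1].
    + pose proof (Hexp (11 / 10) (704 / 1000) ltac:(lra) ltac:(lra) ltac:(lra)). nra.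
    + assert (HXa : 381 <= X1 + 1).
      { pose proof (strip_factor_ge h (598 / 100) Hh ltac:(lra)) as H2. unfold X1.
        enough (381 <= exp (598 / 100)) by lra.
        replace (exp (598 / 100)) with (exp (598 / 1000) ^ 10).
        - pose proof (exp_cubic_le (598 / 1000) ltac:(lra)) as H3.
          apply Rle_trans with ((1812 / 1000) ^ 10); [lra | ]. apply pow_incr. lra.
        - simpl. rewrite Rmult_1_r, <- !exp_plus. f_equal. lra. }
      destruct (Rle_dec (4 / 10) h) as [Hh2 | Hh2].
      * pose proof (Hexp (4 / 10) (879 / 1000) ltac:(lra) ltac:(lra) ltac:(lra)).
        pose proof (Htr2 (3 / 10) ltac:(lra) ltac:(lra)) as H2.
        assert (Hq : (9 / (4 * (3 / 10)) - 2) / X1 <= delta * (2262 / 100000)).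
        { apply div_le_of_le_mul; [exact HX1 | ]. nra. }
        nra.
      * assert (HXb : 18000 <= X1 + 1).
        { pose proof (strip_factor_ge h 10 Hh ltac:(lra)) as H2. unfold X1.
          enough (18000 <= exp 10) by lra.
          replace (exp 10) with (exp 1 ^ 10).
          - pose proof (exp_cubic_le 1 ltac:(lra)) as H3.
            apply Rle_trans with ((2666 / 1000) ^ 10); [lra | ]. apply pow_incr. lra.
          - simpl. rewrite Rmult_1_r, <- !exp_plus. f_equal. lra. }
        pose proof (Htr2 (1 / 10) ltac:(lra) ltac:(lra)) as H2.
        assert (Hq : (9 / (4 * (1 / 10)) - 2) / X1 <= delta * (2 / 1000)).
        { apply div_le_of_le_mul; [exact HX1 | ]. nra. }
        nra.
Qed.

(** * Below one: the discarded positive part *)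

(** A chord bound for a convex function. The slope is $0.6366 = 2 \cdot 0.3183$, because the
    trapezoidal error $0.3183\,\delta$ will be measured against $\delta/2$; $1.02$ is a rate for
    which the chord is valid. *)
Lemma exp_neg_102 (t : R) : 0 <= t <= 1 -> exp (- (102 / 100 * t)) <= 1 - 6366 / 10000 * t.
Proof.
  intros Ht.
  assert (H1 : exp (- (102 / 100)) <= 3634 / 10000).
  { rewrite exp_Ropp.
    replace (102 / 100) with (51 / 100 + 51 / 100) by lra. rewrite exp_plus.
    pose proof (exp_cubic_le (51 / 100) ltac:(lra)) as H.
    apply Rmult_le_reg_r with (exp (51 / 100) * exp (51 / 100)); [nra | ].
    rewrite Rinv_l by nra. nra. }
  set (a := exp (- (102 / 100 * t))). assert (Ha : 0 < a) by apply exp_pos.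
  (* The tangent at $t$, evaluated at 0 here and at 1 in [H3]; the weights $1 - t$ and $t$ combine
     the two into the chord bound. *)
  assert (H2 : a * (1 + 102 / 100 * t) <= 1).
  { pose proof (exp_ineq1_le (102 / 100 * t)) as H. unfold a. rewrite exp_Ropp.
    pose proof (exp_pos (102 / 100 * t)) as Hp. apply Rmult_le_reg_l with (exp (102 / 100 * t)); [exact Hp | ].
    rewrite <- Rmult_assoc, Rinv_r by (apply Rgt_not_eq, Hp). lra. }
  assert (H3 : a * (1 - 102 / 100 * (1 - t)) <= exp (- (102 / 100))).
  { replace (- (102 / 100)) with (- (102 / 100 * t) + - (102 / 100 * (1 - t))) by lra. rewrite exp_plus.
    apply Rmult_le_compat_l; [pos | ]. pose proof (exp_ineq1_le (- (102 / 100 * (1 - t)))). lra. }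
  nra.
Qed.

(* With [l = h / H <= 1], [H = 6.579 / L], the ratio [B / (X - 1)] is at most
   [(3 - k) l^2 + (k - 2) l^3]: a convexity bound for [e^{- k (1 / l - 1)}]. *)
Lemma strip_ratio_le (h B k L : R) : 0 < h -> 0 < B -> 1 + B <= exp L -> 2 <= k <= 3 -> k <= L ->
  let l := h * L / (6579 / 1000) in l < 1 ->
  B / (strip_factor h - 1) <= (3 - k) * l ^ 2 + (k - 2) * l ^ 3.
Proof.
  intros Hh HB HL Hk HkL l Hl.
  assert (Hl0 : 0 < l) by (unfold l; apply Rdiv_lt_0_compat; nra).
  set (y := / l - 1).
  assert (Hyl : l * (1 + y) = 1) by (unfold y; field; lra).
  assert (Hy : 0 < y) by nra.
  pose proof (strip_factor_ge h (L * (1 + y)) Hh) as HX.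
  assert (Hc : L * (1 + y) * h <= 6579 / 1000).
  { assert (E : L * (1 + y) * h = 6579 / 1000 * (l * (1 + y))) by (unfold l; field). rewrite E, Hyl. lra. }
  specialize (HX Hc). pose proof (strip_factor_gt1 h Hh) as HX1.
  (* The exponent is split as $y + y + (k-2) y$ and each factor replaced by its tangent, so that two
     factors cancel exactly against $l^2 = (1+y)^{-2}$. *)
  assert (Hky : (1 + y) ^ 2 * (1 + (k - 2) * y) <= exp (k * y)).
  { replace (k * y) with (y + y + (k - 2) * y) by ring. rewrite !exp_plus.
    pose proof (exp_ineq1_le y). pose proof (exp_ineq1_le ((k - 2) * y)).
    assert (0 <= (k - 2) * y) by nra.
    apply Rmult_le_compat; [nra | lra | nra | lra]. }
  assert (HLy : exp (k * y) <= exp (L * y)) by (apply exp_le_mono; nra).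
  assert (HeL : 1 < exp L) by lra.
  assert (Hrat : (strip_factor h - 1) >= exp (k * y) * B).
  { replace (L * (1 + y)) with (L + L * y) in HX by ring. rewrite exp_plus in HX.
    assert (1 <= exp (k * y)) by (rewrite <- exp_0; apply exp_le_mono; nra).
    assert (exp L * exp (k * y) <= exp L * exp (L * y)) by (apply Rmult_le_compat_l; lra).
    nra. }
  apply div_le_of_le_mul; [lra | ].
  assert (Hq : 0 <= (3 - k) * l ^ 2 + (k - 2) * l ^ 3).
  { assert (0 <= l ^ 2) by nra. assert (0 <= l ^ 3) by pos.
    assert (0 <= (3 - k) * l ^ 2) by pos.
    assert (0 <= (k - 2) * l ^ 3) by pos. lra. }
  assert (Hpoly : 1 <= ((3 - k) * l ^ 2 + (k - 2) * l ^ 3) * ((1 + y) ^ 2 * (1 + (k - 2) * y))).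
  { replace (((3 - k) * l ^ 2 + (k - 2) * l ^ 3) * ((1 + y) ^ 2 * (1 + (k - 2) * y)))
      with ((l * (1 + y)) ^ 2 * (((3 - k) + (k - 2) * l) * (1 + (k - 2) * y))) by ring.
    rewrite Hyl.
    assert (E : ((3 - k) + (k - 2) * l) * (1 + (k - 2) * y) = 1 + (k - 2) * (3 - k) * (l + y - 1)
       + (k - 2) ^ 2 * (l * (1 + y) - 1)) by ring.
    rewrite Hyl in E. rewrite E.
    assert (0 <= l + y - 1) by nra.
    assert (0 <= (k - 2) * (3 - k) * (l + y - 1)) by pos. lra. }
  set (q := (3 - k) * l ^ 2 + (k - 2) * l ^ 3) in *.
  apply Rle_trans with (q * (exp (k * y) * B)).
  - assert (q * ((1 + y) ^ 2 * (1 + (k - 2) * y)) <= q * exp (k * y)) by (apply Rmult_le_compat_l; lra).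
    rewrite <- Rmult_assoc. nra.
  - apply Rmult_le_compat_l; lra.
Qed.

(** Both sides are compared as cubics in $l = hL/6.579$: the gain is at least $a_1 l + a_2 l^2 + a_3
    l^3$, and for $l < 1$ the error ratio is at most $(3-k) l^2 + (k-2) l^3$. The two numerical
    hypotheses are the comparison of coefficients, multiplied by $L^2$ and $L^3$. For $l \ge 1$ it
    is enough that the ratio is at most 1. The numbers are $6.579/2$, $6.579^2/3$ and $6.579^3/8$,
    the last two rounded down. *)
Lemma decay_beats_trapezoid (m w h B k L : R) :
  0 < h -> 0 <= m -> 0 <= w -> 0 < B -> B <= strip_factor h - 1 -> 1 + B <= exp L ->
  2 <= k <= 3 -> k <= L ->
  102 / 100 * (3 - k) * L ^ 2 <= 32895 / 10000 * m * L + 14427 / 1000 * w ->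
  102 / 100 * L ^ 3 <= 32895 / 10000 * m * L ^ 2 + 14427 / 1000 * w * L + 3559 / 100 * w ->
  exp (- decay_gain m w h) <= 1 - 6366 / 10000 * (B / (strip_factor h - 1)).
Proof.
  intros Hh Hm Hw HB HX HL Hk HkL H2 H3.
  set (l := h * L / (6579 / 1000)).
  set (a1 := 32895 / 10000 * m / L). set (a2 := 14427 / 1000 * w / L ^ 2). set (a3 := 3559 / 100 * w / L ^ 3).
  assert (HL2 : 0 < L ^ 2) by nra. assert (HL3 : 0 < L ^ 3) by pos.
  assert (Ha1 : 0 <= a1) by pos.
  assert (Ha2 : 0 <= a2) by pos.
  assert (Ha3 : 0 <= a3) by pos.
  assert (Hl0 : 0 < l) by (unfold l; apply Rdiv_lt_0_compat; nra).
  assert (Hc2 : 102 / 100 * (3 - k) <= a1 + a2).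
  { replace (a1 + a2) with ((32895 / 10000 * m * L + 14427 / 1000 * w) / L ^ 2) by (unfold a1, a2; field; lra).
    apply le_div_of_mul_le; lra. }
  assert (Hc3 : 102 / 100 <= a1 + a2 + a3).
  { replace (a1 + a2 + a3) with ((32895 / 10000 * m * L ^ 2 + 14427 / 1000 * w * L + 3559 / 100 * w) / L ^ 3)
      by (unfold a1, a2, a3; field; lra).
    apply le_div_of_mul_le; lra. }
  assert (HG : a1 * l + a2 * l ^ 2 + a3 * l ^ 3 <= decay_gain m w h).
  { eapply Rle_trans; [ | apply decay_gain_lower; assumption].
    replace (a1 * l) with (m * h / 2) by (unfold a1, l; field; lra).
    replace (a2 * l ^ 2) with (w * (h ^ 2 * (14427 / 1000 / (6579 / 1000) ^ 2))) by (unfold a2, l; field; lra).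
    replace (a3 * l ^ 3) with (w * (h ^ 3 * (3559 / 100 / (6579 / 1000) ^ 3))) by (unfold a3, l; field; lra).
    assert (0 <= h ^ 2) by nra. assert (0 <= h ^ 3) by pos.
    rewrite Rplus_assoc, <- Rmult_plus_distr_l. apply Rplus_le_compat_l, Rmult_le_compat_l; [exact Hw | lra]. }
  set (t := B / (strip_factor h - 1)).
  assert (Ht : 0 <= t <= 1).
  { unfold t. split; [pos | apply div_le_of_le_mul; lra]. }
  enough (HGt : 102 / 100 * t <= decay_gain m w h).
  { eapply Rle_trans; [ | apply exp_neg_102, Ht]. apply exp_le_mono. lra. }
  eapply Rle_trans; [ | exact HG].
  destruct (Rlt_le_dec l 1) as [Hl | Hl].
  - pose proof (strip_ratio_le h B k L Hh HB HL Hk HkL) as Hr. cbv zeta in Hr. fold l t in Hr. specialize (Hr Hl).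
    assert (Hl2 : 0 <= l ^ 2 * (1 - l)) by (apply Rmult_le_pos; nra).
    assert (Hl3 : 0 <= l ^ 3) by pos.
    assert (Ha1l : a1 * l ^ 2 <= a1 * l) by (apply Rmult_le_compat_l; nra).
    assert (0 <= (a1 + a2 - 102 / 100 * (3 - k)) * (l ^ 2 * (1 - l))) by pos.
    assert (0 <= (a1 + a2 + a3 - 102 / 100) * l ^ 3) by pos.
    assert (0 <= a1 * (l ^ 2 * (1 - l))) by pos.
    nra.
  - assert (1 <= l ^ 2) by nra. assert (1 <= l ^ 3) by (simpl; nra).
    assert (a1 * 1 <= a1 * l) by (apply Rmult_le_compat_l; lra).
    assert (a2 * 1 <= a2 * l ^ 2) by (apply Rmult_le_compat_l; lra).
    assert (a3 * 1 <= a3 * l ^ 3) by (apply Rmult_le_compat_l; lra).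
    nra.
Qed.

Lemma exp_ge_pow32 (y : R) : 0 <= y -> (1 + y + y ^ 2 / 2 + y ^ 3 / 6) ^ 32 <= exp (32 * y).
Proof.
  intros Hy.
  assert (H : exp y ^ 32 = exp (32 * y)) by (simpl; rewrite Rmult_1_r, <- !exp_plus; f_equal; ring).
  rewrite <- H. apply pow_incr. split; [ | apply exp_cubic_le, Hy].
  assert (0 <= y ^ 2) by nra. assert (0 <= y ^ 3) by (apply pow_le, Hy). lra.
Qed.

(* Used on boxes in [c = p e^x] ([x] the cutoff) and [r = 1 / p], where [w0] and [m0] are
   lower bounds of [c (1 + r)] and [c + 2 c r - 1 / 2]. *)
Lemma undershoot_box (r2 b w0 m0 k L : R) :
  0 < b -> 0 <= w0 -> 0 <= m0 -> 0 <= L -> 2 <= k <= 3 -> k <= L ->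
  1 + b * (1 + r2) <= exp L ->
  102 / 100 * (3 - k) * L ^ 2 <= 32895 / 10000 * m0 * L + 14427 / 1000 * w0 ->
  102 / 100 * L ^ 3 <= 32895 / 10000 * m0 * L ^ 2 + 14427 / 1000 * w0 * L + 3559 / 100 * w0 ->
  forall r m w h B, r <= r2 -> w0 <= w -> m0 <= m ->
  0 < h -> 0 < B <= b * (1 + r) -> B <= strip_factor h - 1 ->
  exp (- decay_gain m w h) <= 1 - 6366 / 10000 * (B / (strip_factor h - 1)).
Proof.
  intros Hb Hw0 Hm0 HL Hk HkL He H2 H3 r m w h B Hr Hw Hm Hh HB HX.
  apply (decay_beats_trapezoid m w h B k L); try lra.
  - assert (b * (1 + r) <= b * (1 + r2)) by (apply Rmult_le_compat_l; lra). lra.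
  - assert (32895 / 10000 * m0 * L <= 32895 / 10000 * m * L) by (apply Rmult_le_compat_r; lra). lra.
  - assert (32895 / 10000 * m0 * L ^ 2 <= 32895 / 10000 * m * L ^ 2)
      by (apply Rmult_le_compat_r; [apply pow2_ge_0 | lra]).
    assert (14427 / 1000 * w0 * L <= 14427 / 1000 * w * L) by (apply Rmult_le_compat_r; lra). lra.
Qed.

(** The disjunction is what remains of a negative slope when [A] is replaced by its upper bound
    $2e^x = 2cr$. Monotonicity in $w$ and $r$ reduces the exclusion of $w < w_0$ to one inequality
    at the corner $(w_0, r_2)$. *)
Lemma weight_lower_bound (c r r2 w0 : R) : 0 < c -> 0 < r <= r2 -> 0 <= w0 <= 1 / 2 ->
  4 * w0 * (1 - w0) * r2 <= (1 - 2 * w0) * (1 + r2) ->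
  1 / 2 < c * (1 + r) \/ 1 - 2 * (c * (1 + r)) < 2 * (c * r) * (2 - 2 * (c * (1 + r))) ->
  w0 <= c * (1 + r).
Proof.
  intros Hc Hr Hw0 Hq H. apply Rnot_lt_le. intros Hlt.
  set (w := c * (1 + r)) in *. assert (Hw : 0 < w) by (unfold w; pos).
  destruct H as [H | H]; [lra | ].
  assert (H1 : (1 - 2 * w) * (1 + r) < 4 * w * (1 - w) * r).
  { apply (Rmult_lt_compat_r (1 + r)) in H; [ | lra].
    replace (2 * (c * r) * (2 - 2 * w) * (1 + r)) with (4 * w * (1 - w) * r) in H by (unfold w; ring). exact H. }
  assert (H2 : 4 * w * (1 - w) <= 4 * w0 * (1 - w0)) by nra.
  assert (H3 : 4 * w * (1 - w) * r2 <= 4 * w0 * (1 - w0) * r2) by (apply Rmult_le_compat_r; lra).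
  assert (H4 : (1 - 2 * w0) * (1 + r2) <= (1 - 2 * w) * (1 + r2)) by (apply Rmult_le_compat_r; lra).
  assert (H5 : (1 - 2 * w - 4 * w * (1 - w)) * (r2 - r) >= 0 \/ 1 - 2 * w - 4 * w * (1 - w) < 0).
  { destruct (Rlt_le_dec (1 - 2 * w - 4 * w * (1 - w)) 0); [right; lra | left; nra]. }
  destruct H5 as [H5 | H5]; nra.
Qed.

(** With $\operatorname{erfc} E = \delta/2$ the left side is $1 + 10/\delta$. By [erfc_lower] it is
    $e^{E^2}$ times a slowly growing factor, which the extra $E^2/4$ and the constant $e^{2.45} >
    11.5$ absorb. *)
Lemma log_bound_large (E : R) : 9 / 10 <= E ->
  1 + 5 / erfc E <= exp (125 / 100 * E ^ 2 + 245 / 100).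
Proof.
  intros HE. pose proof sqrt_PI_bounds as Hpi.
  pose proof (erfc_lower E ltac:(lra)) as Hl. rewrite exp_Ropp in Hl.
  set (e := exp (E ^ 2)) in *.
  assert (He : 1 + E ^ 2 <= e) by apply exp_ineq1_le.
  assert (HE2 : 81 / 100 <= E ^ 2) by nra.
  assert (Hlow : 0 < 2 * E * / e / (1 + 2 * E ^ 2)).
  { apply Rdiv_lt_0_compat; [ | lra]. apply Rmult_lt_0_compat; [lra | pos]. }
  assert (Herf : 0 < erfc E) by nra.
  assert (H245 : 115 / 10 <= exp (245 / 100)).
  { replace (245 / 100) with (32 * (245 / 3200)) by field.
    eapply Rle_trans; [ | apply exp_ge_pow32; lra]. lra. }
  assert (Hq : 1 + E ^ 2 / 4 + E ^ 4 / 32 <= exp (E ^ 2 / 4)).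
  { pose proof (exp_quad_le (E ^ 2 / 4) ltac:(lra)). nra. }
  replace (125 / 100 * E ^ 2 + 245 / 100) with (245 / 100 + (E ^ 2 + E ^ 2 / 4)) by field.
  rewrite !exp_plus. fold e.
  apply Rle_trans with (115 / 10 * (e * (1 + E ^ 2 / 4 + E ^ 4 / 32))).
  2: { assert (0 <= E ^ 4) by (replace (E ^ 4) with ((E ^ 2) ^ 2) by ring; apply pow2_ge_0).
       apply Rmult_le_compat; [lra | pos | lra | ]. apply Rmult_le_compat_l; lra. }
  assert (H5 : 5 / erfc E <= e * (443125 / 100000 * (1 + 2 * E ^ 2) / E)).
  { apply div_le_of_le_mul; [exact Herf | ].
    apply (Rmult_le_compat_l (e * (5 / 2 * (1 + 2 * E ^ 2) / E))) in Hl.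
    - replace (e * (5 / 2 * (1 + 2 * E ^ 2) / E) * (2 * E * / e / (1 + 2 * E ^ 2))) with 5 in Hl by (field; repeat split; nra).
      eapply Rle_trans; [exact Hl | ].
      replace (e * (5 / 2 * (1 + 2 * E ^ 2) / E) * (sqrt PI * erfc E)) with
        (e * (1 + 2 * E ^ 2) / E * erfc E * (5 / 2 * sqrt PI)) by (field; lra).
      replace (e * (443125 / 100000 * (1 + 2 * E ^ 2) / E) * erfc E) with
        (e * (1 + 2 * E ^ 2) / E * erfc E * (443125 / 100000)) by (field; lra).
      apply Rmult_le_compat_l; [ | lra].
      apply Rmult_le_pos; [ | lra]. apply Rdiv_le_0_compat; [pos | lra].
    - apply Rmult_le_pos; [lra | ]. apply Rdiv_le_0_compat; [lra | lra]. }
  assert (H1 : 1 <= e * (/ (1 + E ^ 2))).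
  { apply (le_div_of_mul_le 1 e (1 + E ^ 2)); lra. }
  enough (/ (1 + E ^ 2) + 443125 / 100000 * (1 + 2 * E ^ 2) / E <= 115 / 10 * (1 + E ^ 2 / 4 + E ^ 4 / 32)) by nra.
  assert (H1E : / (1 + E ^ 2) <= 1 / 2 / E).
  { replace (/ (1 + E ^ 2)) with (1 / (1 + E ^ 2)) by (unfold Rdiv; ring).
    apply div_le_of_le_mul; [lra | ]. replace (1 / 2 / E * (1 + E ^ 2)) with ((1 + E ^ 2) / (2 * E)) by (field; lra).
    apply le_div_of_mul_le; [lra | ]. pose proof (pow2_ge_0 (E - 1)). lra. }
  enough (1 / 2 / E + 443125 / 100000 * (1 + 2 * E ^ 2) / E <= 115 / 10 * (1 + E ^ 2 / 4 + E ^ 4 / 32)) by lra.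
  replace (1 / 2 / E + 443125 / 100000 * (1 + 2 * E ^ 2) / E) with
    ((493125 / 100000 + 88625 / 10000 * E ^ 2) / E) by (field; lra).
  apply div_le_of_le_mul; [lra | ].
  set (t := E - 9 / 10). assert (Ht : 0 <= t) by (unfold t; lra). replace E with (t + 9 / 10) by (unfold t; ring).
  assert (0 <= t ^ 2) by nra. assert (0 <= t ^ 3) by (apply pow_le, Ht). assert (0 <= t ^ 4) by (apply pow_le, Ht).
  assert (0 <= t ^ 5) by (apply pow_le, Ht). nra.
Qed.

(** One box $c \ge c_1$, $r_1 \le r \le r_2$: [b] is 10 over a lower bound for $\delta$, and [L]
    bounds $\log(1 + b(1 + r_2))$. The bounds [w0] and [m0] come from the corner $(c_1, r_1)$,
    except where [weight_lower_bound] yields a better [w0]. *)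
Ltac undershoot_box_tac c r c1 r1 r2 b w0 m0 k L Hbox HX :=
  assert (c1 * r1 <= c * r) by (apply Rmult_le_compat; lra);
  apply (undershoot_box r2 b w0 m0 k L) with (r := r);
  [ lra | lra | lra | lra | lra | lra
  | replace L with (32 * (L / 32)) by field; eapply Rle_trans; [ | apply exp_ge_pow32; lra]; lra
  | lra | lra | first [lra | nra]
  | first [ rewrite Rmult_plus_distr_l; lra | apply (weight_lower_bound _ _ r2 w0); solve [assumption | lra] ]
  | lra | assumption | exact Hbox | exact HX ].

Lemma undershoot_numeric (E delta c r m h : R) :
  0 < delta < 1 -> erfc E = delta / 2 -> 0 < r -> E ^ 2 <= c -> c * r < 9 / 10 ->
  0 <= m -> c + 2 * (c * r) - 1 / 2 <= m -> 0 < h ->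
  1 / 2 < c * (1 + r) \/ 1 - 2 * (c * (1 + r)) < 2 * (c * r) * (2 - 2 * (c * (1 + r))) ->
  10 * (1 + r) / delta <= strip_factor h - 1 ->
  exp (- decay_gain m (c * (1 + r)) h)
  <= 1 - 6366 / 10000 * (10 * (1 + r) / delta / (strip_factor h - 1)).
Proof.
  intros Hd HE Hr Hc Hcr Hm Hm2 Hh Hcase HX.
  pose proof (erfc_half_lower E ltac:(lra)) as HE47. pose proof sqrt_PI_bounds as Hpi.
  assert (HB : 0 < 10 * (1 + r) / delta) by pos.
  (* From $E \le x$ follows $\delta = 2\operatorname{erfc} E \ge 2\operatorname{erfc} x$; [d] is a
     rational lower bound for this, certified by a Taylor polynomial. *)
  assert (Hbox : forall d x, 0 <= x -> E <= x -> 0 < d -> d * (sqrt PI) <= 2 * (sqrt PI - 2 * (x - x ^ 3 / 3 + x ^ 5 / 10)) ->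
    0 < 10 * (1 + r) / delta <= 10 / d * (1 + r)).
  { intros d x Hx0 Hx Hd0 Hdx. split; [exact HB | ].
    pose proof (erfc_anti E x Hx) as H1. pose proof (erfc_ge_taylor x Hx0) as H2.
    assert (H3 : d <= delta) by nra.
    replace (10 / d * (1 + r)) with (10 * (1 + r) / d) by (field; lra).
    apply Rmult_le_compat_l; [lra | ]. apply Rinv_le_contravar; lra. }
  assert (Hc0 : 2209 / 10000 <= c) by nra.
  destruct (Rle_dec (9 / 10) E) as [H9 | H9].
  (* An explicit upper bound for $\log((1+r)(1 + 10/\delta))$, from $E^2 \le c$ and $1 + r \le e^r$.
     It is affine in $c$ and $r$, so the unbounded range $E \ge 9/10$ reduces to polynomial
     inequalities. *)
  { set (L := 125 / 100 * c + 245 / 100 + r).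
    assert (Hc9 : 81 / 100 <= c) by nra.
    apply (decay_beats_trapezoid m (c * (1 + r)) h _ 3 L); try assumption; try (unfold L; lra).
    - pos.
    - pose proof (log_bound_large E H9) as HL. rewrite HE in HL.
      replace (5 / (delta / 2)) with (10 / delta) in HL by (field; lra).
      apply Rle_trans with ((1 + r) * exp (125 / 100 * E ^ 2 + 245 / 100)).
      + apply Rle_trans with ((1 + r) * (1 + 10 / delta)); [ | apply Rmult_le_compat_l; lra].
        replace (10 * (1 + r) / delta) with ((1 + r) * (10 / delta)) by (field; lra). lra.
      + unfold L. rewrite (exp_plus _ r), Rmult_comm. apply Rmult_le_compat.
        * pos. * lra. * apply exp_le_mono. lra. * pose proof (exp_ineq1_le r). lra.
    - assert (HL : 0 < L) by (unfold L; lra).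
      assert (HL1 : 0 <= L ^ 2) by nra.
      assert (0 <= 32895 / 10000 * m * L) by pos.
      assert (0 <= 14427 / 1000 * (c * (1 + r))) by nra. lra.
    - assert (HL : 0 < L) by (unfold L; lra).
      assert (Hkey : 102 / 100 * L ^ 2 <= 32895 / 10000 * m * L + 14427 / 1000 * (c * (1 + r))).
      { apply Rle_trans with (32895 / 10000 * (c + 2 * (c * r) - 1 / 2) * L + 14427 / 1000 * (c * (1 + r))).
        - unfold L. set (t := c - 81 / 100). assert (Ht : 0 <= t) by (unfold t; lra).
          replace c with (t + 81 / 100) by (unfold t; ring).
          assert (0 <= t ^ 2) by nra. assert (0 <= t * r) by nra. assert (0 <= t ^ 2 * r) by nra.
          assert (0 <= t * r ^ 2) by nra. nra.
        - assert (32895 / 10000 * (c + 2 * (c * r) - 1 / 2) * L <= 32895 / 10000 * m * L) by (apply Rmult_le_compat_r; lra).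
          lra. }
      apply (Rmult_le_compat_r L) in Hkey; [ | lra].
      assert (0 <= 3559 / 100 * (c * (1 + r))) by nra. nra. }
  (* From here the range is bounded: $c \ge E^2$ and $cr < 9/10$ limit $r$ by $0.9/E^2$, which is
     where the last box in each range of $E$ ends. *)
  destruct (Rle_dec (75 / 100) E) as [H75 | H75].
  { assert (Hc75 : 5625 / 10000 <= c) by nra.
    specialize (Hbox (3839 / 10000) (9 / 10) ltac:(lra) ltac:(lra) ltac:(lra) ltac:(nra)).
    destruct (Rle_dec r (56 / 100)).
    - undershoot_box_tac c r (5625 / 10000) 0 (56 / 100) (10 / (3839 / 10000)) (5624 / 10000) (62 / 1000) 3 (3730 / 1000) Hbox HX.
    - undershoot_box_tac c r (5625 / 10000) (56 / 100) (160 / 100) (10 / (3839 / 10000)) (8774 / 10000) (692 / 1000) 3 (4232 / 1000) Hbox HX. }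
  destruct (Rle_dec (62 / 100) E) as [H62 | H62].
  { assert (Hc62 : 3844 / 10000 <= c) by nra.
    specialize (Hbox (5711 / 10000) (75 / 100) ltac:(lra) ltac:(lra) ltac:(lra) ltac:(nra)).
    destruct (Rle_dec r (28 / 100)); [ | destruct (Rle_dec r 1)].
    - undershoot_box_tac c r (3844 / 10000) 0 (28 / 100) (10 / (5711 / 10000)) (3954 / 10000) 0 3 (3155 / 1000) Hbox HX.
    - undershoot_box_tac c r (3844 / 10000) (28 / 100) 1 (10 / (5711 / 10000)) (4920 / 10000) (99 / 1000) 3 (3586 / 1000) Hbox HX.
    - undershoot_box_tac c r (3844 / 10000) 1 (235 / 100) (10 / (5711 / 10000)) (7687 / 10000) (653 / 1000) 3 (4090 / 1000) Hbox HX. }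
  destruct (Rle_dec (53 / 100) E) as [H53 | H53].
  { assert (Hc53 : 2809 / 10000 <= c) by nra.
    specialize (Hbox (7593 / 10000) (62 / 100) ltac:(lra) ltac:(lra) ltac:(lra) ltac:(nra)).
    destruct (Rle_dec r (47 / 100)); [ | destruct (Rle_dec r (92 / 100)); [ | destruct (Rle_dec r (314 / 100))]].
    - undershoot_box_tac c r (2809 / 10000) 0 (47 / 100) (10 / (7593 / 10000)) (3537 / 10000) 0 3 (3015 / 1000) Hbox HX.
    - undershoot_box_tac c r (2809 / 10000) (47 / 100) (92 / 100) (10 / (7593 / 10000)) (4129 / 10000) (44 / 1000) 3 (3271 / 1000) Hbox HX.
    - undershoot_box_tac c r (2809 / 10000) (92 / 100) (314 / 100) (10 / (7593 / 10000)) (5393 / 10000) (297 / 1000) 3 (4018 / 1000) Hbox HX.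
    - undershoot_box_tac c r (2809 / 10000) (314 / 100) (321 / 100) (10 / (7593 / 10000)) (11629 / 10000) (1544 / 1000) 3 (4035 / 1000) Hbox HX. }
  specialize (Hbox (9063 / 10000) (53 / 100) ltac:(lra) ltac:(lra) ltac:(lra) ltac:(nra)).
  destruct (Rle_dec r (61 / 100)); [ | destruct (Rle_dec r (76 / 100)); [ | destruct (Rle_dec r (115 / 100));
    [ | destruct (Rle_dec r (267 / 100))]]].
  (* In this box the logarithmic bound [L] is below 3, so [k] is lowered to [L], as $k \le L$ is
     required. *)
  - undershoot_box_tac c r (2209 / 10000) 0 (61 / 100) (10 / (9063 / 10000)) (3319 / 10000) 0 (2933 / 1000) (2933 / 1000) Hbox HX.
  - undershoot_box_tac c r (2209 / 10000) (61 / 100) (76 / 100) (10 / (9063 / 10000)) (3556 / 10000) 0 3 (3018 / 1000) Hbox HX.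
  - undershoot_box_tac c r (2209 / 10000) (76 / 100) (115 / 100) (10 / (9063 / 10000)) (3887 / 10000) (56 / 1000) 3 (3209 / 1000) Hbox HX.
  - undershoot_box_tac c r (2209 / 10000) (115 / 100) (267 / 100) (10 / (9063 / 10000)) (4749 / 10000) (228 / 1000) 3 (3727 / 1000) Hbox HX.
  - undershoot_box_tac c r (2209 / 10000) (267 / 100) (408 / 100) (10 / (9063 / 10000)) (8106 / 10000) (900 / 1000) 3 (4045 / 1000) Hbox HX.
Qed.

(** * The integral lost beyond the cutoff *)

Lemma is_derive_gauss_moment (v : R) :
  is_derive (fun v => v * exp (- v ^ 2)) v ((1 - 2 * v ^ 2) * exp (- v ^ 2)).
Proof. auto_derive; [exact I | simpl; ring]. Qed.

(** $v e^{-v^2}$ decreases once $v^2 \ge 1/2$, so only $u^2 < 1/2$ needs work. There $u e^{-u^2} \ge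
    0.3767$, its bound at $u = 0.47$: for $v > 1$ the left moment is already smaller, and for $v \le
    1$ it is at most $0.4412$ while the factor is at most $0.853$. *)
Lemma gauss_moment_cross (u v : R) : 47 / 100 <= u <= v ->
  v * exp (- v ^ 2) * (1 - 2 * u ^ 2 / (1 + 2 * v ^ 2)) <= u * exp (- u ^ 2).
Proof.
  intros Hu. assert (Hu2 : 2209 / 10000 <= u ^ 2) by nra. assert (Hv2 : u ^ 2 <= v ^ 2) by nra.
  assert (Hdec : forall s t, 1 / 2 <= s ^ 2 -> 0 < s <= t -> t * exp (- t ^ 2) <= s * exp (- s ^ 2)).
  { intros s t Hs Hst.
    apply (derive_nonpos_le (fun v => v * exp (- v ^ 2)) (fun v => (1 - 2 * v ^ 2) * exp (- v ^ 2))); [lra | | ].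
    - intros; apply is_derive_gauss_moment.
    - intros x Hx. pose proof (exp_pos (- x ^ 2)). assert (s ^ 2 <= x ^ 2) by nra. nra. }
  assert (Hg : 0 < v * exp (- v ^ 2)) by pos.
  assert (Hf : 0 <= 2 * u ^ 2 / (1 + 2 * v ^ 2)) by pos.
  destruct (Rle_dec (1 / 2) (u ^ 2)) as [H | H].
  - pose proof (Hdec u v H ltac:(lra)). nra.
  - apply Rnot_le_lt in H.
    assert (Hlow : 3767 / 10000 <= u * exp (- u ^ 2)).
    { apply Rle_trans with (47 / 100 * exp (- (47 / 100) ^ 2)).
      - pose proof (exp_neg_taylor3_le ((47 / 100) ^ 2) ltac:(lra)) as [H1 _].
        set (e := exp (- (47 / 100) ^ 2)) in *. lra.
      - apply (derive_nonneg_le (fun v => v * exp (- v ^ 2)) (fun v => (1 - 2 * v ^ 2) * exp (- v ^ 2))); [lra | | ].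
        + intros; apply is_derive_gauss_moment.
        + intros x Hx. pose proof (exp_pos (- x ^ 2)). assert (x ^ 2 <= u ^ 2) by (apply pow_incr; lra).
          pos. }
    destruct (Rle_dec v 1) as [Hv | Hv].
    + assert (H1 : v * exp (- v ^ 2) <= 4412 / 10000).
      { rewrite exp_Ropp. apply div_le_of_le_mul; [apply exp_pos | ].
        pose proof (exp_quad_le (v ^ 2) ltac:(nra)). pose proof (pow2_ge_0 (v ^ 2 - 5625 / 10000)).
        pose proof (pow2_ge_0 (v - 72 / 100)). nra. }
      assert (H2 : 4418 / 30000 <= 2 * u ^ 2 / (1 + 2 * v ^ 2)).
      { apply le_div_of_mul_le; [lra | ]. nra. }
      nra.
    + assert (H1 : v * exp (- v ^ 2) <= 3751 / 10000).
      { eapply Rle_trans; [apply (Hdec 1 v); lra | ].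
        rewrite exp_Ropp. apply div_le_of_le_mul; [apply exp_pos | ].
        pose proof (exp_cubic_le (1 ^ 2) ltac:(lra)). lra. }
      nra.
Qed.

(** As $A \le 1$, $\sqrt\pi \operatorname{erfc} v$ can be lowered to [A] times its rational bound.
    Then both sides carry the factor $A/u^2$, and [gauss_moment_cross] remains. *)
Lemma mills_cross (u v A B : R) : 47 / 100 <= u <= v -> 0 < A <= 1 -> B <= v ^ 2 / u ^ 2 * A ->
  B * exp (- v ^ 2) / v - sqrt PI * erfc v <= A * exp (- u ^ 2) / u.
Proof.
  intros Hu HA HB. pose proof (erfc_lower v ltac:(lra)) as He.
  pose proof (gauss_moment_cross u v Hu) as Hc.
  set (g := exp (- v ^ 2)) in *. set (g0 := exp (- u ^ 2)) in *.
  assert (Hg : 0 < g) by apply exp_pos.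
  assert (Hu2 : 0 < u ^ 2) by nra. assert (Hv2 : 0 < 1 + 2 * v ^ 2) by nra.
  apply Rle_trans with (v ^ 2 / u ^ 2 * A * g / v - A * (2 * v * g / (1 + 2 * v ^ 2))).
  - assert (H1 : B * g / v <= v ^ 2 / u ^ 2 * A * g / v).
    { unfold Rdiv. apply Rmult_le_compat_r; [pos | ].
      apply Rmult_le_compat_r; [lra | exact HB]. }
    assert (H2 : 0 <= 2 * v * g / (1 + 2 * v ^ 2)) by (apply Rdiv_le_0_compat; [nra | lra]).
    nra.
  - replace (v ^ 2 / u ^ 2 * A * g / v - A * (2 * v * g / (1 + 2 * v ^ 2))) with
      (A / u ^ 2 * (v * g * (1 - 2 * u ^ 2 / (1 + 2 * v ^ 2)))) by (field; repeat split; lra).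
    replace (A * g0 / u) with (A / u ^ 2 * (u * g0)) by (field; lra).
    apply Rmult_le_compat_l; [ | exact Hc]. pos.
Qed.

(** In the variable of [cum_dA] this is [mills_cross] for the values of [A] at the two ends, whose
    ratio is controlled by [dawsonA_ratio_mono]. *)
Lemma cum_increment_le (p x y : R) : 0 < p -> x <= y -> dA y < 1 -> 47 / 100 <= sqrt p * exp (x / 2) ->
  cum p y - cum p x <= erfc (sqrt p * exp (x / 2)).
Proof.
  intros Hp Hxy HA Hv. pose proof sqrt_PI_pos as Hpi. pose proof (sqrt_lt_R0 p Hp) as Hs.
  pose proof (exp_pos (x / 2)) as Hx. pose proof (exp_pos (y / 2)) as Hy.
  pose proof (exp_half_mono x y Hxy) as Hmono.
  rewrite !(cum_dA p) by exact Hp.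
  assert (HB : dA y <= (sqrt p * exp (y / 2)) ^ 2 / (sqrt p * exp (x / 2)) ^ 2 * dA x).
  { pose proof (dawsonA_ratio_mono (exp (x / 2)) (exp (y / 2)) Hx Hmono) as H. fold (dA x) (dA y) in H.
    apply (Rmult_le_compat_l (exp (y / 2) ^ 2)) in H; [ | apply pow2_ge_0].
    replace (exp (y / 2) ^ 2 * (dA y / exp (y / 2) ^ 2)) with (dA y) in H by (field; lra).
    replace ((sqrt p * exp (y / 2)) ^ 2 / (sqrt p * exp (x / 2)) ^ 2 * dA x)
      with (exp (y / 2) ^ 2 * (dA x / exp (x / 2) ^ 2)) by (field; lra). exact H. }
  assert (HAx : dA x < 1) by (apply (dA_lt1_mono x y); assumption).
  pose proof (dA_pos x) as HAx0.
  assert (Huv : sqrt p * exp (x / 2) <= sqrt p * exp (y / 2)) by (apply Rmult_le_compat_l; lra).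
  set (u := sqrt p * exp (x / 2)) in *. set (v := sqrt p * exp (y / 2)) in *.
  pose proof (mills_cross u v (dA x) (dA y) ltac:(lra) ltac:(lra) HB) as HM.
  apply Rmult_le_reg_l with (sqrt PI); [exact Hpi | ].
  replace (sqrt PI * (dA y * exp (- v ^ 2) / (sqrt PI * v) + erf v - (dA x * exp (- u ^ 2) / (sqrt PI * u) + erf u)))
    with ((dA y * exp (- v ^ 2) / v - sqrt PI * erfc v) - dA x * exp (- u ^ 2) / u + sqrt PI * erfc u)
    by (unfold erfc; field; lra).
  lra.
Qed.

Lemma dens_le0 (p x : R) : 0 < p -> 1 <= dA x -> dens p x <= 0.
Proof. intros Hp H. rewrite dens_base. pose proof (base_pos p x Hp). nra. Qed.

(** The decay argument needs a nonnegative density up to its last node. Terms with $A \ge 1$ are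
    nonpositive, so dropping them can only raise the sum. *)
Lemma dens_sum_positive_part (p h : R) (N M : Z) : 0 < p -> 0 < h -> (N + 1 <= M)%Z ->
  dA (IZR (N + 1) * h) < 1 ->
  exists J, (N + 1 <= J <= M)%Z /\ dA (IZR J * h) < 1 /\
    dens_sum p h (N + 1) M <= dens_sum p h (N + 1) J.
Proof.
  intros Hp Hh HM HA.
  assert (HM1 : (N + 2 <= M + 1)%Z) by lia. revert M HM1 HM.
  apply (Z_interval_ind (fun M => (N + 1 <= M)%Z -> _)).
  - intros _. exists (N + 1)%Z. replace (N + 2 - 1)%Z with (N + 1)%Z by lia.
    split; [lia | ]. split; [exact HA | apply Rle_refl].
  - intros m Hm IH _. destruct (IH ltac:(lia)) as [J [HJ [HAJ Hle]]].
    destruct (Rlt_le_dec (dA (IZR (m + 1) * h)) 1) as [H | H].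
    + exists (m + 1)%Z. split; [lia | ]. split; [exact H | apply Rle_refl].
    + exists J. split; [lia | ]. split; [exact HAJ | ].
      rewrite sum_Z_last by lia. pose proof (dens_le0 p _ Hp H). nra.
Qed.

Lemma dens_sum_upper (p h delta E : R) (N : Z) : 0 < p -> 0 < h -> 0 < delta < 1 ->
  erfc E = delta / 2 -> 10 * (1 + / p) / delta <= strip_factor h - 1 ->
  E <= sqrt p * exp (IZR N * h / 2) ->
  (dA (IZR N * h) < 1 /\ 0 <= slope p (IZR N * h)) \/
  (forall M, (N <= M)%Z ->
     dens_sum p h (N + 1) M + trapezoid_error p h <= delta / 2).
Proof.
  intros Hp Hh Hd HE HX HEv.
  assert (Hp2 : 0 < / p) by apply Rinv_0_lt_compat, Hp.
  pose proof (strip_factor_gt1 h Hh) as HX1.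
  set (th := 10 * (1 + / p) / delta / (strip_factor h - 1)).
  assert (Htr : trapezoid_error p h <= 3183 / 10000 * (th * delta)).
  { replace (th * delta) with (10 * (1 + / p) / (strip_factor h - 1)) by (unfold th; field; lra).
    apply (trapezoid_error_le p h delta); lra. }
  assert (Hth : 0 <= th <= 1).
  { assert (0 < 10 * (1 + / p) / delta) by pos.
    unfold th. split; [pos | apply div_le_of_le_mul; lra]. }
  assert (Htr2 : trapezoid_error p h <= delta / 2) by nra.
  set (x0 := IZR N * h) in *.
  (* If the first lost node lies beyond the sign change, so do all the others; the lost sum is
     nonpositive and the trapezoidal error alone fits into $\delta/2$. *)
  destruct (Rlt_le_dec (dA (IZR (N + 1) * h)) 1) as [HA1 | HA1].
  2: { right. intros M HM.
       assert (Hle : dens_sum p h (N + 1) M <= 0).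
       { replace 0 with (sum_Z (fun k => 0 * 0) (N + 1) M) by (rewrite sum_Z_scal; ring).
         apply sum_Z_le. intros k Hk. enough (dens p (IZR k * h) <= 0) by nra.
         apply dens_le0; [exact Hp | ]. apply Rnot_lt_le. intros Hc.
         assert (IZR (N + 1) <= IZR k) by (apply IZR_le; lia).
         apply (dA_lt1_mono (IZR (N + 1) * h)) in Hc; [lra | nra]. }
       lra. }
  assert (HN1 : x0 <= IZR (N + 1) * h) by (unfold x0; rewrite plus_IZR; nra).
  assert (HA0 : dA x0 < 1) by (apply (dA_lt1_mono x0 (IZR (N + 1) * h)); assumption).
  destruct (Rle_lt_dec 0 (slope p x0)) as [Hsl | Hsl]; [left; split; assumption | right].
  intros M HM.
  destruct (Z.eq_dec M N) as [-> | HMN].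
  { rewrite sum_Z_empty by lia. lra. }
  destruct (dens_sum_positive_part p h N M Hp Hh ltac:(lia) HA1) as [J [HJ [HAJ Hle]]].
  pose proof (dA_pos x0) as HA0p. pose proof (exp_pos x0) as Hu0.
  set (w := (p + 1) * exp x0).
  (* The logarithmic decay rate of [dens] is $(p+1)e^x - \frac12 + \frac{A}{2(1-A)}$, and $A/(1-A)
     \ge 2e^x$ by [dA_lower]. The maximum with 0 is allowed because the slope at [x0] is negative;
     [w] drives the growth of the first term beyond [x0], while the last one only increases. *)
  set (m := Rmax 0 (p * exp x0 + 2 * exp x0 - 1 / 2)).
  assert (Hm0 : 0 <= m) by apply Rmax_l.
  assert (Hm1 : (1 - dA x0) * (1 + 2 * m - 2 * w) <= dA x0).
  { unfold m, Rmax. destruct (Rle_dec 0 (p * exp x0 + 2 * exp x0 - 1 / 2)).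
    - unfold w. pose proof (dA_lower x0) as Hl.
      apply (Rmult_le_compat_r (1 + 2 * exp x0)) in Hl; [ | lra].
      unfold Rdiv in Hl. rewrite Rmult_assoc, Rinv_l in Hl by lra. nra.
    - unfold slope in Hsl. fold x0 in Hsl. unfold w. nra. }
  assert (HIJ : IZR (N + 1) <= IZR J) by (apply IZR_le; lia).
  pose proof (riemann_decay (dens p) (fun x => base p x * (slope p x / 2)) (cum p) h m w N J Hh) as HR.
  assert (HR2 : exp (decay_gain m w h) * dens_sum p h (N + 1) J
     <= cum p (IZR J * h) - cum p x0).
  { apply HR.
    - unfold w. nra.
    - lia.
    - intros; apply is_derive_dens.
    - intros; now apply is_derive_cum.
    - intros x Hx. fold x0 in Hx |- *. rewrite dens_base.
      assert (HAx : dA x < 1) by (apply (dA_lt1_mono x (IZR J * h)); [lra | exact HAJ]).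
      pose proof (dA_mono x0 x ltac:(lra) HAx) as HA0x. pose proof (base_pos p x Hp) as Hb.
      replace (w * (exp (x - x0) - 1)) with ((p + 1) * exp x - w).
      2: { unfold w. replace x with (x0 + (x - x0)) at 1 by ring. rewrite exp_plus. ring. }
      enough (slope p x / 2 <= - (m + ((p + 1) * exp x - w)) * (1 - dA x)) by nra.
      unfold slope. enough ((1 - dA x) * (1 + 2 * m - 2 * w) <= dA x) by nra.
      destruct (Rle_dec 0 (1 + 2 * m - 2 * w)); nra.
    - intros x Hx. rewrite dens_base.
      assert (HAx : dA x < 1) by (apply (dA_lt1_mono x (IZR J * h)); [lra | exact HAJ]).
      pose proof (base_pos p x Hp). pos. }
  pose proof (erfc_half_lower E ltac:(lra)) as HE47.
  assert (HI : cum p (IZR J * h) - cum p x0 <= delta / 2).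
  { eapply Rle_trans; [apply cum_increment_le; [exact Hp | nra | exact HAJ | fold x0 in HEv; lra] | ].
    rewrite <- HE. apply erfc_anti. exact HEv. }
  assert (Hcr : p * exp x0 * / p = exp x0) by (field; lra).
  assert (Hw : p * exp x0 * (1 + / p) = w) by (unfold w; field; lra).
  assert (Hnum : exp (- decay_gain m w h) <= 1 - 6366 / 10000 * th).
  { unfold th. rewrite <- Hw. apply (undershoot_numeric E); try assumption; rewrite ?Hcr, ?Hw.
    - rewrite <- sqrt_mul_exp_half_sqr by exact Hp. apply pow_incr. unfold x0 in *. lra.
    - apply Rnot_le_lt. intros Hc. apply (Rlt_not_le _ _ HA0). unfold dA. apply dawsonA_ge1.
      + pos.
      + rewrite exp_half_sqr. exact Hc.
    - apply Rmax_r.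
    - destruct (Rlt_le_dec (1 / 2) w) as [Hw2 | Hw2]; [left; exact Hw2 | right].
      pose proof (dA_le x0) as HAle. unfold slope in Hsl. unfold w in *. nra. }
  rewrite exp_Ropp in Hnum. pose proof (exp_pos (decay_gain m w h)) as HG.
  (* The sum is thus at most $\frac\delta2 (1 - 0.6366\,\theta)$ and the trapezoidal error at most
     $0.3183\,\theta\delta$, with $\theta$ for [th]; the two add up to at most $\delta/2$. *)
  assert (HS : dens_sum p h (N + 1) J <= delta / 2 * / exp (decay_gain m w h)).
  { apply le_div_of_mul_le; [exact HG | ]. lra. }
  nra.
Qed.

(** * Left truncation *)

(** The truncation index is given only through the value of [f_trunc], at most $\delta/2 < 1/2$, and
    not by its position. If $A \ge 1$, the value is at least 1, since $e^{-v^2}/v \ge \sqrt\pi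
    \operatorname{erfc} v$; if the slope is negative, [A] or [erf v] is so large that the value
    exceeds $1/2$. *)
Lemma dens_increasing_of_cum_le_half (p x : R) : 0 < p -> cum p x <= 1 / 2 ->
  dA x < 1 /\ 0 <= slope p x.
Proof.
  intros Hp Hc. pose proof sqrt_PI_bounds as Hpi. pose proof (sqrt_lt_R0 p Hp) as Hs.
  pose proof (exp_pos (x / 2)) as He. pose proof (dA_pos x) as HA0.
  assert (Hv : 0 < sqrt p * exp (x / 2)) by pos.
  rewrite (cum_dA p x Hp) in Hc. pose proof (sqrt_mul_exp_half_sqr p x Hp) as Hv2.
  set (v := sqrt p * exp (x / 2)) in *.
  assert (Hc2 : dA x * exp (- v ^ 2) / v + sqrt PI * erf v <= sqrt PI / 2).
  { apply (Rmult_le_compat_l (sqrt PI)) in Hc; [ | lra].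
    replace (sqrt PI * (dA x * exp (- v ^ 2) / (sqrt PI * v) + erf v)) with
      (dA x * exp (- v ^ 2) / v + sqrt PI * erf v) in Hc by (field; lra). lra. }
  pose proof (exp_pos (- v ^ 2)) as Hev.
  assert (HA1 : dA x < 1).
  { apply Rnot_le_lt. intros H. pose proof (erfc_upper v Hv) as Hu. unfold erfc in Hu.
    assert (exp (- v ^ 2) / v <= dA x * exp (- v ^ 2) / v).
    { unfold Rdiv. apply Rmult_le_compat_r; [apply Rlt_le, Rinv_0_lt_compat, Hv | nra]. }
    lra. }
  split; [exact HA1 | ]. apply Rnot_lt_le. intros Hsl.
  assert (Hg : sqrt PI * erf v = 2 * gauss v) by (rewrite erf_gauss; field; lra).
  assert (Hpos : 0 < dA x * exp (- v ^ 2) / v).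
  { apply Rdiv_lt_0_compat; [pos | exact Hv]. }
  destruct (Rle_dec (48 / 100) v) as [H48 | H48].
  - pose proof (erf_le (48 / 100) v H48) as Hm. rewrite !erf_gauss in Hm.
    destruct (gauss_taylor (48 / 100) ltac:(lra)) as [Ht _].
    assert (gauss (48 / 100) <= gauss v).
    { apply Rmult_le_reg_l with (2 / sqrt PI); [pos | exact Hm]. }
    lra.
  - apply Rnot_le_lt in H48.
    destruct (gauss_taylor v ltac:(lra)) as [Ht _].
    pose proof (exp_ineq1_le (- v ^ 2)) as Hexp.
    assert (Hr : 0 < v ^ 2 <= 2304 / 10000) by nra.
    (* In the negative slope $2(p+1)e^x = 2v^2 + 2e^x$, and $2e^x(1-A) \le A$ removes the part that
       depends on $x$ alone. *)
    assert (HA : 1 - 2 * v ^ 2 < dA x * (3 - 2 * v ^ 2)).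
    { pose proof (dA_lower x) as Hl. pose proof (exp_pos x).
      apply (Rmult_le_compat_r (1 + 2 * exp x)) in Hl; [ | lra].
      unfold Rdiv in Hl. rewrite Rmult_assoc, Rinv_l in Hl by lra.
      unfold slope in Hsl. rewrite Hv2. nra. }
    assert (HA2 : 333 / 1000 - 53 / 100 * v ^ 2 <= dA x).
    { apply Rmult_le_reg_r with (3 - 2 * v ^ 2); [lra | ]. nra. }
    assert (Hfin : dA x * exp (- v ^ 2) + sqrt PI * erf v * v <= sqrt PI / 2 * v).
    { apply (Rmult_le_compat_r v) in Hc2; [ | lra].
      replace ((dA x * exp (- v ^ 2) / v + sqrt PI * erf v) * v) with (dA x * exp (- v ^ 2) + sqrt PI * erf v * v) in Hc2
        by (field; lra). exact Hc2. }
    rewrite Hg in Hfin.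
    assert (H1 : (333 / 1000 - 53 / 100 * v ^ 2) * (1 - v ^ 2) <= dA x * exp (- v ^ 2)).
    { apply Rmult_le_compat; lra. }
    assert (H2 : 2 * (v ^ 2 - v ^ 2 * v ^ 2 / 3) <= 2 * gauss v * v) by nra.
    assert (H3 : sqrt PI / 2 * v <= 88625 / 100000 * v) by nra.
    nra.
Qed.

Lemma dens_increasing_region_mono (p x y : R) : 0 < p -> y <= x ->
  dA x < 1 /\ 0 <= slope p x -> dA y < 1 /\ 0 <= slope p y.
Proof.
  intros Hp Hyx [H1 H2]. split; [now apply (dA_lt1_mono y x) | now apply (slope_ge0_mono p x y)].
Qed.

Lemma cum_mono_of_increasing (p x y : R) : 0 < p -> y <= x -> dA x < 1 -> cum p y <= cum p x.
Proof.
  intros Hp Hyx HA. apply (derive_nonneg_le (cum p) (dens p)); [exact Hyx | | ].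
  - intros; now apply is_derive_cum.
  - intros t Ht. rewrite dens_base. pose proof (base_pos p t Hp).
    pose proof (dA_lt1_mono t x ltac:(lra) HA). pos.
Qed.

(* In the variable [v = sqrt (s / a) e^{-y/2}] the derivative of [f_trunc] changes sign
   at most once, from negative to positive. *)
Lemma trunc_profile_endpoints (A v1 v v2 : R) : 0 <= A -> 0 < v1 -> v1 <= v <= v2 ->
  A * exp (- v ^ 2) / (sqrt PI * v) + erf v <=
  Rmax (A * exp (- v1 ^ 2) / (sqrt PI * v1) + erf v1) (A * exp (- v2 ^ 2) / (sqrt PI * v2) + erf v2).
Proof.
  intros HA Hv1 Hv. pose proof sqrt_PI_pos as Hpi.
  set (q := fun v => A * exp (- v ^ 2) / (sqrt PI * v) + erf v).
  set (q' := fun v => exp (- v ^ 2) / sqrt PI * (2 - 2 * A - A / v ^ 2)).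
  assert (Hd : forall x, 0 < x -> is_derive q x (q' x)).
  { intros x Hx. unfold q, q'.
    replace (exp (- x ^ 2) / sqrt PI * (2 - 2 * A - A / x ^ 2)) with
      ((- 2 * A * exp (- x ^ 2) / sqrt PI - A * exp (- x ^ 2) / (sqrt PI * x ^ 2)) + 2 / sqrt PI * exp (- x ^ 2))
      by (field; lra).
    apply (is_derive_plus (fun v => A * exp (- v ^ 2) / (sqrt PI * v)) erf); [ | apply is_derive_erf].
    auto_derive; [apply Rgt_not_eq, Rmult_lt_0_compat; lra | simpl; field; lra]. }
  change (q v <= Rmax (q v1) (q v2)).
  assert (Hanti : forall x y, 0 < x <= y -> A / y ^ 2 <= A / x ^ 2).
  { intros x y Hxy. unfold Rdiv. apply Rmult_le_compat_l; [exact HA | ].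
    apply Rinv_le_contravar; [pos | apply pow_incr; lra]. }
  assert (He : forall x, 0 < exp (- x ^ 2) / sqrt PI) by (intros x; apply Rdiv_lt_0_compat; [apply exp_pos | exact Hpi]).
  destruct (Rle_dec (2 - 2 * A - A / v ^ 2) 0) as [H | H].
  - eapply Rle_trans; [ | apply Rmax_l].
    apply (derive_nonpos_le q q'); [lra | intros x Hx; apply Hd; lra | ].
    intros x Hx. unfold q'. pose proof (Hanti x v ltac:(lra)). pose proof (He x). nra.
  - eapply Rle_trans; [ | apply Rmax_r].
    apply (derive_nonneg_le q q'); [lra | intros x Hx; apply Hd; lra | ].
    intros x Hx. unfold q'. pose proof (Hanti v x ltac:(lra)). pose proof (He x). pos.
Qed.

Lemma f_trunc_cum (a s y : R) : 0 < a -> 0 < s -> f_trunc a s y = cum (s / a) (- y).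
Proof.
  intros Ha Hs. pose proof sqrt_PI_pos. pose proof PI_RGT_0.
  assert (Hp : 0 < s / a) by (apply Rdiv_lt_0_compat; assumption).
  pose proof (sqrt_lt_R0 _ Hp).
  unfold f_trunc, cum. f_equal. f_equal. f_equal; [ | f_equal; ring].
  replace (a / (s * PI)) with (/ (PI * (s / a))) by (field; lra).
  rewrite sqrt_inv, sqrt_mult by lra. field. lra.
Qed.

Lemma f_trunc_endpoints (a s K y : R) : 0 < a -> 1 <= s <= K ->
  f_trunc a s y <= Rmax (f_trunc a 1 y) (f_trunc a K y).
Proof.
  intros Ha Hs.
  assert (Hp : forall t, 1 <= t -> 0 < t / a) by (intros t Ht; pos).
  rewrite !f_trunc_cum, !cum_dA by (try apply Hp; lra).
  pose proof (exp_pos (- y / 2)) as He.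
  assert (Hmono : forall t u, 1 <= t <= u -> sqrt (t / a) * exp (- y / 2) <= sqrt (u / a) * exp (- y / 2)).
  { intros t u Htu. apply Rmult_le_compat_r; [lra | ]. apply sqrt_le_1_alt.
    unfold Rdiv. apply Rmult_le_compat_r; [apply Rlt_le, Rinv_0_lt_compat, Ha | lra]. }
  apply trunc_profile_endpoints.
  - left; apply dA_pos.
  - apply Rmult_lt_0_compat; [apply sqrt_lt_R0, Hp; lra | exact He].
  - split; apply Hmono; lra.
Qed.

Lemma is_lim_seq_cum_m (p h c : R) : 0 < p -> 0 < h ->
  is_lim_seq (fun n => cum p (c - INR n * h)) 0.
Proof.
  intros Hp Hh. pose proof sqrt_PI_pos as Hpi. pose proof (sqrt_lt_R0 p Hp) as Hs.
  set (k := 2 / (sqrt PI * sqrt p)).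
  assert (Hk : 0 < k) by pos.
  assert (Hinf : is_lim_seq (fun n => INR n * h - c) p_infty).
  { apply (is_lim_seq_ext (fun n => h * INR n + - c)); [intros; ring | ].
    apply (is_lim_seq_plus _ _ p_infty (- c)); [ | apply is_lim_seq_const | reflexivity].
    rewrite <- (Rbar_mult_pos_p_infty h Hh). apply is_lim_seq_scal_l, is_lim_seq_INR. }
  assert (Hcomp : forall f l, is_lim (fun T => f (exp (- T / 2))) p_infty l ->
     is_lim_seq (fun n => f (exp ((c - INR n * h) / 2))) l).
  { intros f l Hf. apply (is_lim_seq_ext (fun n => f (exp (- (INR n * h - c) / 2)))).
    { intros n. do 2 f_equal. field. }
    apply (is_lim_comp_seq (fun T => f (exp (- T / 2))) (fun n => INR n * h - c) p_infty l Hf); [ | exact Hinf].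
    exists 0%nat. intros; destruct l; discriminate. }
  apply (is_lim_seq_le_le (fun _ => 0) _
    (fun n => k * exp ((c - INR n * h) / 2) + erf (sqrt p * exp ((c - INR n * h) / 2)))).
  - intros n. split; [left; now apply cum_pos | ]. unfold cum. fold k. apply Rplus_le_compat_r.
    set (x := c - INR n * h).
    pose proof (dawson_le_taylor 0 (exp (x / 2)) ltac:(pos)) as Hd. simpl in Hd.
    pose proof (dawson_pos (exp (x / 2)) (exp_pos _)) as Hd0.
    assert (exp (- (p * exp x)) <= 1).
    { rewrite <- exp_0. apply exp_le_mono. pose proof (exp_pos x). nra. }
    pose proof (exp_pos (- (p * exp x))).
    rewrite Rmult_assoc. apply Rmult_le_compat_l; [lra | ]. nra.
  - apply is_lim_seq_const.
  - replace (Finite 0) with (Finite (k * 0 + 0)) by (f_equal; ring).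
    apply is_lim_seq_plus'.
    + apply (is_lim_seq_scal_l _ k 0). apply (Hcomp (fun z => z)), is_lim_exp_mhalf.
    + apply (Hcomp (fun z => erf (sqrt p * z))), is_lim_erf_scaled_m, Hs.
Qed.

(** * Assembly: cutoff, convergence and the three estimates *)

Lemma erfc_inv_spec (y : R) : 0 < y < 1 -> erfc (erfc_inv y) = y.
Proof.
  intros Hy.
  assert (Hex : exists b, 0 <= b /\ 1 - y <= erf b).
  { pose proof is_lim_erf as Hl. apply is_lim_spec in Hl.
    destruct (Hl (mkposreal y (proj1 Hy))) as [M HM].
    exists (Rmax 0 (M + 1)). split; [apply Rmax_l | ].
    specialize (HM (Rmax 0 (M + 1))). simpl in HM.
    assert (M < Rmax 0 (M + 1)) by (pose proof (Rmax_r 0 (M + 1)); lra).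
    apply HM in H. apply Rabs_lt_between in H. lra. }
  destruct Hex as [b [Hb0 Hb]].
  destruct (IVT_gen erf 0 b (1 - y)) as [x [_ Hx]].
  - intros t. apply continuity_pt_filterlim, (ex_derive_continuous erf). eexists. apply is_derive_erf.
  - rewrite erf_0, Rmin_left, Rmax_right by lra. lra.
  - replace y with (erfc x) at 1 by (unfold erfc; lra). rewrite erfc_invE. unfold erfc. lra.
Qed.

Lemma Phi_dens (a delta h s : R) (n : nat) : 0 < a -> 1 <= s ->
  Phi a delta h n s = sqrt s / (s + a) *
    dens_sum (s / a) h (- Z.of_nat n) (n_plus a delta h).
Proof.
  intros Ha Hs. unfold Phi. rewrite <- sum_Z_scal. apply sum_Z_ext. intros k _.
  pose proof sqrt_PI_pos. pose proof (sqrt_lt_R0 a Ha). pose proof (sqrt_lt_R0 s ltac:(lra)).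
  unfold w, alpha, dens, dawsonA.
  replace (- (/ a * exp (IZR k * h)) * s) with (- (s / a * exp (IZR k * h))) by (field; lra).
  rewrite sqrt_div_alt by lra.
  assert (Haa : a = sqrt a ^ 2) by (symmetry; apply pow2_sqrt; lra).
  set (ra := sqrt a) in *. set (e := exp (- (s / a * exp (IZR k * h)))).
  clearbody e. clearbody ra. subst a. field. repeat split; nra.
Qed.

Lemma strip_factor_lower (h a delta : R) : 0 < a -> 0 < delta ->
  0 < h <= 2 * PI ^ 2 / (3 * ln (1 + 10 * ((1 + a) / delta))) ->
  1 + 10 * ((1 + a) / delta) <= strip_factor h.
Proof.
  intros Ha Hd Hh.
  assert (HB : 0 < (1 + a) / delta) by pos.
  assert (Hln : 0 < ln (1 + 10 * ((1 + a) / delta))) by (rewrite <- ln_1; apply ln_increasing; lra).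
  rewrite <- (exp_ln (1 + 10 * ((1 + a) / delta))) at 1 by lra.
  unfold strip_factor. apply exp_le_mono. apply le_div_of_mul_le; [lra | ].
  destruct Hh as [Hh0 Hh]. apply (Rmult_le_compat_r (3 * ln (1 + 10 * ((1 + a) / delta)))) in Hh; [ | lra].
  replace (2 * PI ^ 2 / (3 * ln (1 + 10 * ((1 + a) / delta))) * (3 * ln (1 + 10 * ((1 + a) / delta))))
    with (2 * PI ^ 2) in Hh by (field; lra). lra.
Qed.

(* All terms to the left of [- n h] are nonnegative once [cum p (- n0 h) <= 1 / 2]. *)
Lemma dens_left_increment (p h : R) (N : Z) (n0 n m : nat) : 0 < p -> 0 < h ->
  cum p (- (h * INR n0)) <= 1 / 2 -> (n0 <= n)%nat -> (n <= m)%nat -> (- N <= Z.of_nat m + 1)%Z ->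
  0 <= dens_sum p h (- Z.of_nat m) N -
       dens_sum p h (- Z.of_nat n) N <= cum p (- (h * INR n0)).
Proof.
  intros Hp Hh Hc Hn Hm HN.
  pose proof (dens_increasing_of_cum_le_half p _ Hp Hc) as Hreg.
  (* The cutoff [N] may lie to the left of [- n]; the sum from [- n] is then empty, and all new
     terms end at [N] instead of [- n - 1]. *)
  set (hi := Z.min (- Z.of_nat n - 1) N).
  assert (Hsum : dens_sum p h (- Z.of_nat m) N -
       dens_sum p h (- Z.of_nat n) N
     = dens_sum p h (- Z.of_nat m) hi).
  { unfold hi. destruct (Z_le_dec (- Z.of_nat n - 1) N) as [H | H].
    - rewrite Z.min_l by exact H.
      rewrite (sum_Z_split _ (- Z.of_nat m) (- Z.of_nat n - 1) N) by lia.
      replace (- Z.of_nat n - 1 + 1)%Z with (- Z.of_nat n)%Z by lia. ring.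
    - rewrite Z.min_r by lia. rewrite (sum_Z_empty _ (- Z.of_nat n) N) by lia. ring. }
  rewrite Hsum.
  assert (Hx : (IZR hi + 1) * h <= - (h * INR n0)).
  { assert (H1 : IZR hi + 1 <= - INR n0).
    { rewrite INR_IZR_INZ, <- opp_IZR, <- plus_IZR. apply IZR_le. unfold hi. lia. }
    nra. }
  destruct (dens_increasing_region_mono p _ _ Hp Hx Hreg) as [HA Hsl].
  destruct (sum_dens_left_tail p h (- Z.of_nat m) hi Hp Hh ltac:(unfold hi; lia) HA Hsl) as [H1 H2].
  split; [exact H1 | ].
  pose proof (cum_pos p (IZR (- Z.of_nat m) * h) Hp).
  pose proof (cum_mono_of_increasing p _ _ Hp Hx (proj1 Hreg)). lra.
Qed.

Lemma dens_sum_converges (p h : R) (N : Z) : 0 < p -> 0 < h ->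
  exists l : R, is_lim_seq (fun n => dens_sum p h (- Z.of_nat n) N) l.
Proof.
  intros Hp Hh.
  set (S := fun n => dens_sum p h (- Z.of_nat n) N).
  pose proof (is_lim_seq_cum_m p h 0 Hp Hh) as Hl. apply is_lim_seq_spec in Hl.
  destruct (Hl (mkposreal (1 / 2) ltac:(lra))) as [n0 Hn0]. simpl in Hn0.
  assert (Hc : cum p (- (h * INR n0)) <= 1 / 2).
  { specialize (Hn0 n0 (Nat.le_refl _)). apply Rabs_lt_between in Hn0.
    replace (0 - INR n0 * h) with (- (h * INR n0)) in Hn0 by ring. lra. }
  (* Beyond [n1] the partial sums are monotone and bounded; the shift guarantees [- m <= N + 1] also
     for a negative cutoff. *)
  set (n1 := (n0 + Z.to_nat (- N))%nat).
  destruct (ex_finite_lim_seq_incr (fun n => S (n + n1)%nat) (S n1 + 1 / 2)) as [l Hlim].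
  - intros n. destruct (dens_left_increment p h N n0 (n + n1) (Datatypes.S n + n1) Hp Hh Hc) as [H _];
      try (unfold n1; lia). unfold S. lra.
  - intros n. destruct (dens_left_increment p h N n0 n1 (n + n1) Hp Hh Hc) as [_ H];
      try (unfold n1; lia). unfold S. lra.
  - exists l. apply (is_lim_seq_incr_n S n1). exact Hlim.
Qed.

Lemma dens_limit_bounds (p h delta E l : R) (N : Z) : 0 < p -> 0 < h -> 0 < delta < 1 ->
  erfc E = delta / 2 -> 10 * (1 + / p) / delta <= strip_factor h - 1 ->
  E <= sqrt p * exp (IZR N * h / 2) ->
  is_lim_seq (fun n => dens_sum p h (- Z.of_nat n) N) l ->
  1 - delta / 2 <= l <= 1 + delta.
Proof.
  intros Hp Hh Hd HE HX HEv Hlim.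
  pose proof (erfc_half_lower E ltac:(lra)) as HE47.
  destruct (trapezoid_dens p h Hp Hh) as [t [Ht HT]].
  set (f := fun k => h * dens p (IZR k * h)) in *.
  assert (Hsplit : forall K : nat, (Z.abs N <= Z.of_nat K)%Z ->
    Rabs (sum_Z f (- Z.of_nat K) N + sum_Z f (N + 1) (Z.of_nat K) - 1) <= trapezoid_error p h + t K).
  { intros K HK. rewrite <- sum_Z_split by lia. specialize (HT K). rewrite <- sum_Z_scal in HT. exact HT. }
  split.
  - destruct (dens_sum_upper p h delta E N Hp Hh Hd HE HX HEv) as [[HA Hsl] | Hup].
    + assert (Herf : 1 - delta / 2 <= cum p (IZR N * h)).
      { rewrite (cum_dA p) by exact Hp.
        pose proof (erf_le E _ HEv) as Hm. unfold erfc in HE.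
        assert (Hv : 0 < sqrt p * exp (IZR N * h / 2)) by lra.
        pose proof sqrt_PI_pos.
        assert (0 < dA (IZR N * h) * exp (- (sqrt p * exp (IZR N * h / 2)) ^ 2) / (sqrt PI * (sqrt p * exp (IZR N * h / 2)))).
        { apply Rdiv_lt_0_compat; [apply Rmult_lt_0_compat; [apply dA_pos | apply exp_pos] | ].
          pos. }
        lra. }
      apply (is_lim_seq_le_loc (fun K => 1 - delta / 2 - cum p (- h - INR K * h)) (fun K => sum_Z f (- Z.of_nat K) N)
         (1 - delta / 2 - 0) l) in Hlim.
      * simpl in Hlim. lra.
      * exists (Z.to_nat (Z.abs N)). intros K HK.
        pose proof (sum_dens_increasing p h (- Z.of_nat K) N Hp Hh ltac:(lia) HA Hsl) as H.
        replace ((IZR (- Z.of_nat K) - 1) * h) with (- h - INR K * h) in H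
          by (rewrite opp_IZR, <- INR_IZR_INZ; ring).
        fold f in H. lra.
      * apply is_lim_seq_minus'; [apply is_lim_seq_const | now apply is_lim_seq_cum_m].
    + apply (is_lim_seq_le_loc (fun K => 1 - delta / 2 - t K) (fun K => sum_Z f (- Z.of_nat K) N)
         (1 - delta / 2 - 0) l) in Hlim.
      * simpl in Hlim. lra.
      * exists (Z.to_nat (Z.abs N)). intros K HK.
        pose proof (Hsplit K ltac:(lia)) as H. apply Rabs_le_between in H.
        pose proof (Hup (Z.of_nat K) ltac:(lia)) as H2. fold f in H2. lra.
      * apply is_lim_seq_minus'; [apply is_lim_seq_const | exact Ht].
  - apply (is_lim_seq_le_loc (fun K => sum_Z f (- Z.of_nat K) N) (fun K => 1 + delta + t K) l (1 + delta + 0)) in Hlim.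
    + simpl in Hlim. lra.
    + exists (Z.to_nat (Z.abs N)). intros K HK.
      pose proof (Hsplit K ltac:(lia)) as H. apply Rabs_le_between in H.
      pose proof (dens_sum_lower p h E N (Z.of_nat K) Hp Hh HE47 ltac:(lia) HEv) as H2. fold f in H2.
      pose proof (overshoot_numeric p h delta E Hp Hh Hd HE HX). lra.
    + apply is_lim_seq_plus'; [apply is_lim_seq_const | exact Ht].
Qed.

Theorem theorem4p1 : forall a delta h : R,
  0 < a ->
  0 < delta < 1 ->
  0 < h <= 2 * PI ^ 2 / (3 * ln (1 + 10 * ((1 + a) / delta))) ->
  (forall s : R, 1 <= s ->
     ex_finite_lim_seq (fun n => Phi a delta h n s) /\
     Rabs (sqrt s / (s + a) - Phi_inf a delta h s)
       <= delta * (sqrt s / (s + a))) /\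
  (forall eta K : R, 0 < eta -> 1 < K ->
     exists n0 : nat,
       is_min_nat (fun m => Rmax (f_trunc a 1 (h * INR m)) (f_trunc a K (h * INR m))
                              <= Rmin (delta / 2) eta) n0 /\
       forall n : nat, (n0 <= n)%nat ->
         (forall s : R, 1 <= s <= K ->
            Rabs (sqrt s / (s + a) - Phi a delta h n s)
              <= delta * (sqrt s / (s + a))) /\
         (forall s : R, 1 <= s <= K ->
            Rabs (Phi_inf a delta h s - Phi a delta h n s)
              <= eta * (sqrt s / (s + a)))).
Proof.
  intros a delta h Ha Hd Hh.
  set (N := n_plus a delta h). set (E := erfc_inv (delta / 2)).
  set (S := fun s n => dens_sum (s / a) h (- Z.of_nat n) N).
  assert (HE : erfc E = delta / 2) by (apply erfc_inv_spec; lra).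
  pose proof (erfc_half_lower E ltac:(lra)) as HE47.
  assert (Hp : forall s, 1 <= s -> 0 < s / a) by (intros s Hs; pos).
  assert (Hrel : forall s, 1 <= s -> 0 < sqrt s / (s + a)).
  { intros s Hs. apply Rdiv_lt_0_compat; [apply sqrt_lt_R0; lra | lra]. }
  (* Here $s \ge 1$ enters: $1 + 1/p = 1 + a/s \le 1 + a$, so one $h$ serves all $s$. *)
  assert (HX : forall s, 1 <= s -> 10 * (1 + / (s / a)) / delta <= strip_factor h - 1).
  { intros s Hs. pose proof (strip_factor_lower h a delta Ha ltac:(lra) Hh) as HX.
    enough (10 * (1 + / (s / a)) / delta <= 10 * ((1 + a) / delta)) by lra.
    unfold Rdiv at 1 3. rewrite <- Rmult_assoc. apply Rmult_le_compat_r; [pos | ].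
    enough (/ (s / a) <= a) by lra. replace (/ (s / a)) with (a / s) by (field; lra).
    apply div_le_of_le_mul; nra. }
  (* The ceiling gives $e^{Nh/2} \ge \sqrt a\, E$, and $\sqrt{s/a} \ge 1/\sqrt a$ for $s \ge 1$. *)
  assert (HEv : forall s, 1 <= s -> E <= sqrt (s / a) * exp (IZR N * h / 2)).
  { intros s Hs. pose proof (sqrt_lt_R0 a Ha) as Hsa.
    assert (HN : sqrt a * E <= exp (IZR N * h / 2)).
    { rewrite <- (exp_ln (sqrt a * E)) by pos. apply exp_le_mono.
      destruct (Zceil_bound (2 * / h * ln (sqrt a * E))) as [_ Hc]. fold E N in Hc.
      apply (Rmult_le_compat_r (h / 2)) in Hc; [ | lra].
      replace (2 * / h * ln (sqrt a * E) * (h / 2)) with (ln (sqrt a * E)) in Hc by (field; lra).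
      unfold Rdiv in *. rewrite Rmult_assoc. exact Hc. }
    rewrite sqrt_div_alt by lra.
    assert (1 <= sqrt s) by (rewrite <- sqrt_1; apply sqrt_le_1_alt; lra).
    apply Rle_trans with (sqrt s / sqrt a * (sqrt a * E)).
    - replace (sqrt s / sqrt a * (sqrt a * E)) with (sqrt s * E) by (field; lra). nra.
    - apply Rmult_le_compat_l; [pos | exact HN]. }
  assert (HPhi : forall s n, 1 <= s -> Phi a delta h n s = sqrt s / (s + a) * S s n).
  { intros s n Hs. now apply Phi_dens. }
  assert (Hlim : forall s, 1 <= s -> exists l : R, is_lim_seq (S s) l /\
     is_lim_seq (fun n => Phi a delta h n s) (sqrt s / (s + a) * l) /\
     Phi_inf a delta h s = sqrt s / (s + a) * l /\ 1 - delta / 2 <= l <= 1 + delta).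
  { intros s Hs. destruct (dens_sum_converges (s / a) h N (Hp s Hs) ltac:(lra)) as [l Hl].
    assert (HPl : is_lim_seq (fun n => Phi a delta h n s) (sqrt s / (s + a) * l)).
    { apply (is_lim_seq_ext (fun n => sqrt s / (s + a) * S s n)); [intros n; now rewrite HPhi | ].
      apply (is_lim_seq_scal_l (S s) (sqrt s / (s + a)) l Hl). }
    exists l. split; [exact Hl | ]. split; [exact HPl | ]. split.
    - unfold Phi_inf. now rewrite (is_lim_seq_unique _ _ HPl).
    - apply (dens_limit_bounds (s / a) h delta E l N); auto. lra. }
  split.
  - intros s Hs. destruct (Hlim s Hs) as [l [_ [HPl [HPi Hl]]]]. pose proof (Hrel s Hs) as Hr. split.
    + exists (sqrt s / (s + a) * l). exact HPl.
    + rewrite HPi. set (r := sqrt s / (s + a)) in *. apply Rabs_le. split; nra.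
  - intros eta K Heta HK.
    set (P := fun m => Rmax (f_trunc a 1 (h * INR m)) (f_trunc a K (h * INR m)) <= Rmin (delta / 2) eta).
    assert (HPex : exists m, P m).
    { set (eps := Rmin (delta / 2) eta). assert (Heps : 0 < eps) by (apply Rmin_pos; lra).
      assert (Hev : forall s, 1 <= s -> exists M, forall m, (M <= m)%nat -> f_trunc a s (h * INR m) <= eps).
      { intros s Hs. pose proof (is_lim_seq_cum_m (s / a) h 0 (Hp s Hs) ltac:(lra)) as Hl.
        apply is_lim_seq_spec in Hl. destruct (Hl (mkposreal eps Heps)) as [M HM]. exists M.
        intros m Hm. rewrite f_trunc_cum by lra. specialize (HM m Hm). simpl in HM.
        replace (- (h * INR m)) with (0 - INR m * h) by ring. apply Rabs_lt_between in HM. lra. }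
      destruct (Hev 1 ltac:(lra)) as [M1 H1]. destruct (Hev K ltac:(lra)) as [M2 H2].
      exists (M1 + M2)%nat. apply Rmax_lub; [apply H1 | apply H2]; lia. }
    destruct (dec_inh_nat_subset_has_unique_least_element P) as [n0 [[HP0 Hmin] _]]; [ | exact HPex | ].
    { intros m. unfold P. destruct (Rle_dec (Rmax (f_trunc a 1 (h * INR m)) (f_trunc a K (h * INR m)))
        (Rmin (delta / 2) eta)); [left | right]; assumption. }
    exists n0. split; [split; [exact HP0 | exact Hmin] | ].
    intros n Hn.
    (* Left truncation only lowers the sum. Hence the upper bound $1 + \delta$ is inherited from the
       limit, and the loss of at most $\delta/2$ turns $1 - \delta/2$ into $1 - \delta$. *)
    assert (Hinc : forall s, 1 <= s <= K -> exists l : R, 1 - delta / 2 <= l <= 1 + delta /\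
       Phi_inf a delta h s = sqrt s / (s + a) * l /\
       0 <= l - S s n <= Rmin (delta / 2) eta).
    { intros s Hs. destruct (Hlim s ltac:(lra)) as [l [Hl [_ [HPi Hlb]]]]. exists l.
      split; [exact Hlb | ]. split; [exact HPi | ].
      pose proof (f_trunc_endpoints a s K (h * INR n0) Ha Hs) as Hf.
      assert (Hc : cum (s / a) (- (h * INR n0)) <= Rmin (delta / 2) eta).
      { rewrite <- f_trunc_cum by lra. eapply Rle_trans; [exact Hf | exact HP0]. }
      assert (Hc2 : cum (s / a) (- (h * INR n0)) <= 1 / 2).
      { pose proof (Rmin_l (delta / 2) eta). lra. }
      assert (Hstep : forall m, (n + Z.to_nat (- N) <= m)%nat ->
        0 <= S s m - S s n <= cum (s / a) (- (h * INR n0))).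
      { intros m Hm. apply (dens_left_increment (s / a) h N n0 n m); auto; try lia; try lra. apply Hp; lra. }
      assert (Hdl : is_lim_seq (fun m => S s m - S s n) (l - S s n)).
      { apply is_lim_seq_minus'; [exact Hl | apply is_lim_seq_const]. }
      split.
      - apply (is_lim_seq_le_loc (fun _ => 0) (fun m => S s m - S s n) 0 (l - S s n)); [ | apply is_lim_seq_const | exact Hdl].
        exists (n + Z.to_nat (- N))%nat. intros m Hm. apply Hstep, Hm.
      - eapply Rle_trans; [ | exact Hc].
        apply (is_lim_seq_le_loc (fun m => S s m - S s n) (fun _ => cum (s / a) (- (h * INR n0)))
          (l - S s n) (cum (s / a) (- (h * INR n0)))); [ | exact Hdl | apply is_lim_seq_const].
        exists (n + Z.to_nat (- N))%nat. intros m Hm. apply Hstep, Hm. }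
    pose proof (Rmin_l (delta / 2) eta) as Hm1. pose proof (Rmin_r (delta / 2) eta) as Hm2.
    split; intros s Hs; destruct (Hinc s Hs) as [l [Hl [HPi Hls]]]; rewrite ?HPi, HPhi by lra;
      pose proof (Hrel s ltac:(lra)) as Hr; set (r := sqrt s / (s + a)) in *; apply Rabs_le; split; nra.
Qed.
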